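(* Let $1<p<\infty$ and let $\varphi\in L^1_{\mathrm{loc}}(\mathbb{R}_+)$. Then the following conditions are equivalent: (i) $Q_\varphi\in\boldsymbol{S}_p$; (ii) $Q^+_\varphi\in\boldsymbol{S}_p$; (iii) $\varphi\in X_p$.
   Context: $\mathbb{R}_+=(0,\infty)$, and ''loc'' refers to compact subsets of $(0,\infty)$. For a locally integrable complex-valued function $\varphi$ on $\mathbb{R}_+$, the operators $Q_\varphi$ and $Q_\varphi^+$ are defined on bounded functions $f$ with compact support in $\mathbb{R}_+$ by $$(Q_\varphi f)(x)=\int_0^\infty\varphi(\max\{x,y\})f(y)\,dy,\qquad (Q^+_\varphi f)(x)=\varphi(x)\int_0^x f(y)\,dy .$$ $\boldsymbol{S}_p$ is the Schatten--von Neumann class: bounded operators $T$ with $\sum_{n\ge0}s_n(T)^p<\infty$, where $s_n(T)=\inf\{\|T-R\|:\operatorname{rank}R\le n\}$. Writing that $Q_\varphi$ (or $Q_\varphi^+$) belongs to $\boldsymbol{S}_p$ means that it extends to a bounded operator on $L^2(\mathbb{R}_+)$ and the extension is in $\boldsymbol{S}_p$. For $0<p<\infty$, $X_p$ is the space of all measurable functions $\varphi$ on $\mathbb{R}_+$ such that $$\sum_{n\in\mathbb{Z}}2^{np/2}\Bigl(\int_{2^n}^{2^{n+1}}|\varphi(x)|^2dx\Bigr)^{p/2}<\infty .$$ *)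

(* Defs.v *)
From HB Require Import structures.
From mathcomp Require Import all_boot all_order all_algebra.
From mathcomp Require Import all_classical all_reals all_analysis.
From mathcomp Require Import complex.

Set Implicit Arguments.
Unset Strict Implicit.
Unset Printing Implicit Defensive.
Import Order.TTheory GRing.Theory Num.Theory.
Import numFieldNormedType.Exports.
Local Open Scope classical_set_scope.
Local Open Scope ring_scope.
Local Open Scope complex_scope.

Section Defs.
Context {R : realType}.
Local Notation C := (complex R).
Local Notation leb := (@lebesgue_measure R).
Implicit Types (f g phi : R -> C) (D : set R) (p : R).

(* Functions on (0, +oo) are represented by total functions R -> C; their values
   outside Rplus never matter. *)
Definition Rplus : set R := `]0, +oo[.

(* The modulus as an element of R; `|z| would be an element of C. *)
Definition cmod (z : C) : R := ComplexField.Normc.normc z.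

(* Borel measurability of both parts, i.e. a Borel representative of the a.e. class. *)
Definition cmeasurable D f : Prop :=
  measurable_fun D (fun x => complex.Re (f x)) /\
  measurable_fun D (fun x => complex.Im (f x)).

Definition cintegral D f : C :=
  (\int[leb]_(x in D) complex.Re (f x))%R +i*
  (\int[leb]_(x in D) complex.Im (f x))%R.

Definition L1loc phi : Prop :=
  cmeasurable Rplus phi /\
  forall K : set R, compact K -> K `<=` Rplus ->
    (\int[leb]_(x in K) (cmod (phi x))%:E < +oo)%E.

Definition aeq f g : Prop := f = g %[ae leb in Rplus].

Definition L2norm f : \bar R :=
  'N[leb]_(2%:E)[EFin \o ((fun x => cmod (f x)) \_ Rplus)]%E.

Definition L2 f : Prop := cmeasurable Rplus f /\ (L2norm f < +oo)%E.

(* Operators on the Hilbert space L^2(Rplus) act on representatives, with all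
   identities read almost everywhere.  Linearity and finiteness of the operator
   norm force an operator to respect a.e. equality, so that it descends to the
   quotient. *)
Definition operator := (R -> C) -> (R -> C).

Definition opnorm (T : operator) : \bar R :=
  ereal_sup [set L2norm (T f) | f in [set f | L2 f /\ (L2norm f <= 1)%E]].

Definition bounded_operator (T : operator) : Prop :=
  [/\ forall f, L2 f -> L2 (T f),
      forall (a : C) f g, L2 f -> L2 g ->
        aeq (T (fun x => a * f x + g x)) (fun x => a * T f x + T g x) &
      (opnorm T < +oo)%E].

Definition rank_le (n : nat) (A : operator) : Prop :=
  exists2 e : 'I_n -> R -> C, forall i, L2 (e i) &
    forall f, L2 f -> exists c : 'I_n -> C,
      aeq (A f) (fun x => \sum_(i < n) c i * e i x).

Definition singular_number (n : nat) (T : operator) : \bar R :=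
  ereal_inf [set opnorm (fun f x => T f x - A f x)
            | A in [set A | bounded_operator A /\ rank_le n A]].

Definition schatten p (T : operator) : Prop :=
  bounded_operator T /\
  (\sum_(0 <= n <oo) (singular_number n T) `^ p < +oo)%E.

Definition bounded_compact_support f : Prop :=
  [/\ cmeasurable Rplus f,
      exists M : R, forall x, Rplus x -> cmod (f x) <= M &
      exists K : set R, [/\ compact K, K `<=` Rplus &
        forall x, Rplus x -> ~ K x -> f x = 0]].

(* An operator Q given on bounded functions with compact support in Rplus
   belongs to S_p. *)
Definition in_schatten p (Q : operator) : Prop :=
  exists2 T : operator, schatten p T &
    forall f, bounded_compact_support f -> aeq (T f) (Q f).

Definition Qop phi : operator := fun f x =>
  cintegral Rplus (fun y => phi (Num.max x y) * f y).

Definition Qop_plus phi : operator := fun f x =>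
  phi x * cintegral `]0, x[ f.

Definition Xspace p phi : Prop :=
  cmeasurable Rplus phi /\
  (\esum_(n in [set: int])
     ((2 `^ (n%:~R * p / 2))%:E *
      (\int[leb]_(x in `[(2 : R) ^ n, (2 : R) ^ (n + 1)])
         ((cmod (phi x)) ^+ 2)%:E) `^ (p / 2)) < +oo)%E.

End Defs.

(* Main.v *)
Require Import Defs.
From mathcomp Require Import all_boot all_order all_algebra.
From mathcomp Require Import all_classical all_reals all_analysis.
From mathcomp Require Import complex measurable_realfun.
From mathcomp Require Import ring lra.
Set Implicit Arguments.
Unset Strict Implicit.
Unset Printing Implicit Defensive.
Import Order.TTheory GRing.Theory Num.Theory.
Import numFieldNormedType.Exports.
Local Open Scope classical_set_scope.
Local Open Scope ring_scope.
Local Open Scope complex_scope.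

(** Put sigma_n = 2^(n/2) |phi|_n, where |phi|_n is the L^2 norm of phi on the dyadic
    interval I_n = [2^n, 2^(n+1)[. Then phi is in X_p exactly when the sum of the
    sigma_n^p is finite. Both operators are integral operators, with the kernel
    phi(x) 1_(y<x) for Q^+ and phi(x) 1_(y<x) + phi(y) 1_(x<=y) for Q (kernelQ).

    Sufficiency. Fix eps > 0. Only finitely many sigma_n reach eps (finite_level); cut
    each such I_n into k_n = floor(sigma_n / eps) pieces J for which |J| times the
    integral of |phi|^2 over J is at most (sigma_n / k_n)^2 <= 4 eps^2 (equipartition).
    For x in a piece J with left end point a, replace 1_(y<x) by 1_(y<a): the kernel so
    obtained has rank at most one per piece, or two for Q. What is left consists of the
    kernel cut off to the intervals with sigma_n < eps, whose operator norm is O(eps) by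
    a weighted Hardy inequality (hardy_bound, hardy_dual_bound), and of a kernel that
    lives on the squares J x J, of operator norm at most 2 eps (block_bound,
    block_dual_bound); all these norm estimates are instances of the Schur test (schur).
    So s_(2N)(T) <= 24 eps, where N is the number of pairs (n, i), i >= 1, with
    sigma_n / i >= eps (kernelQ_approximation). Such a counting bound forces the p-th
    powers of the singular numbers to be summable as soon as those of the numbers
    sigma_n / i are (sum_powR_le_count), and these have the sum
    (sum_i i^(-p)) (sum_n sigma_n^p), which is finite because p > 1.

    Necessity. Let e_n be the normalized indicator of I_(n-1). On I_n both Q and Q^+ map
    e_n to 2^((n-1)/2) phi, because the support of e_n lies to the left of I_n. Pairing
    with the normalized conjugate of phi on I_n shows that T has the diagonal entry
    sigma_n / sqrt 2 at n with respect to two orthonormal systems. For a finite set of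
    indices let B be the matrix of T between the two systems. By the singular value
    decomposition and convexity of x^p, the sum of the |B_nn|^p is at most that of the
    t_k^p, where the t_k are the singular values of B (sum_diag_le), and t_k in
    decreasing order is bounded by a constant times s_k(T) (singular_number_ge). Hence the
    sum of the sigma_n^p over every finite set of indices is at most a constant times the
    sum of the s_k(T)^p. *)

(** * The modulus of a complex number *)

Section Cmod.
Context {R : realType}.
Local Notation C := (complex R).
Implicit Types z w : C.

Lemma cmodE z : `|z| = (cmod z)%:C.
Proof. by []. Qed.

Lemma cmod_ge0 z : 0 <= cmod z.
Proof. by rewrite -ler0c -cmodE. Qed.

Lemma cmodM z w : cmod (z * w) = cmod z * cmod w.
Proof. by apply: complexI; rewrite /= rmorphM /= -!cmodE normrM. Qed.

Lemma cmodD z w : cmod (z + w) <= cmod z + cmod w.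
Proof. by rewrite -lecR rmorphD /= -!cmodE ler_normD. Qed.

Lemma cmod0 : cmod (0 : C) = 0.
Proof. by apply: complexI; rewrite -cmodE normr0. Qed.

Lemma cmodR (x : R) : 0 <= x -> cmod x%:C = x.
Proof. by move=> x0; apply: complexI; rewrite -cmodE ger0_norm // ler0c. Qed.

Lemma cmod_sqr z : cmod z ^+ 2 = complex.Re z ^+ 2 + complex.Im z ^+ 2.
Proof.
case: z => a b; rewrite /cmod /= sqr_sqrtr //.
by rewrite addr_ge0 ?sqr_ge0.
Qed.

Lemma cmod_sum I (r : seq I) (P : pred I) (F : I -> C) :
  cmod (\sum_(i <- r | P i) F i) <= \sum_(i <- r | P i) cmod (F i).
Proof.
elim/big_ind2: _ => [|x1 x2 y1 y2 h1 h2|//]; first by rewrite cmod0.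
by rewrite (le_trans (cmodD _ _)) ?lerD.
Qed.

Lemma cmod_mulconj z : z * z^* = (cmod z ^+ 2)%:C.
Proof. by rewrite -normCK cmodE rmorphXn. Qed.

Lemma conjRC (x : R) : (x%:C)^* = x%:C :> C.
Proof. exact: conjc_real. Qed.

Lemma conjMRC (x : R) z : (x%:C * z)^* = x%:C * z^*.
Proof. by rewrite rmorphM -[in RHS](conjRC x). Qed.

End Cmod.

(** * Singular values and diagonal entries of a matrix *)

Section SVD.
Local Open Scope sesquilinear_scope.
Context {R : realType}.
Local Notation C := (complex R).

Lemma gram_diag m n (W : 'M[C]_(m, n)) (k l : 'I_m) :
  (W *m W ^t*) k l = \sum_j W k j * (W l j)^*.
Proof. by rewrite mxE; apply: eq_bigr => j _; rewrite !mxE. Qed.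

(** P diagonalizes the product of B with its adjoint, so the rows of P B are
    orthogonal and their lengths are the singular values of B. The decomposition
    is left in this form, B = P^-1 W, since normalizing the rows of W would mean
    choosing vectors for the zero singular values. *)
Lemma svd M (B : 'M[C]_M) : exists (P W : 'M[C]_M) (t : 'I_M -> R),
  [/\ P *m P^t* = 1%:M, P *m B = W, forall k, 0 <= t k &
      W *m W ^t* = diag_mx (\row_k ((t k) ^+ 2)%:C)].
Proof.
pose A := B *m B ^t*.
have hA : A \is normalmx.
  by apply/normalmxP; rewrite /A !trmx_mul !map_mxM /= trmxCK.
pose P := spectralmx A; pose D := spectral_diag A.
have PU : P *m P^t* = 1%:M by apply/unitarymxP/spectral_unitarymx.
have PE : A = P^t* *m diag_mx D *m P.
  rewrite -(invmx_unitary (spectral_unitarymx A)).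
  by apply/orthomx_spectralP.
have WE : (P *m B) *m (P *m B)^t* = diag_mx D.
  rewrite trmx_mul map_mxM /= mulmxA -(mulmxA P) -/A PE.
  by rewrite !mulmxA PU mul1mx -mulmxA PU mulmx1.
pose W := P *m B.
have Dk k : D 0 k = (\sum_j (cmod (W k j)) ^+ 2)%:C.
  have := congr1 (fun X : 'M[C]_M => X k k) WE; rewrite /= gram_diag [RHS]mxE eqxx mulr1n.
  by move=> <-; rewrite rmorph_sum; apply: eq_bigr => j _; rewrite cmod_mulconj.
exists P, W, (fun k => Num.sqrt (\sum_j (cmod (W k j)) ^+ 2)); split => //.
rewrite WE; congr diag_mx; apply/rowP => k.
by rewrite !mxE sqr_sqrtr -?Dk// sumr_ge0// => j _; rewrite sqr_ge0.
Qed.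

(** Pythagoras for the orthogonal rows of W. It is used for W as in svd and, with
    t = 1, for a unitary matrix. *)
Lemma sum_sqr_mulmx M (W : 'M[C]_M) (t : 'I_M -> R) (x : 'rV[C]_M) :
  W *m W ^t* = diag_mx (\row_k ((t k) ^+ 2)%:C) ->
  \sum_n cmod ((x *m W) 0 n) ^+ 2 = \sum_k cmod (x 0 k) ^+ 2 * t k ^+ 2.
Proof.
move=> h; apply: complexI.
have : (x *m W) *m (x *m W)^t* = x *m diag_mx (\row_k ((t k) ^+ 2)%:C) *m x^t*.
  by rewrite trmx_mul map_mxM /= !mulmxA -(mulmxA x) h.
move/(congr1 (fun X : 'M[C]_1 => X 0 0)); rewrite /= gram_diag => e.
rewrite rmorph_sum (eq_bigr _ (fun j _ => esym (cmod_mulconj _))) e.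
rewrite mxE rmorph_sum; apply: eq_bigr => k _.
by rewrite mul_mx_diag !mxE mulrAC cmod_mulconj [RHS]rmorphM.
Qed.

Lemma row_sum M (U : 'M[C]_M) (k : 'I_M) (a : R):
  (U *m U ^t*) k k = a%:C -> \sum_n cmod (U k n) ^+ 2 = a.
Proof.
rewrite gram_diag => e; apply: complexI; rewrite -e rmorph_sum.
by apply: eq_bigr => j _; rewrite cmod_mulconj.
Qed.

(** The rows of U are orthonormal or zero (b tells which), so the product G of the
    adjoint of U with U is an orthogonal projection. Its diagonal entry g = G n n
    is the sum of the |G n k|^2, in particular g^2 <= g, and g is the sum to be
    bounded. *)
Lemma col_sum M (U : 'M[C]_M) (b : 'I_M -> bool) (n : 'I_M) :
  U *m U ^t* = diag_mx (\row_k (b k)%:R) ->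
  \sum_k cmod (U k n) ^+ 2 <= 1.
Proof.
move=> UU.
have EU : diag_mx (\row_k (b k)%:R) *m U = U.
  apply/matrixP => k j; rewrite mul_diag_mx !mxE; case: (boolP (b k)) => bk.
    by rewrite mul1r.
  rewrite mul0r.
  have /row_sum h : (U *m U ^t*) k k = (0 : R)%:C.
    by rewrite UU !mxE eqxx (negbTE bk).
  have : cmod (U k j) ^+ 2 = 0.
    by apply/eqP; rewrite eq_sym; move/eqP: h; rewrite psumr_eq0 => [|i _];
      [move=> /allP/(_ j); rewrite mem_index_enum eq_sym => /(_ isT) | rewrite sqr_ge0].
  move/eqP; rewrite sqrf_eq0 => /eqP h0; apply/esym.
  by apply/eqP; rewrite -normr_eq0 cmodE h0.
pose G := U^t* *m U.
have GG : G *m G^t* = G.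
  by rewrite /G trmx_mul map_mxM /= trmxCK !mulmxA -(mulmxA (U^t*) U) UU -mulmxA EU.
set S := (X in X <= _).
have GS : G n n = S%:C.
  rewrite /G mxE rmorph_sum; apply: eq_bigr => k _; rewrite !mxE mulrC.
  by rewrite cmod_mulconj.
have S0 : 0 <= S by rewrite sumr_ge0// => k _; rewrite sqr_ge0.
have : \sum_k cmod (G n k) ^+ 2 = S by apply: row_sum; rewrite GG.
rewrite (bigD1 n)//= GS cmodR// => e.
have : S ^+ 2 <= S.
  by rewrite -[leRHS]e lerDl sumr_ge0// => k _; rewrite sqr_ge0.
move=> h; rewrite leNgt; apply/negP => S1.
have : S < S ^+ 2 by rewrite expr2 ltr_pMl// (lt_trans ltr01).
by rewrite ltNge h.
Qed.

(** The graph of x^p lies above its tangent at d; in this form it is Young's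
    inequality for s and d^(p-1). *)
Lemma powR_tangent (p s d : R) : 1 < p -> 0 <= s -> 0 <= d ->
  p * (s * d `^ (p - 1)) <= s `^ p + (p - 1) * d `^ p.
Proof.
move=> p1 s0 d0.
have p0 : 0 < p by rewrite (lt_trans ltr01).
have pm0 : 0 < p - 1 by rewrite subr_gt0.
have := @conjugate_powR R s (d `^ (p - 1)) p (p / (p - 1)) s0 (powR_ge0 _ _) p0.
rewrite divr_gt0// => /(_ isT) h.
have e : p^-1 + (p / (p - 1))^-1 = 1 by field; rewrite !gt_eqF.
move: (h e); rewrite -powRrM mulrCA divff ?gt_eqF// mulr1 => h'.
have := ler_wpM2l (ltW p0) h'.
rewrite (_ : p * (s `^ p / p + d `^ p / (p / (p - 1))) = s `^ p + (p - 1) * d `^ p) //.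
by field; rewrite !gt_eqF.
Qed.

(** Weigh the tangent inequality at d = sum_i s i * a i by the a i and add up. The
    total weight may be less than 1 because x^p vanishes at 0. *)
Lemma jensen_substoch (I : finType) (p : R) (s a : I -> R) : 1 < p ->
  (forall i, 0 <= s i) -> (forall i, 0 <= a i) -> \sum_i a i <= 1 ->
  (\sum_i s i * a i) `^ p <= \sum_i (s i) `^ p * a i.
Proof.
move=> p1 s0 a0 a1; set d := \sum_i s i * a i.
have d0 : 0 <= d by rewrite sumr_ge0// => i _; rewrite mulr_ge0.
have : \sum_i a i * (p * (s i * d `^ (p - 1))) <=
       \sum_i a i * (s i `^ p + (p - 1) * d `^ p).
  by apply: ler_sum => i _; rewrite ler_wpM2l// powR_tangent.
have -> : \sum_i a i * (p * (s i * d `^ (p - 1))) = p * d `^ p.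
  have [->|dn0] := eqVneq d 0.
    have pn : p != 0 by rewrite gt_eqF// (lt_trans ltr01).
    have pn1 : p - 1 != 0 by rewrite gt_eqF// subr_gt0.
    by rewrite !powR0// mulr0 big1// => i _; rewrite !mulr0.
  have -> : d `^ p = d * d `^ (p - 1).
    rewrite -{2}(powRr1 d0) -powRD; first by congr powR; ring.
    by rewrite dn0 implybT.
  rewrite mulrA {2}/d mulr_sumr mulr_suml; apply: eq_bigr => i _.
  by rewrite !mulrA; congr (_ * _); ring.
have -> : \sum_i a i * (s i `^ p + (p - 1) * d `^ p) =
   \sum_i s i `^ p * a i + (\sum_i a i) * ((p - 1) * d `^ p).
  rewrite mulr_suml -big_split; apply: eq_bigr => i _ /=.
  by rewrite mulrDr mulrC.
have dp0 : 0 <= d `^ p by rewrite powR_ge0.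
have : (\sum_i a i) * ((p - 1) * d `^ p) <= (p - 1) * d `^ p.
  by rewrite ler_piMl// mulr_ge0// subr_ge0 ltW.
lra.
Qed.

(** With W k n = t k * U k n, where U has orthonormal or zero rows, B n n is the
    sum over k of conj(P k n) * t k * U k n, so that |B n n| is at most an average
    of the t k with weights a n k = |P k n| |U k n|. Both the rows and the columns
    of a have sums at most 1, by a n k <= (|P k n|^2 + |U k n|^2) / 2. The row
    sums allow Jensen's inequality, the column sums the exchange of summation. *)
Lemma sum_diag_le M (p : R) (B P W : 'M[C]_M) (t : 'I_M -> R) : 1 < p ->
  P *m P^t* = 1%:M -> P *m B = W -> (forall k, 0 <= t k) ->
  W *m W ^t* = diag_mx (\row_k ((t k) ^+ 2)%:C) ->
  \sum_n (cmod (B n n)) `^ p <= \sum_k (t k) `^ p.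
Proof.
move=> p1 PP PB t0 WW.
(* The inverse of 0 is 0, so the rows of U belonging to zero singular values
   vanish. *)
pose u (k : 'I_M) : R := (t k)^-1.
pose U := \matrix_(k < M, n < M) ((u k)%:C * W k n).
have cE l j : (U l j)^* = (u l)%:C * (W l j)^* by rewrite mxE; exact: conjMRC.
have UU : U *m U ^t* = diag_mx (\row_k ((t k != 0) : bool)%:R).
  apply/matrixP => k l; rewrite gram_diag.
  transitivity ((u k)%:C * (u l)%:C * (W *m W ^t*) k l).
    rewrite gram_diag mulr_sumr; apply: eq_bigr => j _.
    by rewrite [X in _ * X]cE mxE; ring.
  rewrite WW !mxE; case: eqVneq => [->|]; last by rewrite !mulr0n mulr0.
  rewrite !mulr1n; have [tl|tl] := eqVneq (t l) 0.
    by rewrite /u tl invr0 mul0r mul0r.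
  rewrite -!rmorphM /=; have -> : u l * u l * t l ^+ 2 = 1 by rewrite /u; field.
  by [].
have WU k n : W k n = (t k)%:C * U k n.
  rewrite mxE mulrA -rmorphM /= /u; have [tk|tk] := eqVneq (t k) 0; last first.
    by rewrite divff// mul1r.
  rewrite tk mul0r mul0r.
  have /row_sum : (W *m W ^t*) k k = (0 : R)%:C.
    by rewrite WW !mxE eqxx tk expr0n.
  move/eqP; rewrite psumr_eq0 => [|i _]; last by rewrite sqr_ge0.
  move=> /allP/(_ n); rewrite mem_index_enum => /(_ isT).
  by rewrite sqrf_eq0 => /eqP h; apply/eqP; rewrite -normr_eq0 cmodE h.
have PP' : P^t* *m P = 1%:M by apply: mulmx1C.
have BE : B = P^t* *m W by rewrite -PB mulmxA PP' mul1mx.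
pose a n k := cmod (P k n) * cmod (U k n).
have a0 n k : 0 <= a n k by rewrite mulr_ge0 ?cmod_ge0.
have ab n k : a n k <= (cmod (P k n) ^+ 2 + cmod (U k n) ^+ 2) / 2.
  by rewrite /a; have := sqr_ge0 (cmod (P k n) - cmod (U k n)); lra.
have Bn n : cmod (B n n) <= \sum_k t k * a n k.
  rewrite BE mxE; apply: le_trans (cmod_sum _ _ _) _; apply: ler_sum => k _.
  rewrite !mxE cmodM WU cmodM cmodR// mulrCA.
  suff -> : cmod (P k n)^* = cmod (P k n) by [].
  by apply: complexI; rewrite -!cmodE norm_conjC.
have Prow k : \sum_n cmod (P k n) ^+ 2 = 1.
  by apply: row_sum; rewrite PP mxE eqxx.
have Urow k : \sum_n cmod (U k n) ^+ 2 <= 1.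
  rewrite (@row_sum _ _ _ ((t k != 0)%:R)) ?lern1 ?leq_b1//.
  by rewrite UU !mxE eqxx mulr1n rmorph_nat.
have Pcol n : \sum_k cmod (P k n) ^+ 2 <= 1.
  apply: (@col_sum _ _ (fun=> true)); rewrite PP; apply/matrixP => i j.
  by rewrite !mxE.
have Ucol n : \sum_k cmod (U k n) ^+ 2 <= 1 by apply: col_sum UU.
have arow n : \sum_k a n k <= 1.
  apply: le_trans (ler_sum _ (fun k _ => ab n k)) _.
  by rewrite -mulr_suml big_split /=; have := Pcol n; have := Ucol n; lra.
have acol k : \sum_n a n k <= 1.
  apply: le_trans (ler_sum _ (fun n _ => ab n k)) _.
  by rewrite -mulr_suml big_split /=; have := Prow k; have := Urow k; lra.
have p0 : 0 <= p by rewrite ltW// (lt_trans ltr01).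
have st n : cmod (B n n) `^ p <= \sum_k t k `^ p * a n k.
  apply: le_trans (_ : (\sum_k t k * a n k) `^ p <= _).
    by rewrite ge0_ler_powR ?nnegrE ?cmod_ge0// sumr_ge0// => k _; rewrite mulr_ge0.
  exact: jensen_substoch.
apply: le_trans (ler_sum _ (fun n _ => st n)) _.
rewrite exchange_big /=; apply: ler_sum => k _.
by rewrite -mulr_sumr ler_piMr ?powR_ge0.
Qed.
End SVD.

(** * Summing decreasing sequences by counting *)

Section Sequences.
Context {R : realType}.

(** Bounding the terms of odd index 2j+1 by those of index 2j gives S(2m+1) <= 1 +
    2 sum_(j<=m) (2j)^(-p) = 1 + 2^(1-p) S(m) for the partial sums S, and S(m) <=
    S(2m+1); since p > 1 the factor 2^(1-p) is less than 1. *)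
Lemma sum_inv_powR_le (p : R) : 1 < p ->
  forall N, \sum_(i < N) (i.+1%:R : R) `^ (- p) <= (1 - 2 `^ (1 - p))^-1.
Proof.
move=> p1 N.
pose S N := \sum_(i < N) (i.+1%:R : R) `^ (- p).
have Sle m : S (m.*2.+1) <= 1 + 2 `^ (1 - p) * S m.
  elim: m => [|m IH].
    by rewrite /S /= big_ord_recr !big_ord0 /= powR1 mulr0 addr0 add0r.
  rewrite /S doubleS big_ord_recr big_ord_recr /= -!/(S _).
  rewrite [S m.+1]/S big_ord_recr /= -!/(S _).
  have h1 : 2 `^ (1 - p) * (m.+1%:R : R) `^ (- p) = 2 * (m.+1.*2%:R : R) `^ (- p).
    rewrite -muln2 natrM (mulrC _ 2) powRM// mulrA powRD ?powRr1//.
    by rewrite pnatr_eq0 implybT.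
  have h2 : (m.*2.+3%:R : R) `^ (- p) <= (m.*2.+2%:R : R) `^ (- p).
    rewrite !powRN lef_pV2 ?posrE ?powR_gt0 ?ltr0n//.
    rewrite ge0_ler_powR ?nnegrE ?ler0n ?ler_nat//.
    by rewrite ltW// (lt_trans ltr01).
  rewrite mulrDr h1 doubleS; lra.
have Smono m : S m <= S m.*2.+1.
  rewrite /S -addnn -addnS big_split_ord /= lerDl sumr_ge0//.
have q1 : 2 `^ (1 - p) < 1 :> R.
  rewrite -opprB powRN invf_lt1 ?powR_gt0//.
  apply: (@le_lt_trans _ _ (1 `^ (p - 1))); first by rewrite powR1.
  by rewrite gt0_ltr_powR ?nnegrE ?subr_gt0 ?ltr1n.
rewrite -[leRHS]mul1r ler_pdivlMr; last lra.
have := Smono N; have := Sle N; rewrite /S; lra.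
Qed.

(** Go through s 0, s 1, ... and charge each nonzero s K to an index t with s K <=
    2 C * tau t that has not been used yet. Such a t exists: for eps = s K / (2 C)
    the list l has s (size l) <= s K / 2 < s K, so it has more than K elements,
    whereas at most K indices have been used. *)
Lemma sum_powR_le_count (T : eqType) (p C : R) (tau : T -> R) (s : nat -> R) :
  0 < p -> 0 < C -> (forall k, 0 <= s k) ->
  (forall i j, (i <= j)%N -> s j <= s i) -> (forall t, 0 <= tau t) ->
  (forall eps, 0 < eps -> exists l : seq T,
     [/\ uniq l, forall t, t \in l -> eps <= tau t & s (size l) <= C * eps]) ->
  forall K, exists2 l : seq T, uniq l &
    \sum_(k < K) s k `^ p <= (2 * C) `^ p * \sum_(t <- l) tau t `^ p.
Proof.
move=> p0 C0 s0 smono tau0 count K.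
suff [l [ul _ h]] : exists l : seq T, [/\ uniq l, (size l <= K)%N &
    \sum_(k < K) s k `^ p <= (2 * C) `^ p * \sum_(t <- l) tau t `^ p] by exists l.
elim: K => [|K [l [ul sl IH]]].
  by exists [::]; rewrite big_ord0 big_nil mulr0.
have [sK|sK] := eqVneq (s K) 0.
  exists l; split => //; first exact: leq_trans sl _.
  by rewrite big_ord_recr /= sK powR0 ?addr0// gt_eqF.
have sK0 : 0 < s K by rewrite lt_def sK s0.
have C2 : 0 < 2 * C by rewrite mulr_gt0.
have [l' [ul' l'tau sl']] := count (s K / (2 * C)) (divr_gt0 sK0 C2).
have Kl' : (K < size l')%N.
  rewrite ltnNge; apply/negP => /smono.
  apply/negP; rewrite -ltNge; apply: le_lt_trans sl' _.
  rewrite (_ : C * (s K / (2 * C)) = s K / 2); last by field; rewrite gt_eqF.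
  lra.
have [x xl' xl] : exists2 x, x \in l' & x \notin l.
  apply/hasP; rewrite -[has _ _]negbK -all_predC; apply/negP => /allP h.
  have : (size l' <= size l)%N.
    by apply: uniq_leq_size => // y /h /=; rewrite negbK.
  by rewrite leqNgt (leq_ltn_trans sl).
exists (x :: l); split; rewrite ?ltnS//= ?xl//.
rewrite big_ord_recr big_cons /= mulrDr addrC lerD//.
have -> : s K = (2 * C) * (s K / (2 * C)) by field; rewrite gt_eqF.
have e0 : 0 <= s K / (2 * C) by rewrite divr_ge0// ltW.
rewrite powRM ?(ltW C2)// ler_pM2l ?powR_gt0//.
by apply: ge0_ler_powR; rewrite ?nnegrE// ?l'tau// ltW.
Qed.

Lemma sum_le_sub (T : eqType) (l L : seq T) (f : T -> R) :
  uniq l -> uniq L -> {subset l <= L} -> (forall t, 0 <= f t) ->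
  \sum_(t <- l) f t <= \sum_(t <- L) f t.
Proof.
move=> ul uL lL f0.
have pl : perm_eq l [seq t <- L | t \in l].
  apply: uniq_perm => //; first exact: filter_uniq.
  move=> t; rewrite mem_filter; case: (boolP (t \in l)) => //= tl.
  by rewrite lL.
rewrite (perm_big _ pl) big_filter [leRHS](bigID (mem l)) /= lerDl sumr_ge0//.
Qed.

(** Each sigma n / i.+1 is counted twice, once for each boolean: a finite rank
    approximation of the kernel of Q uses two functions per piece. *)
Lemma sum_harmonic_le (T : eqType) (p S : R) (sigma : T -> R) : 1 < p ->
  (forall n, 0 <= sigma n) ->
  (forall F : seq T, uniq F -> \sum_(n <- F) sigma n `^ p <= S) ->
  forall l : seq (T * nat * bool), uniq l ->
  \sum_(t <- l) (sigma t.1.1 / t.1.2.+1%:R) `^ p <=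
    2 * (1 - 2 `^ (1 - p))^-1 * S.
Proof.
move=> p1 s0 hS l ul.
pose F := undup [seq t.1.1 | t <- l].
pose I := (\max_(t <- l) t.1.2).+1.
pose L0 := [seq (n, i) | n <- F, i <- index_iota 0 I].
pose L := [seq (t, b) | t <- L0, b <- [:: true; false]].
have uL0 : uniq L0.
  by apply: allpairs_uniq; rewrite ?undup_uniq ?iota_uniq// => -[a b] [c d].
have uL : uniq L.
  by apply: allpairs_uniq => // -[a b] [c d].
have lL : {subset l <= L}.
  move=> [[n i] b] tl; apply/allpairsP; exists ((n, i), b); split => //=.
    apply/allpairsP; exists (n, i); split => //.
      by rewrite mem_undup; apply/mapP; exists (n, i, b).
    rewrite mem_index_iota /= ltnS.
    exact: (@leq_bigmax_seq _ _ xpredT (fun t : T * nat * bool => t.1.2) _ tl).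
  by case: (b); rewrite !inE ?orbT.
have p0 : 0 < p by rewrite (lt_trans ltr01).
apply: le_trans (sum_le_sub ul uL lL (fun t => powR_ge0 _ _)) _.
rewrite big_allpairs /=; under eq_bigr do rewrite !big_cons big_nil addr0 -mulr2n.
rewrite sumrMnl -[leLHS]mulr_natl -mulrA ler_pM2l// big_allpairs /=.
have Fle := hS F (undup_uniq _).
have Z0 : 0 <= (1 - 2 `^ (1 - p))^-1 :> R.
  by apply: le_trans (sum_inv_powR_le p1 0); rewrite big_ord0.
apply: le_trans (ler_wpM2l Z0 Fle).
rewrite mulr_sumr ler_sum// => n _.
under eq_bigr => i _ do rewrite powRM ?invr_ge0// -powR_inv1// -powRrM mulN1r.
by rewrite -mulr_sumr mulrC ler_wpM2r ?powR_ge0// big_mkord sum_inv_powR_le.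
Qed.

End Sequences.

(** * Positive integral operators and the Schur test *)

Section Schur.
Context {R : realType}.
Local Notation leb := (@lebesgue_measure R).
Local Notation Rp := (@Rplus R).
Local Open Scope ereal_scope.

Lemma measurable_Rplus : measurable Rp.
Proof. exact: measurable_itv. Qed.
Hint Resolve measurable_Rplus : core.

Lemma Lnorm2E (D : set R) (u : R -> R) : measurable D ->
  'N[leb]_(2%:E)[EFin \o (u \_ D)] = sqrte (\int[leb]_(x in D) ((u x) ^+ 2)%:E).
Proof.
move=> mD; rewrite unlock /Lnorm poweR12_sqrt; last first.
  by apply: integral_ge0 => x _; exact: poweR_ge0.
congr sqrte; rewrite [RHS]integral_mkcond; apply: eq_integral => x _.
rewrite /= !patchE; case: ifPn => _; rewrite /= ?poweR_EFin.
  by rewrite powR_mulrn// real_normK// num_real.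
by rewrite normr0 powR0.
Qed.

Lemma cauchy_schwarz (D : set R) (u v : R -> R) : measurable D ->
  measurable_fun D u -> measurable_fun D v ->
  (forall x, D x -> 0 <= u x)%R -> (forall x, D x -> 0 <= v x)%R ->
  (\int[leb]_(x in D) (u x * v x)%:E) ^+ 2 <=
  (\int[leb]_(x in D) ((u x) ^+ 2)%:E) * (\int[leb]_(x in D) ((v x) ^+ 2)%:E).
Proof.
move=> mD mu mv u0 v0.
have I0 (w : R -> R) : 0 <= \int[leb]_(x in D) ((w x) ^+ 2)%:E.
  by apply: integral_ge0 => x _; rewrite lee_fin sqr_ge0.
rewrite -[X in _ <= X * _]sqr_sqrte// -[X in _ <= _ * X]sqr_sqrte//.
rewrite !expe2 muleACA -expe2 -[in leRHS]expe2 lee_sqr ?mule_ge0 ?sqrte_ge0//; last first.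
  by apply: integral_ge0 => x Dx; rewrite lee_fin mulr_ge0 ?u0 ?v0.
rewrite -!Lnorm2E//; apply: le_trans (@hoelder _ _ _ leb (u \_ D) (v \_ D) 2 2 _ _ _ _ _) => //.
- rewrite Lnorm1 [leLHS]integral_mkcond le_eqVlt; apply/orP; left; apply/eqP.
  apply: eq_integral => x _ /=; rewrite !patchE; case: ifPn.
    by rewrite inE => Dx; rewrite ger0_norm// mulr_ge0 ?u0 ?v0.
  by rewrite mul0r normr0.
- exact/(measurable_restrictT _ _).1.
- exact/(measurable_restrictT _ _).1.
- by field.
Qed.

Lemma fubini_Rplus (f : R -> R -> \bar R) :
  measurable_fun [set: R * R] (fun z : R * R => f z.1 z.2) ->
  (forall x y, 0 <= f x y) ->
  \int[leb]_(x in Rp) \int[leb]_(y in Rp) f x y =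
  \int[leb]_(y in Rp) \int[leb]_(x in Rp) f x y.
Proof.
move=> mf f0.
pose g := (fun z : R * R => f z.1 z.2) \_ (Rp `*` Rp).
have mRR : measurable (Rp `*` Rp) by exact: measurableX.
have mg : measurable_fun setT g.
  apply/(measurable_restrictT _ _).1 => //. by apply: measurable_funTS.
have g0 z : 0 <= g z by rewrite /g patchE; case: ifP.
have := fubini_tonelli (m1 := leb) (m2 := leb) g mg g0.
rewrite [X in X = _ -> _](_ : _ = \int[leb]_(x in Rp) \int[leb]_(y in Rp) f x y).
  move=> ->; rewrite [RHS]integral_mkcond; apply: eq_integral => y _.
  rewrite patchE; case: ifPn => yR.
    rewrite [RHS]integral_mkcond; apply: eq_integral => x _.
    by rewrite /g !patchE in_setX /= yR andbT.
  rewrite integral0_eq// => x _; rewrite /g !patchE in_setX /=.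
  by rewrite (negbTE yR) andbF.
rewrite [RHS]integral_mkcond; apply: eq_integral => x _.
rewrite patchE; case: ifPn => xR.
  rewrite [RHS]integral_mkcond; apply: eq_integral => y _.
  by rewrite /g !patchE in_setX /= xR.
rewrite integral0_eq// => y _; rewrite /g !patchE in_setX /=.
by rewrite (negbTE xR).
Qed.

Lemma measurable_integral_Rplus (f : R -> R -> \bar R) :
  measurable_fun [set: R * R] (fun z : R * R => f z.1 z.2) ->
  (forall x y, 0 <= f x y) ->
  measurable_fun setT (fun x => \int[leb]_(y in Rp) f x y).
Proof.
move=> mf f0.
pose g := (fun z : R * R => f z.1 z.2) \_ (setT `*` Rp).
have mRR : measurable ([set: R] `*` Rp) by exact: measurableX.
have mg : measurable_fun setT g.
  by apply/(measurable_restrictT _ _).1 => //; exact: measurable_funTS.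
have g0 z : 0 <= g z by rewrite /g patchE; case: ifP.
have := measurable_fun_fubini_tonelli_F (m2 := leb) g mg g0.
congr (measurable_fun _ _); apply/funext => x.
rewrite /fubini_F [RHS]integral_mkcond; apply: eq_integral => y _.
by rewrite /g !patchE in_setX /= in_setT.
Qed.

Definition jmeasurable (k : R -> R -> R) := measurable_fun [set: R * R] (fun z : R * R => k z.1 z.2).

Lemma jmeasurable1 k x : jmeasurable k -> measurable_fun setT (k x).
Proof. by move=> mk; exact: (measurableT_comp mk (pair1_measurable x)). Qed.

Lemma jmeasurable2 k y : jmeasurable k -> measurable_fun setT (k ^~ y).
Proof. by move=> mk; exact: (measurableT_comp mk (pair2_measurable y)). Qed.

Lemma jmeasurableM k l : jmeasurable k -> jmeasurable l -> jmeasurable (fun x y => k x y * l x y)%R.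
Proof. by move=> mk ml; exact: measurable_funM. Qed.

Lemma jmeasurableD k l : jmeasurable k -> jmeasurable l -> jmeasurable (fun x y => k x y + l x y)%R.
Proof. by move=> mk ml; exact: measurable_funD. Qed.

Lemma jmeasurable_x (g : R -> R) : measurable_fun setT g -> jmeasurable (fun x _ => g x).
Proof. by move=> mg; exact: (measurableT_comp mg measurable_fst). Qed.

Lemma jmeasurable_y (g : R -> R) : measurable_fun setT g -> jmeasurable (fun _ y => g y).
Proof. by move=> mg; exact: (measurableT_comp mg measurable_snd). Qed.

Lemma jmeasurable_swap k : jmeasurable k -> jmeasurable (fun x y => k y x).
Proof.
move=> mk; apply: (measurableT_comp mk (g := fun z : R * R => (z.2, z.1))).
by apply: measurable_fun_pair; [exact: measurable_snd|exact: measurable_fst].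
Qed.

(** c bounds the square of the norm on L^2(0, oo) of the integral operator with
    kernel k. The integrals take values in [0, oo], so that no integrability has
    to be known in advance. *)
Definition kbound (k : R -> R -> R) (c : R) := forall g : R -> R,
  measurable_fun setT g -> (forall x, 0 <= g x)%R ->
  \int[leb]_(x in Rp) (\int[leb]_(y in Rp) (k x y * g y)%:E) ^+ 2 <=
  c%:E * \int[leb]_(x in Rp) ((g x) ^+ 2)%:E.

Lemma measurable_expe2 (D : set R) (f : R -> \bar R) :
  measurable_fun D f -> measurable_fun D (fun x => f x ^+ 2).
Proof. by move=> mf; exact: emeasurable_funM. Qed.

Lemma meas_kint (k : R -> R -> R) (g : R -> R) : jmeasurable k -> measurable_fun setT g ->
  (forall x y, 0 <= k x y)%R -> (forall x, 0 <= g x)%R ->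
  measurable_fun setT (fun x => \int[leb]_(y in Rp) (k x y * g y)%:E).
Proof.
move=> mk mg k0 g0; apply: measurable_integral_Rplus.
  by apply/measurable_EFinP; exact: (jmeasurableM mk (jmeasurable_y mg)).
by move=> x y; rewrite lee_fin mulr_ge0.
Qed.

Lemma meas_kint_sqr (k : R -> R -> R) (g : R -> R) : jmeasurable k -> measurable_fun setT g ->
  (forall x y, 0 <= k x y)%R -> (forall x, 0 <= g x)%R ->
  measurable_fun Rp (fun x => (\int[leb]_(y in Rp) (k x y * g y)%:E) ^+ 2).
Proof.
move=> mk mg k0 g0; apply: measurable_expe2; apply: measurable_funTS.
exact: (meas_kint mk mg k0 g0).
Qed.

(** By Cauchy-Schwarz with k <= a b, the square of the integral of k(x, y) g(y) is
    at most A(x) times the integral of b(x, y)^2 g(y)^2; integrate in x and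
    exchange the integrals. *)
Lemma schur (k a b : R -> R -> R) (A : R -> R) (c : R) :
  jmeasurable k -> jmeasurable a -> jmeasurable b -> measurable_fun setT A ->
  (forall x y, 0 <= k x y)%R -> (forall x y, 0 <= a x y)%R ->
  (forall x y, 0 <= b x y)%R -> (forall x, 0 <= A x)%R ->
  (forall x y, Rp x -> Rp y -> k x y <= a x y * b x y)%R ->
  (forall x, Rp x -> \int[leb]_(y in Rp) ((a x y) ^+ 2)%:E <= (A x)%:E) ->
  (forall y, Rp y -> \int[leb]_(x in Rp) (A x * (b x y) ^+ 2)%:E <= c%:E) ->
  kbound k c.
Proof.
move=> mk ma mb mA k0 a0 b0 A0 kab hA hc g mg g0.
have mbg : jmeasurable (fun x y => (b x y * g y) ^+ 2)%R.
  by apply: measurable_funX; exact: (jmeasurableM mb (jmeasurable_y mg)).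
pose H x y := (A x * (b x y * g y) ^+ 2)%R.
have mH : jmeasurable H by exact: (jmeasurableM (jmeasurable_x mA) mbg).
apply: (@le_trans _ _ (\int[leb]_(x in Rp) \int[leb]_(y in Rp) (H x y)%:E)).
  apply: ge0_le_integral => //.
  - move=> x _; rewrite expe_ge0//; apply: integral_ge0 => y _.
    by rewrite lee_fin mulr_ge0.
  - exact: (meas_kint_sqr mk mg k0 g0).
  - apply: measurable_funTS; apply: measurable_integral_Rplus.
      exact/measurable_EFinP.
    by move=> x y; rewrite lee_fin mulr_ge0// sqr_ge0.
  move=> x Rx.
  have mbgx : measurable_fun Rp (fun y => b x y * g y)%R.
    by apply: measurable_funM; apply: measurable_funTS => //; exact: jmeasurable1.
  have -> : \int[leb]_(y in Rp) (H x y)%:E =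
      (A x)%:E * \int[leb]_(y in Rp) ((b x y * g y) ^+ 2)%:E.
    rewrite -ge0_integralZl//.
    - by apply/measurable_EFinP; exact: measurable_funX.
    - by move=> y _; rewrite lee_fin sqr_ge0.
    - by rewrite lee_fin.
  apply: (@le_trans _ _ ((\int[leb]_(y in Rp) (a x y * (b x y * g y))%:E) ^+ 2)).
    rewrite lee_sqr; last 2 first.
    - by apply: integral_ge0 => y _; rewrite lee_fin mulr_ge0.
    - by apply: integral_ge0 => y _; rewrite lee_fin !mulr_ge0.
    apply: ge0_le_integral => //.
    - by move=> y _; rewrite lee_fin mulr_ge0.
    - apply/measurable_EFinP; apply: measurable_funM; apply: measurable_funTS => //.
      exact: jmeasurable1.
    - apply/measurable_EFinP; apply: measurable_funM => //; apply: measurable_funTS => //.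
      exact: jmeasurable1.
    - by move=> y Ry; rewrite lee_fin mulrA ler_wpM2r// kab.
  apply: le_trans (cauchy_schwarz _ _ _ _ _) _ => //.
  - by apply: measurable_funTS; exact: jmeasurable1.
  - by move=> y _; rewrite mulr_ge0.
  apply: lee_wpmul2r; first by apply: integral_ge0 => y _; rewrite lee_fin sqr_ge0.
  exact: hA.
rewrite fubini_Rplus//; last 2 first.
- exact/measurable_EFinP.
- by move=> x y; rewrite lee_fin mulr_ge0// sqr_ge0.
have c0 : (0 <= c)%R.
  rewrite -lee_fin; apply: le_trans (hc 1%R _); last by rewrite /Rplus /= in_itv /= ltr01.
  by apply: integral_ge0 => x _; rewrite lee_fin mulr_ge0// sqr_ge0.
rewrite -ge0_integralZl//; last 2 first.
- by apply/measurable_EFinP; apply: measurable_funX; exact: measurable_funTS.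
- by move=> y _; rewrite lee_fin sqr_ge0.
apply: ge0_le_integral => //.
- by move=> y _; apply: integral_ge0 => x _; rewrite lee_fin mulr_ge0// sqr_ge0.
- apply: measurable_funTS; apply: (measurable_integral_Rplus (f := fun y x => (H x y)%:E)).
    by apply/measurable_EFinP; exact: (jmeasurable_swap mH).
  by move=> x y; rewrite lee_fin mulr_ge0// sqr_ge0.
- apply/measurable_EFinP; apply: measurable_funM => //.
  by apply: measurable_funX; exact: measurable_funTS.
move=> y Ry.
have -> : \int[leb]_(x in Rp) (H x y)%:E =
    \int[leb]_(x in Rp) (((g y) ^+ 2)%:E * (A x * (b x y) ^+ 2)%:E).
  by apply: eq_integral => x _; rewrite /H -EFinM; congr EFin; ring.
rewrite ge0_integralZl//.
- by rewrite muleC lee_wpmul2r ?lee_fin ?sqr_ge0// hc.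
- apply/measurable_EFinP; apply: measurable_funM; first exact: measurable_funTS.
  by apply: measurable_funX; apply: measurable_funTS; exact: jmeasurable2.
- by move=> x _; rewrite lee_fin mulr_ge0// sqr_ge0.
- by rewrite lee_fin sqr_ge0.
Qed.

End Schur.

Section KBound.
Context {R : realType}.
Local Notation leb := (@lebesgue_measure R).
Local Notation Rp := (@Rplus R).
Local Open Scope ereal_scope.
Let mRp : measurable Rp. Proof. exact: measurable_Rplus. Qed.
#[local] Hint Resolve mRp : core.
Implicit Types (k : R -> R -> R) (c : R).

Lemma int_sqr_ge0 (D : set R) (g : R -> R) :
  0 <= \int[leb]_(x in D) ((g x) ^+ 2)%:E.
Proof. by apply: integral_ge0 => x _; rewrite lee_fin sqr_ge0. Qed.
#[local] Hint Resolve int_sqr_ge0 : core.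

Lemma kint_ge0 k (g : R -> R) x : (forall x y, 0 <= k x y)%R ->
  (forall x, 0 <= g x)%R -> 0 <= \int[leb]_(y in Rp) (k x y * g y)%:E.
Proof. by move=> k0 g0; apply: integral_ge0 => y _; rewrite lee_fin mulr_ge0. Qed.

Lemma kint_sqr_ge0 k (g : R -> R) x : (forall x y, 0 <= k x y)%R ->
  (forall x, 0 <= g x)%R -> 0 <= (\int[leb]_(y in Rp) (k x y * g y)%:E) ^+ 2.
Proof. by move=> k0 g0; rewrite expe_ge0// kint_ge0. Qed.

Lemma kbound_le k1 k2 c : jmeasurable k1 -> jmeasurable k2 ->
  (forall x y, 0 <= k1 x y)%R -> (forall x y, 0 <= k2 x y)%R ->
  (forall x y, Rp x -> Rp y -> k1 x y <= k2 x y)%R ->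
  kbound k2 c -> kbound k1 c.
Proof.
move=> m1 m2 k10 k20 k12 b2 g mg g0; apply: le_trans (b2 g mg g0).
apply: ge0_le_integral => //.
- by move=> x _; exact: (kint_sqr_ge0 x k10 g0).
- exact: (meas_kint_sqr m1 mg k10 g0).
- exact: (meas_kint_sqr m2 mg k20 g0).
move=> x Rx; rewrite lee_sqr ?kint_ge0//; apply: ge0_le_integral => //.
- by move=> y _; rewrite lee_fin mulr_ge0.
- apply/measurable_EFinP; apply: measurable_funM; apply: measurable_funTS => //.
  exact: jmeasurable1.
- apply/measurable_EFinP; apply: measurable_funM; apply: measurable_funTS => //.
  exact: jmeasurable1.
- by move=> y Ry; rewrite lee_fin ler_wpM2r// k12.
Qed.

(** Used to add bounds for squared norms, at the price of a factor 2. *)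
Lemma sqr_add_le (a b : \bar R) : 0 <= a -> 0 <= b ->
  (a + b) ^+ 2 <= 2%:E * (a ^+ 2 + b ^+ 2).
Proof.
have ey : (+oo : \bar R) ^+ 2 = +oo by rewrite expe2 mulyy.
move: a b => [a| |] [b| |]// a0 b0.
- suff : (((a + b) ^+ 2)%R%:E <= (2 * (a ^+ 2 + b ^+ 2))%R%:E) by [].
  by rewrite lee_fin; have := sqr_ge0 (a - b)%R; nra.
- by rewrite ey [in leRHS]addey// gt0_muley ?leey// lte_fin.
- by rewrite ey [in leRHS]addye// gt0_muley ?leey// lte_fin.
- by rewrite ey [in leRHS]addye// gt0_muley ?leey// lte_fin.
Qed.

Lemma kbound_add k1 k2 c1 c2 : jmeasurable k1 -> jmeasurable k2 ->
  (forall x y, 0 <= k1 x y)%R -> (forall x y, 0 <= k2 x y)%R ->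
  (0 <= c1)%R -> (0 <= c2)%R ->
  kbound k1 c1 -> kbound k2 c2 ->
  kbound (fun x y => k1 x y + k2 x y)%R (2 * (c1 + c2)).
Proof.
move=> m1 m2 k10 k20 c10 c20 b1 b2 g mg g0.
have mk1 := meas_kint_sqr m1 mg k10 g0.
have mk2 := meas_kint_sqr m2 mg k20 g0.
have m12 := jmeasurableD m1 m2.
have k120 x y : (0 <= k1 x y + k2 x y)%R by rewrite addr_ge0.
apply: (@le_trans _ _ (\int[leb]_(x in Rp) (2%:E *
   ((\int[leb]_(y in Rp) (k1 x y * g y)%:E) ^+ 2 +
    (\int[leb]_(y in Rp) (k2 x y * g y)%:E) ^+ 2)))).
  apply: ge0_le_integral => //.
  - by move=> x _; exact: (kint_sqr_ge0 x k120 g0).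
  - exact: (meas_kint_sqr m12 mg k120 g0).
  - by apply: emeasurable_funM => //; apply: emeasurable_funD.
  move=> x Rx.
  have -> : \int[leb]_(y in Rp) ((k1 x y + k2 x y) * g y)%:E =
     \int[leb]_(y in Rp) (k1 x y * g y)%:E + \int[leb]_(y in Rp) (k2 x y * g y)%:E.
    rewrite -ge0_integralD//.
    - by apply: eq_integral => y _; rewrite -EFinD mulrDl.
    - by move=> y _; rewrite lee_fin mulr_ge0.
    - apply/measurable_EFinP; apply: measurable_funM; apply: measurable_funTS => //.
      exact: jmeasurable1.
    - by move=> y _; rewrite lee_fin mulr_ge0.
    - apply/measurable_EFinP; apply: measurable_funM; apply: measurable_funTS => //.
      exact: jmeasurable1.
  by rewrite sqr_add_le// kint_ge0.
rewrite ge0_integralZl//; last 2 first.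
- by apply: emeasurable_funD.
- by move=> x _; rewrite adde_ge0// ?(kint_sqr_ge0 x k10 g0) ?(kint_sqr_ge0 x k20 g0).
rewrite EFinM -muleA lee_pmul2l// EFinD ge0_muleDl ?lee_fin//.
rewrite ge0_integralD//; last 2 first.
- by move=> x _; exact: (kint_sqr_ge0 x k10 g0).
- by move=> x _; exact: (kint_sqr_ge0 x k20 g0).
by apply: leeD; [exact: b1|exact: b2].
Qed.

(** At points x where h x is not integrable the integral is still a definite
    extended real number; the positive and the negative part are therefore treated
    separately. *)
Lemma measurable_integral_Rplus_real (h : R -> R -> R) : jmeasurable h ->
  measurable_fun setT (fun x => \int[leb]_(y in Rp) (h x y)%:E).
Proof.
move=> mh.
have mE : measurable_fun [set: R * R] (fun z : R * R => (h z.1 z.2)%:E).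
  exact/measurable_EFinP.
under eq_fun do rewrite integralE.
apply: emeasurable_funB.
- apply: (measurable_integral_Rplus (f := fun x y => ((fun y => (h x y)%:E)^\+ y))) => //.
  have h1 := measurable_funepos mE.
  rewrite [X in measurable_fun _ X](_ : _ = (fun z : R * R => (h z.1 z.2)%:E)^\+)//.
  by apply/funext => z; rewrite !funeposE.
- apply: (measurable_integral_Rplus (f := fun x y => ((fun y => (h x y)%:E)^\- y))) => //.
  have h1 := measurable_funeneg mE.
  rewrite [X in measurable_fun _ X](_ : _ = (fun z : R * R => (h z.1 z.2)%:E)^\-)//.
  by apply/funext => z; rewrite !funenegE.
Qed.

End KBound.

(** * Complex square-integrable functions *)

Section L2.
Context {R : realType}.
Local Notation C := (complex R).
Local Notation leb := (@lebesgue_measure R).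
Local Notation Rp := (@Rplus R).
Let mRp : measurable Rp. Proof. exact: measurable_Rplus. Qed.
#[local] Hint Resolve mRp : core.
#[local] Hint Resolve int_sqr_ge0 : core.
Implicit Types (f g h : R -> C) (D : set R).

Lemma measurable_cmod D f : measurable D -> cmeasurable D f ->
  measurable_fun D (fun x => cmod (f x)).
Proof.
move=> mD [m1 m2].
have -> : (fun x => cmod (f x)) = (fun x => Num.sqrt (complex.Re (f x) ^+ 2 + complex.Im (f x) ^+ 2)).
  by apply/funext => x; rewrite /cmod; case: (f x).
have ms : measurable_fun setT (@Num.sqrt R).
  by apply: continuous_measurable_fun; exact: sqrt_continuous.
exact: (measurableT_comp ms (measurable_funD (measurable_funX 2 m1) (measurable_funX 2 m2))).
Qed.

Definition sqnorm f : \bar R := (\int[leb]_(x in Rp) (cmod (f x) ^+ 2)%:E)%E.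

Lemma L2normE f : L2norm f = sqrte (sqnorm f).
Proof. by rewrite /L2norm Lnorm2E. Qed.

Lemma sqnorm_ge0 f : (0 <= sqnorm f)%E.
Proof. exact: int_sqr_ge0. Qed.

Lemma L2norm_le f r : 0 <= r -> (L2norm f <= r%:E)%E = (sqnorm f <= (r ^+ 2)%:E)%E.
Proof.
move=> r0; rewrite L2normE -lee_sqr ?sqrte_ge0// sqr_sqrte ?sqnorm_ge0//.
Qed.

Lemma L2E f : L2 f <-> cmeasurable Rp f /\ (sqnorm f < +oo)%E.
Proof.
rewrite /L2 L2normE; have := sqnorm_ge0 f; case: (sqnorm f) => [r| |]//= r0.
by split=> -[? _]; split; rewrite // ltry.
Qed.

Lemma cmeasurableD D f g : cmeasurable D f -> cmeasurable D g ->
  cmeasurable D (fun x => f x + g x).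
Proof.
move=> [f1 f2] [g1 g2]; split.
- rewrite [X in measurable_fun _ X](_ : _ =
    (fun x => complex.Re (f x) + complex.Re (g x))); last first.
    by apply/funext => x; case: (f x) => ? ?; case: (g x).
  exact: measurable_funD.
- rewrite [X in measurable_fun _ X](_ : _ =
    (fun x => complex.Im (f x) + complex.Im (g x))); last first.
    by apply/funext => x; case: (f x) => ? ?; case: (g x).
  exact: measurable_funD.
Qed.

Lemma cmeasurableM D f g : cmeasurable D f -> cmeasurable D g ->
  cmeasurable D (fun x => f x * g x).
Proof.
move=> [f1 f2] [g1 g2]; split.
- rewrite [X in measurable_fun _ X](_ : _ =
    (fun x => complex.Re (f x) * complex.Re (g x) - complex.Im (f x) * complex.Im (g x))); last first.
    by apply/funext => x; case: (f x) => ? ?; case: (g x).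
  by apply: measurable_funB; exact: measurable_funM.
- rewrite [X in measurable_fun _ X](_ : _ =
    (fun x => complex.Re (f x) * complex.Im (g x) + complex.Im (f x) * complex.Re (g x))); last first.
    by apply/funext => x; case: (f x) => ? ?; case: (g x).
  by apply: measurable_funD; exact: measurable_funM.
Qed.

Lemma cmeasurable_cst D (a : C) : cmeasurable D (fun=> a).
Proof. by split; exact: measurable_cst. Qed.

Lemma sqnormD f g : cmeasurable Rp f -> cmeasurable Rp g ->
  (sqnorm (fun x => f x + g x)%R <= 2%:E * (sqnorm f + sqnorm g))%E.
Proof.
move=> mf mg; have mfg := cmeasurableD mf mg.
have mcf := measurable_cmod measurable_Rplus mf.
have mcg := measurable_cmod measurable_Rplus mg.
have mcfg := measurable_cmod measurable_Rplus mfg.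
rewrite /sqnorm -ge0_integralD//; last 4 first.
- by move=> x _; rewrite lee_fin sqr_ge0.
- by apply/measurable_EFinP; exact: measurable_funX.
- by move=> x _; rewrite lee_fin sqr_ge0.
- by apply/measurable_EFinP; exact: measurable_funX.
rewrite -ge0_integralZl//; last 2 first.
- by apply/measurable_EFinP; apply: measurable_funD; exact: measurable_funX.
- by move=> x _; rewrite lee_fin addr_ge0// sqr_ge0.
apply: ge0_le_integral => //.
- by move=> x _; rewrite lee_fin sqr_ge0.
- by apply/measurable_EFinP; exact: measurable_funX.
- apply/measurable_EFinP; apply: measurable_funM => //.
  by apply: measurable_funD; exact: measurable_funX.
move=> x _; rewrite -EFinM lee_fin.
have := cmodD (f x) (g x); have := cmod_ge0 (f x + g x).
have := sqr_ge0 (cmod (f x) - cmod (g x)).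
have := cmod_ge0 (f x); have := cmod_ge0 (g x); nra.
Qed.

Lemma sqnormZ (a : C) f : cmeasurable Rp f ->
  sqnorm (fun x => a * f x) = ((cmod a ^+ 2)%:E * sqnorm f)%E.
Proof.
move=> mf; rewrite /sqnorm -ge0_integralZl//.
- by apply: eq_integral => x _; rewrite cmodM exprMn.
- by apply/measurable_EFinP; apply: measurable_funX; exact: measurable_cmod.
- by move=> x _; rewrite lee_fin sqr_ge0.
- by rewrite lee_fin sqr_ge0.
Qed.

Lemma L2_lin (a : C) f g : L2 f -> L2 g -> L2 (fun x => a * f x + g x).
Proof.
move=> /L2E[mf nf] /L2E[mg ng]; apply/L2E.
have maf : cmeasurable Rp (fun x => a * f x).
  by apply: cmeasurableM => //; exact: cmeasurable_cst.
split; first exact: cmeasurableD.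
apply: le_lt_trans (sqnormD maf mg) _; rewrite sqnormZ//.
by rewrite lte_mul_pinfty// lte_add_pinfty// lte_mul_pinfty// lee_fin sqr_ge0.
Qed.

Lemma sqnorm_ae f g : cmeasurable Rp f -> cmeasurable Rp g -> aeq f g ->
  sqnorm f = sqnorm g.
Proof.
move=> mf mg fg; apply: ge0_ae_eq_integral => //.
- by apply/measurable_EFinP; apply: measurable_funX; exact: measurable_cmod.
- by apply/measurable_EFinP; apply: measurable_funX; exact: measurable_cmod.
- by move=> x _; rewrite lee_fin sqr_ge0.
- by move=> x _; rewrite lee_fin sqr_ge0.
have F := ae_filter_ringOfSetsType leb.
by apply: (@filterS _ _ F _ _ _ fg) => x /= fgx Rx; rewrite fgx.
Qed.

Definition cintegrable D h := cmeasurable D h /\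
  (\int[leb]_(x in D) (cmod (h x))%:E < +oo)%E.

Lemma normRe (z : C) : `|complex.Re z| <= cmod z.
Proof.
rewrite -(@ler_pXn2r _ 2)// ?nnegrE ?cmod_ge0// real_normK ?num_real//.
by rewrite cmod_sqr lerDl sqr_ge0.
Qed.

Lemma normIm (z : C) : `|complex.Im z| <= cmod z.
Proof.
rewrite -(@ler_pXn2r _ 2)// ?nnegrE ?cmod_ge0// real_normK ?num_real//.
by rewrite cmod_sqr lerDr sqr_ge0.
Qed.

Lemma cintegrable_Re D h : measurable D -> cintegrable D h ->
  leb.-integrable D (EFin \o (fun x => complex.Re (h x))).
Proof.
move=> mD [mh hh]; apply/integrableP; split; first by apply/measurable_EFinP; case: mh.
apply: le_lt_trans hh; apply: ge0_le_integral => //.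
- by apply/measurable_EFinP; apply: measurableT_comp => //; case: mh.
- by apply/measurable_EFinP; exact: measurable_cmod.
- by move=> x _ /=; rewrite lee_fin normRe.
Qed.

Lemma cintegrable_Im D h : measurable D -> cintegrable D h ->
  leb.-integrable D (EFin \o (fun x => complex.Im (h x))).
Proof.
move=> mD [mh hh]; apply/integrableP; split; first by apply/measurable_EFinP; case: mh.
apply: le_lt_trans hh; apply: ge0_le_integral => //.
- by apply/measurable_EFinP; apply: measurableT_comp => //; case: mh.
- by apply/measurable_EFinP; exact: measurable_cmod.
- by move=> x _ /=; rewrite lee_fin normIm.
Qed.

Lemma cintegral_lin D (a : C) h g : measurable D -> cintegrable D h -> cintegrable D g ->
  cintegral D (fun x => a * h x + g x) = a * cintegral D h + cintegral D g.
Proof.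
move=> mD ih ig.
have hr := cintegrable_Re mD ih; have hi := cintegrable_Im mD ih.
have gr := cintegrable_Re mD ig; have gi := cintegrable_Im mD ig.
have L (b1 b2 : R) (u v w : R -> R) :
  leb.-integrable D (EFin \o u) -> leb.-integrable D (EFin \o v) ->
  leb.-integrable D (EFin \o w) ->
  \int[leb]_(x in D) (b1 * u x + b2 * v x + w x) =
  b1 * \int[leb]_(x in D) u x + b2 * \int[leb]_(x in D) v x + \int[leb]_(x in D) w x.
  move=> iu iv iw.
  have iu' : leb.-integrable D (EFin \o (fun x => b1 * u x)) by exact: (integrableZl (mu := leb) mD b1 iu).
  have iv' : leb.-integrable D (EFin \o (fun x => b2 * v x)) by exact: (integrableZl (mu := leb) mD b2 iv).
  have iuv' : leb.-integrable D (EFin \o (fun x => b1 * u x + b2 * v x)).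
    exact: (integrableD (mu := leb) mD iu' iv').
  by rewrite RintegralD// RintegralD// !RintegralZl.
case: a => a1 a2; rewrite /cintegral; apply/eqP; rewrite eq_complex /=.
apply/andP; split; apply/eqP.
- rewrite -mulNr -L//; apply: eq_Rintegral => x _.
  by case: (h x) => ? ?; case: (g x) => ? ? /=; rewrite mulNr.
- rewrite -L//; apply: eq_Rintegral => x _.
  by case: (h x) => ? ?; case: (g x) => ? ? /=.
Qed.

Lemma cintegrableZ D (a : C) h : measurable D -> cintegrable D h ->
  cintegrable D (fun x => a * h x).
Proof.
move=> mD [mh hh]; split; first by apply: cmeasurableM => //; exact: cmeasurable_cst.
under eq_integral do rewrite cmodM EFinM.
rewrite ge0_integralZl//.
- by rewrite lte_mul_pinfty// lee_fin cmod_ge0.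
- by apply/measurable_EFinP; exact: measurable_cmod.
- by move=> x _; rewrite lee_fin cmod_ge0.
- by rewrite lee_fin cmod_ge0.
Qed.

Lemma cintegrable0 D : measurable D -> cintegrable D (fun=> 0).
Proof.
move=> mD; split; first exact: cmeasurable_cst.
by rewrite integral0_eq ?ltry// => x _; rewrite cmod0.
Qed.

Lemma cintegral0 D : cintegral D (fun=> 0) = 0.
Proof. by rewrite /cintegral /Rintegral integral0. Qed.

Lemma eq_cintegral D h g : (forall x, D x -> h x = g x) -> cintegral D h = cintegral D g.
Proof.
move=> e; rewrite /cintegral; congr (_ +i* _); apply: eq_Rintegral => x;
  by rewrite inE => /e ->.
Qed.

Lemma cintegralZ D (a : C) h : measurable D -> cintegrable D h ->
  cintegral D (fun x => a * h x) = a * cintegral D h.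
Proof.
move=> mD ih; have := cintegral_lin a mD ih (cintegrable0 mD).
rewrite cintegral0 addr0 => <-; apply: eq_cintegral => x _; by rewrite addr0.
Qed.

Lemma cintegralD D h g : measurable D -> cintegrable D h -> cintegrable D g ->
  cintegral D (fun x => h x + g x) = cintegral D h + cintegral D g.
Proof.
move=> mD ih ig; have := cintegral_lin 1 mD ih ig.
rewrite mul1r => <-; apply: eq_cintegral => x _; by rewrite mul1r.
Qed.

(** The real and the imaginary part are bounded separately, whence the factor 2 in
    place of the sharp constant 1. *)
Lemma cintegral_sqr_le D h : measurable D -> cmeasurable D h ->
  (((cmod (cintegral D h)) ^+ 2)%:E <=
   2%:E * (\int[leb]_(x in D) (cmod (h x))%:E) ^+ 2)%E.
Proof.
move=> mD mh; set I := (X in (_ * X ^+ 2)%E).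
have I0 : (0 <= I)%E by apply: integral_ge0 => x _; rewrite lee_fin cmod_ge0.
have [Ioo|] := ltP I +oo%E; last first.
  rewrite leye_eq => /eqP ->; rewrite expe2 mulyy gt0_muley ?leey// lte_fin.
have ih : cintegrable D h by split.
have aux (u : R -> R) : leb.-integrable D (EFin \o u) ->
  (forall x, `|u x| <= cmod (h x)) -> `|\int[leb]_(x in D) u x| <= fine I.
  move=> iu ule; apply: le_trans (le_normr_Rintegral (mu := leb) mD iu) _.
  rewrite /Rintegral fine_le ?ge0_fin_numE//.
  - have /integrableP[_] := integrable_abse iu.
    by under eq_integral do rewrite abse_id.
  - by apply: integral_ge0 => x _.
  apply: ge0_le_integral => //.
  - have /integrableP[miu _] := iu.
    by apply/measurable_EFinP; apply: measurableT_comp => //; apply/measurable_EFinP.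
  - by apply/measurable_EFinP; exact: measurable_cmod.
  - by move=> x _; rewrite lee_fin ule.
have hr := aux _ (cintegrable_Re mD ih) (fun x => normRe _).
have hi := aux _ (cintegrable_Im mD ih) (fun x => normIm _).
rewrite -(fineK (x := I)) ?ge0_fin_numE// expe2 -!EFinM lee_fin cmod_sqr /=.
move: hr hi; set u := \int[_]_(_ in _) _; set v := \int[_]_(_ in _) _.
move=> hr hi.
have : `|u| ^+ 2 <= fine I ^+ 2 by rewrite ler_pXn2r ?nnegrE// (le_trans _ hr).
have : `|v| ^+ 2 <= fine I ^+ 2 by rewrite ler_pXn2r ?nnegrE// (le_trans _ hi).
rewrite !real_normK ?num_real//; lra.
Qed.

End L2.

(** * Bounded integral operators with complex kernels *)

Section KernelOp.
Context {R : realType}.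
Local Notation C := (complex R).
Local Notation leb := (@lebesgue_measure R).
Local Notation Rp := (@Rplus R).
Let mRp : measurable Rp. Proof. exact: measurable_Rplus. Qed.
#[local] Hint Resolve mRp : core.
#[local] Hint Resolve int_sqr_ge0 : core.
Implicit Types (f g h : R -> C) (D : set R) (K : R -> R -> C) (c : R).

Definition kmeasurable K := jmeasurable (fun x y => complex.Re (K x y)) /\
  jmeasurable (fun x y => complex.Im (K x y)).

(** The bound concerns the modulus of the kernel. It therefore also gives absolute
    convergence, for almost every x, of the integrals that define the operator. *)
Definition cbound K c := [/\ kmeasurable K, 0 <= c & kbound (fun x y => cmod (K x y)) c].

Definition kernel_op K : operator := fun f x => cintegral Rp (fun y => K x y * f y).

Lemma jmeasurable_cmod K : kmeasurable K -> jmeasurable (fun x y => cmod (K x y)).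
Proof.
move=> [m1 m2]; rewrite /jmeasurable.
have -> : (fun z : R * R => cmod (K z.1 z.2)) = (fun z : R * R =>
   Num.sqrt (complex.Re (K z.1 z.2) ^+ 2 + complex.Im (K z.1 z.2) ^+ 2)).
  by apply/funext => z; rewrite /cmod; case: (K _ _).
have ms : measurable_fun setT (@Num.sqrt R).
  by apply: continuous_measurable_fun; exact: sqrt_continuous.
exact: (measurableT_comp ms (measurable_funD (measurable_funX 2 m1) (measurable_funX 2 m2))).
Qed.

Lemma kmeasurable1 K x D : measurable D -> kmeasurable K -> cmeasurable D (K x).
Proof. by move=> mD [m1 m2]; split; apply: measurable_funTS; [exact: (jmeasurable1 x m1)|exact: (jmeasurable1 x m2)]. Qed.

Lemma kmeasurableD K1 K2 : kmeasurable K1 -> kmeasurable K2 -> kmeasurable (fun x y => K1 x y + K2 x y).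
Proof.
move=> [a1 b1] [a2 b2]; split.
- have -> : (fun x y => complex.Re (K1 x y + K2 x y)) =
    (fun x y => complex.Re (K1 x y) + complex.Re (K2 x y)).
    by apply/funext => x; apply/funext => y; case: (K1 x y) => ? ?; case: (K2 x y).
  exact: jmeasurableD.
- have -> : (fun x y => complex.Im (K1 x y + K2 x y)) =
    (fun x y => complex.Im (K1 x y) + complex.Im (K2 x y)).
    by apply/funext => x; apply/funext => y; case: (K1 x y) => ? ?; case: (K2 x y).
  exact: jmeasurableD.
Qed.

Lemma jmeasurableB k l : jmeasurable k -> jmeasurable l -> jmeasurable (fun x y => k x y - l x y : R).
Proof. by move=> mk ml; exact: measurable_funB. Qed.

Lemma kmeasurableM K1 K2 : kmeasurable K1 -> kmeasurable K2 -> kmeasurable (fun x y => K1 x y * K2 x y).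
Proof.
move=> [a1 b1] [a2 b2]; split.
- have -> : (fun x y => complex.Re (K1 x y * K2 x y)) =
    (fun x y => complex.Re (K1 x y) * complex.Re (K2 x y)
              - complex.Im (K1 x y) * complex.Im (K2 x y)).
    by apply/funext => x; apply/funext => y; case: (K1 x y) => ? ?; case: (K2 x y).
  by apply: jmeasurableB; exact: jmeasurableM.
- have -> : (fun x y => complex.Im (K1 x y * K2 x y)) =
    (fun x y => complex.Re (K1 x y) * complex.Im (K2 x y)
              + complex.Im (K1 x y) * complex.Re (K2 x y)).
    by apply/funext => x; apply/funext => y; case: (K1 x y) => ? ?; case: (K2 x y).
  by apply: jmeasurableD; exact: jmeasurableM.
Qed.

Lemma kmeasurable_x f : cmeasurable setT f -> kmeasurable (fun x _ => f x).
Proof. by move=> [m1 m2]; split; [exact: (jmeasurable_x m1)|exact: (jmeasurable_x m2)]. Qed.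

Lemma kmeasurable_y f : cmeasurable setT f -> kmeasurable (fun _ y => f y).
Proof. by move=> [m1 m2]; split; [exact: (jmeasurable_y m1)|exact: (jmeasurable_y m2)]. Qed.

Lemma cbound_add K1 K2 c1 c2 : cbound K1 c1 -> cbound K2 c2 ->
  cbound (fun x y => K1 x y + K2 x y) (2 * (c1 + c2)).
Proof.
move=> [m1 c10 b1] [m2 c20 b2]; split; first exact: kmeasurableD.
  by rewrite mulr_ge0// addr_ge0.
have j1 := jmeasurable_cmod m1; have j2 := jmeasurable_cmod m2.
have p1 x y : 0 <= cmod (K1 x y) by exact: cmod_ge0.
have p2 x y : 0 <= cmod (K2 x y) by exact: cmod_ge0.
apply: (kbound_le (k2 := fun x y => cmod (K1 x y) + cmod (K2 x y))).
- by apply: jmeasurable_cmod; exact: kmeasurableD.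
- exact: jmeasurableD.
- by move=> x y; exact: cmod_ge0.
- by move=> x y; exact: addr_ge0.
- by move=> x y _ _; exact: cmodD.
- exact: kbound_add.
Qed.

(** Joint measurability of kernels is required on the whole plane, so functions
    given on (0, oo) are extended by 0. *)
Lemma cmeasurable_ext f : cmeasurable Rp f -> exists2 f',
  cmeasurable setT f' & forall x, Rp x -> f' x = f x.
Proof.
move=> [m1 m2]; exists (fun x => if x \in Rp then f x else 0); last first.
  by move=> x /mem_set ->.
split.
- rewrite [X in measurable_fun _ X](_ : _ = (fun x => complex.Re (f x)) \_ Rp).
    by apply/(measurable_restrictT _ _).1.
  by apply/funext => x; rewrite patchE /=; case: ifP.
- rewrite [X in measurable_fun _ X](_ : _ = (fun x => complex.Im (f x)) \_ Rp).
    by apply/(measurable_restrictT _ _).1.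
  by apply/funext => x; rewrite patchE /=; case: ifP.
Qed.

Lemma kernel_op_ext K f f' : (forall x, Rp x -> f' x = f x) -> kernel_op K f = kernel_op K f'.
Proof.
by move=> e; apply/funext => x; apply: eq_cintegral => y /e ->.
Qed.

Lemma sqnorm_ext f f' : (forall x, Rp x -> f' x = f x) -> sqnorm f = sqnorm f'.
Proof.
by move=> e; apply: eq_integral => y; rewrite inE => /e ->.
Qed.

Lemma kernel_op_measurable K f : kmeasurable K -> cmeasurable Rp f -> cmeasurable Rp (kernel_op K f).
Proof.
move=> mK /cmeasurable_ext[f' mf' /kernel_op_ext ->].
have [m1 m2] := kmeasurableM mK (kmeasurable_y mf').
split; apply: measurable_funTS; apply: (measurableT_comp (@fine_measurable R setT measurableT)).
- exact: (measurable_integral_Rplus_real m1).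
- exact: (measurable_integral_Rplus_real m2).
Qed.

Lemma kint_measurable K f : kmeasurable K -> cmeasurable Rp f ->
  measurable_fun Rp (fun x => \int[leb]_(y in Rp) (cmod (K x y * f y))%:E)%E.
Proof.
move=> mK mf; have [f' mf' e] := cmeasurable_ext mf.
have := meas_kint (jmeasurable_cmod mK) (measurable_cmod measurableT mf')
  (fun x y => cmod_ge0 _) (fun x => cmod_ge0 _).
move=> h; apply: measurable_funTS; apply: eq_measurable_fun h => x _.
apply: eq_integral => y; rewrite inE => /e ->; by rewrite cmodM.
Qed.

Lemma kernel_op_sqr_le K c f : cbound K c -> L2 f ->
  (\int[leb]_(x in Rp) (\int[leb]_(y in Rp) (cmod (K x y * f y))%:E) ^+ 2
    <= c%:E * sqnorm f)%E.
Proof.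
move=> [mK c0 bK] /L2E[/cmeasurable_ext[f' mf' e] _].
rewrite (sqnorm_ext e).
have h := bK _ (measurable_cmod measurableT mf') (fun x => cmod_ge0 _).
apply: le_trans h; rewrite le_eqVlt; apply/orP; left; apply/eqP.
apply: eq_integral => x _; congr expe.
by apply: eq_integral => y; rewrite inE => /e ->; rewrite cmodM.
Qed.

Lemma kernel_op_sqnorm K c f : cbound K c -> L2 f ->
  (sqnorm (kernel_op K f) <= (2 * c)%:E * sqnorm f)%E.
Proof.
move=> bK fL2; have := kernel_op_sqr_le bK fL2; have [mf _] := fL2.
have [mK c0 _] := bK.
have mKf x : cmeasurable Rp (fun y => K x y * f y).
  by apply: cmeasurableM => //; exact: kmeasurable1.
have mI := kint_measurable mK mf.
move=> h; rewrite EFinM -muleA; apply: le_trans (lee_wpmul2l _ h); last by rewrite lee_fin.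
rewrite -ge0_integralZl//; last 2 first.
- exact: measurable_expe2.
- move=> x _; rewrite expe_ge0//; apply: integral_ge0 => y _.
  by rewrite lee_fin cmod_ge0.
apply: ge0_le_integral => //.
- by move=> x _; rewrite lee_fin sqr_ge0.
- apply/measurable_EFinP; apply: measurable_funX; apply: measurable_cmod => //.
  exact: kernel_op_measurable.
- by apply: emeasurable_funM => //; exact: measurable_expe2.
- by move=> x Rx; exact: cintegral_sqr_le.
Qed.

Lemma kernel_op_L2 K c f : cbound K c -> L2 f -> L2 (kernel_op K f).
Proof.
move=> bK fL2; apply/L2E; have [mK c0 _] := bK; have /L2E[mf nf] := fL2.
split; first exact: kernel_op_measurable.
apply: le_lt_trans (kernel_op_sqnorm bK fL2) _.
by rewrite lte_mul_pinfty// lee_fin mulr_ge0.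
Qed.

(** The square of the inner integral of absolute values is integrable in x, hence
    finite almost everywhere. *)
Lemma kernel_op_ae K c f : cbound K c -> L2 f ->
  {ae leb, forall x, Rp x -> cintegrable Rp (fun y => K x y * f y)}.
Proof.
move=> bK fL2; have := kernel_op_sqr_le bK fL2; have /L2E[mf nf] := fL2.
have [mK c0 _] := bK.
have mKf x : cmeasurable Rp (fun y => K x y * f y).
  by apply: cmeasurableM => //; exact: kmeasurable1.
have mI := kint_measurable mK mf.
have I0 x : (0 <= \int[leb]_(y in Rp) (cmod (K x y * f y))%:E)%E.
  by apply: integral_ge0 => y _; rewrite lee_fin cmod_ge0.
move=> h; have int : leb.-integrable Rp
   (fun x => (\int[leb]_(y in Rp) (cmod (K x y * f y))%:E) ^+ 2)%E.
  apply/integrableP; split; first exact: measurable_expe2.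
  under eq_integral => x _ do rewrite gee0_abs ?expe_ge0//.
  by apply: le_lt_trans h _; rewrite lte_mul_pinfty.
have F := ae_filter_ringOfSetsType leb.
apply: (@filterS _ _ F _ _ _ (integrable_ae (mu := leb) mRp int)) => x /= h1 Rx.
split => //; rewrite ltNge leye_eq; apply/negP => /eqP E.
have : ((\int[leb]_(y in Rp) (cmod (K x y * f y))%:E) ^+ 2)%E \is a fin_num := h1 Rx.
by rewrite E expe2 mulyy.
Qed.

Lemma opnorm_le (T : @operator R) c : 0 <= c ->
  (forall f, L2 f -> (sqnorm (T f) <= (c ^+ 2)%:E * sqnorm f)%E) ->
  (opnorm T <= c%:E)%E.
Proof.
move=> c0 hT; apply: ub_ereal_sup => _ [f [fL2 f1] <-].
rewrite L2norm_le//; apply: le_trans (hT _ fL2) _.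
rewrite -[leRHS]mule1 lee_wpmul2l ?lee_fin ?sqr_ge0//.
by move: f1; rewrite L2norm_le// expr1n.
Qed.

Lemma kernel_op_bounded K c : cbound K c -> bounded_operator (kernel_op K).
Proof.
move=> bK; split.
- by move=> f; exact: kernel_op_L2 bK.
- move=> a f g fL2 gL2.
  have F := ae_filter_ringOfSetsType leb.
  have := @filterI _ _ F _ _ (kernel_op_ae bK fL2) (kernel_op_ae bK gL2).
  apply: (@filterS _ _ F) => x [/= hf hg] Rx.
  rewrite /kernel_op -cintegral_lin//; [|exact: hf|exact: hg].
  by apply: eq_cintegral => y _; ring.
- have [_ c0 _] := bK.
  apply: le_lt_trans (@opnorm_le _ (Num.sqrt (2 * c)) _ _) (ltry _) => // f fL2.
  by rewrite sqr_sqrtr ?mulr_ge0//; exact: kernel_op_sqnorm.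
Qed.

(** Additivity of the integral identifies the difference with kernel_op E at those
    x where the integrals for A and E converge absolutely, that is almost
    everywhere. *)
Lemma kernel_op_subr_opnorm K A E c cK cA : cbound K cK -> cbound A cA -> cbound E c ->
  (forall x y, Rp x -> Rp y -> K x y = A x y + E x y) ->
  (opnorm (fun f x => kernel_op K f x - kernel_op A f x)%R <= (Num.sqrt (2 * c))%:E)%E.
Proof.
move=> bK bA bE KAE; have [_ c0 _] := bE.
apply: opnorm_le => // f fL2.
rewrite sqr_sqrtr ?mulr_ge0//; apply: le_trans (kernel_op_sqnorm bE fL2).
have [mKf _] := kernel_op_L2 bK fL2; have [mAf _] := kernel_op_L2 bA fL2.
have [mEf _] := kernel_op_L2 bE fL2.
rewrite le_eqVlt; apply/orP; left; apply/eqP; apply: sqnorm_ae => //.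
  have -> : (fun x => kernel_op K f x - kernel_op A f x) = (fun x => kernel_op K f x + (-1) * kernel_op A f x).
    by apply/funext => x; rewrite mulN1r.
  by apply: cmeasurableD => //; apply: cmeasurableM => //; exact: cmeasurable_cst.
have F := ae_filter_ringOfSetsType leb.
have := @filterI _ _ F _ _ (kernel_op_ae bA fL2) (kernel_op_ae bE fL2).
apply: (@filterS _ _ F) => x [/= hf hg] Rx.
have -> : kernel_op K f x = kernel_op A f x + kernel_op E f x.
  rewrite /kernel_op -cintegralD//; [|exact: hf|exact: hg].
  by apply: eq_cintegral => y Ry; rewrite KAE// mulrDl.
by rewrite addrAC subrr add0r.
Qed.

End KernelOp.

(** * Finite rank kernels and singular numbers *)

Section FiniteRank.
Context {R : realType}.
Local Notation C := (complex R).
Local Notation leb := (@lebesgue_measure R).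
Local Notation Rp := (@Rplus R).
Let mRp : measurable Rp. Proof. exact: measurable_Rplus. Qed.
#[local] Hint Resolve mRp : core.
#[local] Hint Resolve int_sqr_ge0 : core.
Implicit Types (f g h : R -> C) (D : set R) (K : R -> R -> C) (c : R).

Lemma sqnorm0 : sqnorm (fun=> 0 : C) = 0%E.
Proof. by apply: integral0_eq => x _; rewrite cmod0 expr0n. Qed.

Lemma L2_0 : L2 (fun=> 0 : C).
Proof. by apply/L2E; split; [exact: cmeasurable_cst|rewrite sqnorm0 ltry]. Qed.

Lemma L2_mul_int f g : L2 f -> L2 g -> cintegrable Rp (fun x => f x * g x).
Proof.
move=> /L2E[mf nf] /L2E[mg ng]; split; first exact: cmeasurableM.
have h : ((\int[leb]_(x in Rp) (cmod (f x * g x))%:E) ^+ 2 <= sqnorm f * sqnorm g)%E.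
  apply: le_trans (cauchy_schwarz mRp (measurable_cmod mRp mf) (measurable_cmod mRp mg)
   (fun x _ => cmod_ge0 _) (fun x _ => cmod_ge0 _)).
  rewrite le_eqVlt; apply/orP; left; apply/eqP; congr expe.
  by apply: eq_integral => x _; rewrite cmodM.
rewrite ltNge leye_eq; apply/negP => /eqP E; move: h; rewrite E expe2 mulyy.
rewrite leye_eq => /eqP e; suff : (sqnorm f * sqnorm g < +oo)%E by rewrite e.
by rewrite lte_mul_pinfty ?sqnorm_ge0// ge0_fin_numE ?sqnorm_ge0.
Qed.

Lemma cbound0 : cbound (fun _ _ => 0 : C) 0.
Proof.
split => //; first by split; exact: measurable_cst.
move=> g mg g0; rewrite mul0e integral0_eq// => x _.
by rewrite integral0_eq ?expe2 ?mule0// => y _; rewrite cmod0 mul0r.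
Qed.

(** The squared Hilbert-Schmidt norm, obtained from the Schur test with A
    constant. *)
Lemma cbound_rank1 f g : cmeasurable setT f -> cmeasurable setT g -> L2 f -> L2 g ->
  exists c, cbound (fun x y => f x * g y) c.
Proof.
move=> mf mg /L2E[_ nf] /L2E[_ ng].
exists (fine (sqnorm g) * fine (sqnorm f)).
have mK : kmeasurable (fun x y => f x * g y).
  by apply: kmeasurableM; [exact: kmeasurable_x|exact: kmeasurable_y].
have mcf := measurable_cmod measurableT mf.
have mcg := measurable_cmod measurableT mg.
have fg : sqnorm g \is a fin_num by rewrite ge0_fin_numE ?sqnorm_ge0.
have ff : sqnorm f \is a fin_num by rewrite ge0_fin_numE ?sqnorm_ge0.
split => //; first by rewrite mulr_ge0// fine_ge0// sqnorm_ge0.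
apply: (schur (a := fun _ y => cmod (g y)) (b := fun x _ => cmod (f x))
   (A := fun=> fine (sqnorm g))) => //.
- exact: jmeasurable_cmod.
- exact: jmeasurable_y.
- exact: jmeasurable_x.
- by move=> x y; exact: cmod_ge0.
- by move=> _ y; exact: cmod_ge0.
- by move=> x _; exact: cmod_ge0.
- by move=> x; rewrite fine_ge0// sqnorm_ge0.
- by move=> x y _ _; rewrite cmodM mulrC.
- by move=> x _; rewrite fineK.
- move=> y _; under eq_integral do rewrite EFinM.
  rewrite ge0_integralZl//.
  + by rewrite EFinM !fineK// .
  + by apply/measurable_EFinP; apply: measurable_funX; exact: measurable_funTS.
  + by move=> x _; rewrite lee_fin sqr_ge0.
  + by rewrite lee_fin fine_ge0// sqnorm_ge0.
Qed.

Definition finite_rank_kernel (I : finType) (e b : I -> R -> C) (x y : R) : C :=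
  \sum_i e i x * b i y.

Lemma cbound_finite_rank_kernel (I : finType) (e b : I -> R -> C) :
  (forall i, cmeasurable setT (e i)) -> (forall i, cmeasurable setT (b i)) ->
  (forall i, L2 (e i)) -> (forall i, L2 (b i)) ->
  exists c, cbound (finite_rank_kernel e b) c.
Proof.
move=> me mb Le Lb; rewrite /finite_rank_kernel; elim: (index_enum I) => [|i r [c IH]].
  exists 0; rewrite (_ : (fun _ _ => _) = (fun _ _ => 0)); first exact: cbound0.
  by apply/funext => x; apply/funext => y; rewrite big_nil.
have [d Hd] := cbound_rank1 (me i) (mb i) (Le i) (Lb i).
exists (2 * (d + c)).
rewrite (_ : (fun _ _ => _) = (fun x y => e i x * b i y + \sum_(j <- r) e j x * b j y)).
  exact: cbound_add.
by apply/funext => x; apply/funext => y; rewrite big_cons.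
Qed.

Lemma cintegral_sum (I : Type) (r : seq I) (a : I -> C) (F : I -> R -> C) :
  (forall i, cintegrable Rp (F i)) ->
  cintegral Rp (fun y => \sum_(i <- r) a i * F i y) =
   \sum_(i <- r) a i * cintegral Rp (F i) /\
  cintegrable Rp (fun y => \sum_(i <- r) a i * F i y).
Proof.
move=> iF; elim: r => [|i r [IH1 IH2]].
  rewrite big_nil (_ : (fun y => _) = (fun=> 0)); last first.
    by apply/funext => y; rewrite big_nil.
  by split; [exact: cintegral0|exact: cintegrable0].
rewrite big_cons (_ : (fun y => _) = (fun y => a i * F i y + \sum_(j <- r) a j * F j y)); last first.
  by apply/funext => y; rewrite big_cons.
split; first by rewrite cintegral_lin// IH1.
have [m1 h1] := cintegrableZ (a i) mRp (iF i); have [m2 h2] := IH2.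
split; first exact: cmeasurableD.
apply: (@le_lt_trans _ _ (\int[leb]_(x in Rp) ((cmod (a i * F i x))%:E +
   (cmod (\sum_(j <- r) a j * F j x))%:E))%E).
  apply: ge0_le_integral => //.
  - by move=> x _; rewrite lee_fin cmod_ge0.
  - by apply/measurable_EFinP; apply: measurable_cmod => //; exact: cmeasurableD.
  - by apply/measurable_EFinP; apply: measurable_funD; exact: measurable_cmod.
  - by move=> x _; rewrite lee_fin cmodD.
rewrite ge0_integralD//.
- exact: lte_add_pinfty.
- by move=> x _; rewrite lee_fin cmod_ge0.
- by apply/measurable_EFinP; exact: measurable_cmod.
- by move=> x _; rewrite lee_fin cmod_ge0.
- by apply/measurable_EFinP; exact: measurable_cmod.
Qed.

Lemma rank_le_finite_rank_kernel (I : finType) (e b : I -> R -> C) :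
  (forall i, L2 (e i)) -> (forall i, L2 (b i)) -> rank_le #|I| (kernel_op (finite_rank_kernel e b)).
Proof.
move=> Le Lb; exists (fun k => e (enum_val k)) => // f fL2.
exists (fun k => cintegral Rp (fun y => b (enum_val k) y * f y)).
apply: aeW => x _; rewrite /kernel_op.
have iF i : cintegrable Rp (fun y => b i y * f y) by exact: L2_mul_int.
have [E _] := cintegral_sum (index_enum I) (fun i => e i x) iF.
transitivity (\sum_i e i x * cintegral Rp (fun y => b i y * f y)).
  rewrite -E; apply: eq_cintegral => y _; rewrite /finite_rank_kernel mulr_suml.
  by apply: eq_bigr => i _; rewrite mulrA.
rewrite (eq_bigl (mem I))// big_enum_val /=.
by apply: eq_bigr => k _; rewrite mulrC.
Qed.

Lemma rank_le_mono n m (A : @operator R) : (n <= m)%N -> rank_le n A -> rank_le m A.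
Proof.
move=> nm [e Le rA].
pose ext (T : Type) (d : T) (u : 'I_n -> T) (k : nat) := oapp u d (insub k).
exists (fun i : 'I_m => ext _ (fun=> 0) e i).
  move=> i; rewrite /ext; case: insubP => [j _ _|_] /=; first exact: Le.
  exact: L2_0.
move=> f /rA[c hc]; exists (fun i : 'I_m => ext _ 0 c i).
have F := ae_filter_ringOfSetsType leb.
apply: (@filterS _ _ F _ _ _ hc) => x h Rx; rewrite h//.
transitivity (\sum_(i < n) ext _ 0 c i * ext _ (fun=> 0) e i x).
  by apply: eq_bigr => i _; rewrite /ext valK.
rewrite (big_ord_widen m (fun i => ext _ 0 c i * ext _ (fun=> 0) e i x))//.
rewrite big_mkcond; apply: eq_bigr => i _; case: ifPn => // ni.
by rewrite /ext insubF ?mul0r//; exact: negbTE.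
Qed.

Lemma opnorm_ge0 (T : @operator R) : (0 <= opnorm T)%E.
Proof.
apply: (@le_trans _ _ (L2norm (T (fun=> 0)))); first by rewrite L2normE sqrte_ge0.
apply: ereal_sup_ubound; exists (fun=> 0) => //; split; first exact: L2_0.
by rewrite L2normE sqnorm0 sqrte0.
Qed.

Lemma singular_number_ge0 n (T : @operator R) : (0 <= singular_number n T)%E.
Proof. by apply: le_ereal_inf_tmp => _ [A _ <-]; exact: opnorm_ge0. Qed.

Lemma singular_number_mono n m (T : @operator R) : (n <= m)%N ->
  (singular_number m T <= singular_number n T)%E.
Proof.
move=> nm; apply: ereal_inf_le_tmp => _ [A [bA rA] <-]; exists A => //.
by split => //; exact: rank_le_mono rA.
Qed.

Lemma singular_number_lty n (T : @operator R) : bounded_operator T ->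
  (singular_number n T < +oo)%E.
Proof.
move=> [_ _ bT]; apply: le_lt_trans (singular_number_mono T (leq0n n)) _.
apply: le_lt_trans bT; apply: ereal_inf_lbound; exists (fun _ _ => 0).
  split.
  - split.
    + by move=> *; exact: L2_0.
    + by move=> a f g _ _; apply: aeW => x _; rewrite mulr0 addr0.
    + apply: le_lt_trans (@opnorm_le _ _ 0 _ _) (ltry _) => // f _.
      by rewrite sqnorm0 expr0n mul0e.
  - exists (fun=> fun=> 0) => [i|f _]; first exact: L2_0.
    by exists (fun=> 0); apply: aeW => x _; rewrite big_ord0.
by congr opnorm; apply/funext => f; apply/funext => x; rewrite subr0.
Qed.

Lemma singular_number_le (I : finType) (e b : I -> R -> C) K E cK c :
  (forall i, cmeasurable setT (e i)) -> (forall i, cmeasurable setT (b i)) ->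
  (forall i, L2 (e i)) -> (forall i, L2 (b i)) ->
  cbound K cK -> cbound E c ->
  (forall x y, Rp x -> Rp y -> K x y = finite_rank_kernel e b x y + E x y) ->
  (singular_number #|I| (kernel_op K) <= (Num.sqrt (2 * c))%:E)%E.
Proof.
move=> me mb Le Lb bK bE KE; have [cA bA] := cbound_finite_rank_kernel me mb Le Lb.
apply: le_trans (kernel_op_subr_opnorm bK bA bE KE).
apply: ereal_inf_lbound; exists (kernel_op (finite_rank_kernel e b)) => //.
by split; [exact: kernel_op_bounded bA|exact: rank_le_finite_rank_kernel].
Qed.

(** The partial sums of the s_k(A)^p are bounded by sum_powR_le_count. *)
Lemma schatten_of_count (T : eqType) (p c Z : R) (tau : T -> R) (A : @operator R) :
  0 < p -> 0 < c -> bounded_operator A -> (forall t, 0 <= tau t) ->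
  (forall eps, 0 < eps -> exists l : seq T,
     [/\ uniq l, forall t, t \in l -> eps <= tau t &
         (singular_number (size l) A <= (c * eps)%:E)%E]) ->
  (forall l : seq T, uniq l -> \sum_(t <- l) tau t `^ p <= Z) ->
  schatten p A.
Proof.
move=> p0 c0 bA tau0 count hZ; split => //.
pose s k := fine (singular_number k A).
have sE k : singular_number k A = (s k)%:E.
  by rewrite fineK// ge0_fin_numE ?singular_number_lty// singular_number_ge0.
have s0 k : 0 <= s k by rewrite -lee_fin -sE singular_number_ge0.
have smono i j : (i <= j)%N -> s j <= s i.
  by move=> ij; rewrite -lee_fin -!sE singular_number_mono.
have cnt eps : 0 < eps -> exists l : seq T,
     [/\ uniq l, forall t, t \in l -> eps <= tau t & s (size l) <= c * eps].
  by move=> /count[l [ul h1 h2]]; exists l; split => //; rewrite -lee_fin -sE.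
have h := sum_powR_le_count p0 c0 s0 smono tau0 cnt.
apply: (@le_lt_trans _ _ ((2 * c) `^ p * Z)%:E); last exact: ltry.
apply: lime_le.
  by apply: is_cvg_nneseries => n _ _; exact: poweR_ge0.
apply: nearW => n; rewrite big_mkord.
under eq_bigr do rewrite sE poweR_EFin.
rewrite sumEFin lee_fin; have [l ul hl] := h n; apply: le_trans hl _.
by rewrite ler_wpM2l ?powR_ge0// hZ.
Qed.

End FiniteRank.

(** * Dyadic intervals and weighted Hardy inequalities *)

Section Dyadic.
Context {R : realType}.
Local Notation leb := (@lebesgue_measure R).
Local Notation Rp := (@Rplus R).
Let mRp : measurable Rp.
Proof. exact: measurable_Rplus. Qed.
#[local] Hint Resolve mRp : core.
#[local] Hint Resolve int_sqr_ge0 : core.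

(** Half-open, so that the dyadic intervals partition (0, oo). *)
Definition dyad (n : int) : set R := `[(2 : R) ^ n, (2 : R) ^ (n + 1)[.

Let r : R := Num.sqrt 2.
Let r0 : 0 < r.
Proof. by rewrite sqrtr_gt0. Qed.
Let rr : r * r = 2.
Proof. by rewrite -expr2 sqr_sqrtr. Qed.
Let rn n : 0 < r ^ n.
Proof. exact: exprz_gt0. Qed.
Let rn1 n : r ^ (n + 1) = r ^ n * r.
Proof. by rewrite expfzDr ?gt_eqF// expr1z. Qed.
Let two_r n : (2 : R) ^ n = r ^ n * r ^ n.
Proof. by rewrite -exprMz_comm ?rr ?unitfE ?gt_eqF//; exact: mulrC. Qed.

Lemma two_gt0 (n : int) : 0 < (2 : R) ^ n.
Proof. exact: exprz_gt0. Qed.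

Lemma two_exprzS n : (2 : R) ^ (n + 1) = 2 * 2 ^ n.
Proof. by rewrite expfzDr ?pnatr_eq0// expr1z mulrC. Qed.

Lemma measurable_dyad n : measurable (dyad n).
Proof. exact: measurable_itv. Qed.
#[local] Hint Resolve measurable_dyad : core.

Lemma dyadP n x : dyad n x <-> 2 ^ n <= x < 2 ^ (n + 1).
Proof. by rewrite /dyad /= in_itv. Qed.

Lemma dyad_Rplus n : dyad n `<=` Rp.
Proof.
move=> x /dyadP/andP[h _]; rewrite /Rplus /= in_itv /= andbT.
exact: lt_le_trans (two_gt0 n) h.
Qed.

Lemma RplusP x : Rp x <-> 0 < x.
Proof. by rewrite /Rplus /= in_itv /= andbT. Qed.

Lemma dyad_cover x : Rp x -> exists n, dyad n x.
Proof.
move=> /RplusP x0; have l2 : 0 < ln (2 : R) by rewrite ln_gt0// ltr1n.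
pose t := ln x / ln 2; exists (Num.floor t); apply/dyadP.
have xE : x = 2 `^ t.
  by rewrite /powR pnatr_eq0 /= /t divfK ?gt_eqF// lnK// posrE.
rewrite -!powR_intmul// xE; have /andP[h1 h2] := floor_itv t.
rewrite ler_powR ?ler1n//= /powR pnatr_eq0 /= ltr_expR ltr_pM2r//.
Qed.

Lemma dyad_uniq n m x : dyad n x -> dyad m x -> n = m.
Proof.
move=> /dyadP/andP[n1 n2] /dyadP/andP[m1 m2].
have aux (a b : int) : (2 : R) ^ a < 2 ^ (b + 1) -> (a <= b)%R.
  by move=> h; rewrite -ltzD1 -(ltr_eXz2l (x := 2 : R)) ?ltr1n.
by apply/eqP; rewrite eq_le (aux n m (le_lt_trans n1 m2)) (aux m n (le_lt_trans m1 n2)).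
Qed.

Lemma dyad_trivIset (J : nat -> int) : injective J ->
  trivIset setT (fun k => dyad (J k)).
Proof.
move=> injJ i j _ _ [x [xi xj]]; apply: injJ; exact: dyad_uniq xi xj.
Qed.

Lemma sum_geometric_le (q : R) N : 0 <= q -> q <= 3/4 -> \sum_(k < N) q ^+ k <= 4.
Proof.
move=> q0 q1; suff : \sum_(k < N) q ^+ k <= 4 * (1 - q ^+ N).
  by move=> h; apply: le_trans h _; have := exprn_ge0 N q0; lra.
elim: N => [|N IH]; first by rewrite big_ord0 expr0 subrr mulr0.
rewrite big_ord_recr /= exprSr; have := exprn_ge0 N q0.
move: (q ^+ N) IH => z IH z0; nra.
Qed.

Let ri34 : r^-1 <= 3/4.
Proof.
rewrite -[leRHS]invrK lef_pV2 ?posrE ?invr_gt0//.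
rewrite -(@ler_pXn2r _ 2) ?nnegrE ?invr_ge0 ?(ltW r0)// [r ^+ 2]expr2 rr; lra.
Qed.

(** The dyadic contributions decay like a geometric series with ratio 1 / sqrt 2
    <= 3/4, whose sum is at most 4. J enumerates the dyadic intervals below or
    above a given point. *)
Lemma int_dyadic_le (J : nat -> int) (h : R -> R) (c : R) : injective J ->
  measurable_fun setT h -> (forall y, 0 <= h y) ->
  (forall y, Rp y -> h y != 0 -> exists k, dyad (J k) y) ->
  (forall k, (\int[leb]_(x in dyad (J k)) (h x)%:E <= (c * r^-1 ^+ k)%:E)%E) ->
  (\int[leb]_(x in Rp) (h x)%:E <= (4 * c)%:E)%E.
Proof.
move=> injJ mh h0 sup hk.
have c0 : 0 <= c.
  have := hk 0; rewrite expr0 mulr1 -lee_fin; apply: le_trans.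
  by apply: integral_ge0 => x _; rewrite lee_fin.
pose U := \bigcup_k dyad (J k).
have -> : (\int[leb]_(x in Rp) (h x)%:E = \int[leb]_(x in U) (h x)%:E)%E.
  rewrite integral_mkcond [RHS]integral_mkcond; apply: eq_integral => x _.
  rewrite !patchE; case: ifPn => xR; case: ifPn => // xU.
    have [->//|hx] := eqVneq (h x) 0.
    case/negP: xU; rewrite inE; have [|k xk] := sup x _ hx; first by rewrite inE in xR.
    by exists k.
  case/negP: xR; rewrite inE; rewrite inE in xU; have [k _ /dyad_Rplus] := xU.
  by [].
rewrite (ge0_integral_bigcup leb) //; last 4 first.
- by move=> k; exact: measurable_dyad.
- by apply/measurable_EFinP; exact: measurable_funTS.
- by move=> x _; rewrite lee_fin.
- exact: dyad_trivIset.
apply: lime_le.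
  apply: is_cvg_nneseries => n _ _; apply: integral_ge0 => x _; by rewrite lee_fin.
apply: nearW => n; rewrite big_mkord.
apply: (@le_trans _ _ (\sum_(k < n) (c * r^-1 ^+ k)%:E)%E).
  by apply: lee_sum => k _; exact: hk.
rewrite sumEFin lee_fin -mulr_sumr mulrC ler_wpM2r//.
by apply: sum_geometric_le => //; rewrite invr_ge0 ltW.
Qed.

Let sqrt_two n : Num.sqrt ((2 : R) ^ n) = r ^ n.
Proof. by rewrite two_r -expr2 sqrtr_sqr gtr0_norm. Qed.

Let sqrt_dyad n x : dyad n x -> r ^ n <= Num.sqrt x <= r ^ n * r.
Proof.
move=> /dyadP/andP[h1 h2]; have x0 : 0 <= x := le_trans (ltW (two_gt0 n)) h1.
by rewrite -rn1 -!sqrt_two !ler_sqrt ?h1 ?(ltW h2)// ltW// two_gt0.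
Qed.

Lemma leb_dyad n : leb (dyad n) = (2 ^ n)%:E.
Proof.
rewrite lebesgue_measure_itv /= lte_fin two_exprzS ltr_pMl ?two_gt0// ltr1n -EFinD.
by congr EFin; ring.
Qed.

Lemma measurable_boolR d (T : measurableType d) (b : T -> bool) :
  measurable_fun setT b -> measurable_fun setT (fun x => (b x)%:R : R).
Proof.
move=> mb; rewrite (_ : (fun _ => _) = (fun x => if b x then 1 else 0)).
  exact: measurable_fun_ifT.
by apply/funext => x; case: (b x).
Qed.

Lemma jmeasurable_le : jmeasurable (fun x y : R => (y <= x)%R%:R).
Proof.
apply: (@measurable_boolR _ _ (fun z : R * R => z.2 <= z.1)).
by apply: measurable_fun_ler; [exact: measurable_snd|exact: measurable_fst].
Qed.

Lemma jmeasurable_lt : jmeasurable (fun x y : R => (y < x)%R%:R).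
Proof.
apply: (@measurable_boolR _ _ (fun z : R * R => z.2 < z.1)).
by apply: measurable_fun_ltr; [exact: measurable_snd|exact: measurable_fst].
Qed.

Lemma measurable_sqrt : measurable_fun setT (@Num.sqrt R).
Proof. by apply: continuous_measurable_fun; exact: sqrt_continuous. Qed.

Lemma measurable_inv_sqrt : measurable_fun setT (fun y : R => (Num.sqrt y)^-1).
Proof.
rewrite (_ : (fun _ => _) = (fun y => Num.sqrt y `^ (-1))).
  exact: (measurableT_comp (measurable_powR _) measurable_sqrt).
by apply/funext => y; rewrite powR_inv1// sqrtr_ge0.
Qed.

(** On the dyadic interval of index m - k the integral is at most 2^((m-k)/2),
    where m is the index of the interval of x. The constant is not sharp: the
    integral is 2 * sqrt x. *)
Lemma int_inv_sqrt_le x : Rp x ->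
  (\int[leb]_(y in Rp) ((Num.sqrt y)^-1 * (y <= x)%R%:R)%:E <= (4 * Num.sqrt x)%:E)%E.
Proof.
move=> /[dup] Rx /dyad_cover[m xm].
have /andP[s1 s2] := sqrt_dyad xm.
apply: (@le_trans _ _ (4 * r ^ m)%:E); last by rewrite lee_fin ler_wpM2l.
apply: (int_dyadic_le (J := fun k : nat => m - k%:Z)).
- by move=> i j /addrI/oppr_inj [].
- apply: measurable_funM; first exact: measurable_inv_sqrt.
  by apply: (jmeasurable1 x jmeasurable_le).
- by move=> y; rewrite mulr_ge0 ?invr_ge0 ?sqrtr_ge0.
- move=> y Ry; have [yx _|] := leP y x; last by rewrite mulr0 eqxx.
  have [n yn] := dyad_cover Ry; have nm : (n <= m)%R.
    rewrite -ltzD1 -(ltr_eXz2l (x := 2 : R)) ?ltr1n//.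
    by move/dyadP/andP : yn => [y1 _]; move/dyadP/andP : xm => [_ y2]; lra.
  exists `|m - n|%N; rewrite gez0_abs ?subr_ge0// opprB addrCA subrr addr0 //.
- move=> k; set n := m - k%:Z.
  apply: (@le_trans _ _ (\int[leb]_(y in dyad n) (r ^ n)^-1%:E)%E).
    apply: ge0_le_integral => //.
    + exact: measurable_dyad.
    + apply/measurable_EFinP; apply: measurable_funTS; apply: measurable_funM.
        exact: measurable_inv_sqrt.
      by apply: (jmeasurable1 x jmeasurable_le).
    + move=> y yn; have /andP[t1 t2] := sqrt_dyad yn; rewrite lee_fin.
      rewrite -[leRHS]mulr1 ler_pM ?invr_ge0 ?sqrtr_ge0//; last by case: (boolP (y <= x)).
      by rewrite lef_pV2 ?posrE// (lt_le_trans _ t1).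
  rewrite (_ : \int[leb]_(y in dyad n) _ = (r ^ n)^-1%:E * leb (dyad n))%E; last exact: (integral_cst leb (measurable_dyad n) (r ^ n)^-1%:E).
  rewrite leb_dyad -EFinM lee_fin two_r mulKf ?gt_eqF// /n.
  by rewrite expfzDr ?gt_eqF// -invr_expz exprVn.
Qed.

(** On the dyadic interval of index m + k the function sqrt y is at most sqrt 2 *
    2^((m+k)/2), so the integral there is at most sqrt 2 * e * 2^(-(m+k)/2). *)
Lemma int_sqrt_tail_le (psi : R -> R) (e : R) x : Rp x ->
  measurable_fun setT psi ->
  (forall n, (\int[leb]_(y in dyad n) (psi y ^+ 2)%:E <= (e * (2 ^ n)^-1)%:E)%E) ->
  (\int[leb]_(y in Rp) (psi y ^+ 2 * Num.sqrt y * (x <= y)%R%:R)%:E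
     <= (8 * e / Num.sqrt x)%:E)%E.
Proof.
move=> /[dup] Rx /dyad_cover[m xm] mpsi he.
have /andP[s1 s2] := sqrt_dyad xm.
have e0 : 0 <= e.
  have := le_trans (int_sqr_ge0 _ _) (he 0); rewrite expr0z invr1 mulr1 lee_fin.
  by [].
have mh : measurable_fun setT (fun y => psi y ^+ 2 * Num.sqrt y * (x <= y)%R%:R).
  apply: measurable_funM; last exact: (jmeasurable2 x jmeasurable_le).
  by apply: measurable_funM; [exact: measurable_funX|exact: measurable_sqrt].
apply: (@le_trans _ _ (4 * (e * r * (r ^ m)^-1))%:E); last first.
  rewrite lee_fin (_ : 8 * e / Num.sqrt x = 4 * (e * r * (r / Num.sqrt x))).
    rewrite ler_wpM2l// ler_wpM2l ?mulr_ge0 ?(ltW r0)//.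
    rewrite -[leLHS]mul1r ler_pdivrMr// mulrAC ler_pdivlMr ?(lt_le_trans _ s1)// mul1r.
    by rewrite mulrC.
  have -> : 8 = 4 * (r * r) :> R by rewrite rr; ring.
  by ring.
apply: (int_dyadic_le (J := fun k : nat => m + k%:Z)) => //.
- by move=> i j /addrI [].
- by move=> y; rewrite mulr_ge0// mulr_ge0 ?sqr_ge0 ?sqrtr_ge0.
- move=> y Ry; have [xy _|] := leP x y; last by rewrite mulr0 eqxx.
  have [n yn] := dyad_cover Ry; have nm : (m <= n)%R.
    rewrite -ltzD1 -(ltr_eXz2l (x := 2 : R)) ?ltr1n//.
    by move/dyadP/andP : yn => [_ y1]; move/dyadP/andP : xm => [y2 _]; lra.
  exists `|n - m|%N; rewrite gez0_abs ?subr_ge0// addrCA subrr addr0 //.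
- move=> k; set n := m + k%:Z.
  apply: (@le_trans _ _ (\int[leb]_(y in dyad n) ((r ^ n * r)%:E * (psi y ^+ 2)%:E))%E).
    apply: ge0_le_integral => //.
    + exact: measurable_dyad.
    + by move=> y _; rewrite lee_fin mulr_ge0// mulr_ge0 ?sqr_ge0 ?sqrtr_ge0.
    + by apply/measurable_EFinP; exact: measurable_funTS.
    + apply/measurable_EFinP; apply: measurable_funM => //.
      by apply: measurable_funX; exact: measurable_funTS.
    + move=> y yn; have /andP[t1 t2] := sqrt_dyad yn; rewrite -EFinM lee_fin.
      have pos : 0 <= psi y ^+ 2 * Num.sqrt y by rewrite mulr_ge0 ?sqr_ge0 ?sqrtr_ge0.
      rewrite -[leRHS]mulr1 ler_pM//; last by case: (boolP (x <= y)).
      by rewrite mulrC ler_wpM2r ?sqr_ge0.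
  rewrite ge0_integralZl//.
  + apply: (@le_trans _ _ ((r ^ n * r)%:E * (e * (2 ^ n)^-1)%:E)%E).
      by apply: lee_wpmul2l (he n); rewrite lee_fin mulr_ge0// ltW.
    rewrite -EFinM lee_fin two_r.
    rewrite (_ : e * r / r ^ m * r^-1 ^+ k = e * r / r ^ n); last first.
      by rewrite /n expfzDr ?gt_eqF// exprVn invfM !mulrA.
    rewrite le_eqVlt; apply/orP; left; apply/eqP; field.
    by rewrite gt_eqF.
  + exact: measurable_dyad.
  + by apply/measurable_EFinP; apply: measurable_funX; exact: measurable_funTS.
  + by move=> y _; rewrite lee_fin sqr_ge0.
  + by rewrite lee_fin mulr_ge0// ltW.
Qed.

Let v (y : R) := Num.sqrt (Num.sqrt y).
Let v0 y : 0 <= v y.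
Proof. exact: sqrtr_ge0. Qed.
Let v2 y : v y ^+ 2 = Num.sqrt y.
Proof. by rewrite sqr_sqrtr// sqrtr_ge0. Qed.
Let mv : measurable_fun setT v.
Proof. exact: (measurableT_comp measurable_sqrt measurable_sqrt). Qed.
Let mvi : measurable_fun setT (fun y => (v y)^-1).
Proof. exact: (measurableT_comp measurable_inv_sqrt measurable_sqrt). Qed.
Let vp y : Rp y -> 0 < v y.
Proof. by move=> /RplusP y0; rewrite !sqrtr_gt0. Qed.
Let bb (b : bool) : b%:R ^+ 2 = b%:R :> R.
Proof. by case: b; rewrite ?expr1n ?expr0n. Qed.

Variables (psi : R -> R) (e : R).
Hypothesis mpsi : measurable_fun setT psi.
Hypothesis psi0 : forall x, 0 <= psi x.
Hypothesis he : forall n, (\int[leb]_(y in dyad n) (psi y ^+ 2)%:E <= (e * (2 ^ n)^-1)%:E)%E.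

Let e0 : 0 <= e.
Proof.
have := le_trans (int_sqr_ge0 _ _) (he 0); rewrite expr0z invr1 mulr1 lee_fin.
by [].
Qed.

(** Schur test with the weight v(y) = y^(1/4): the kernel is the product of
    1_(y<=x) / v(y) and psi(x) v(y) 1_(y<=x). The first factor contributes A(x) =
    4 sqrt x (int_inv_sqrt_le), and the integral of 4 sqrt x psi(x)^2 sqrt y over
    x >= y is at most 4 * 8 e (int_sqrt_tail_le). *)
Lemma hardy_bound : kbound (fun x y => psi x * (y <= x)%R%:R) (32 * e).
Proof.
apply: (schur (a := fun x y => (v y)^-1 * (y <= x)%R%:R)
   (b := fun x y => psi x * v y * (y <= x)%R%:R) (A := fun x => 4 * Num.sqrt x)).
- by apply: jmeasurableM; [exact: jmeasurable_x|exact: jmeasurable_le].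
- by apply: jmeasurableM; [exact: jmeasurable_y|exact: jmeasurable_le].
- apply: jmeasurableM; last exact: jmeasurable_le.
  by apply: jmeasurableM; [exact: jmeasurable_x|exact: jmeasurable_y].
- by apply: measurable_funM => //; exact: measurable_sqrt.
- by move=> x y; rewrite mulr_ge0.
- by move=> x y; rewrite mulr_ge0// invr_ge0.
- by move=> x y; rewrite !mulr_ge0.
- by move=> x; rewrite mulr_ge0// sqrtr_ge0.
- move=> x y Rx Ry; case: (boolP (y <= x)) => _; last by rewrite !mulr0.
  by rewrite !mulr1 mulrCA mulVf ?mulr1// gt_eqF// vp.
- move=> x Rx; apply: le_trans (int_inv_sqrt_le Rx).
  rewrite le_eqVlt; apply/orP; left; apply/eqP; apply: eq_integral => y _.
  by rewrite exprMn exprVn v2 bb.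
move=> y Ry; have vy := vp Ry; have sy : 0 < Num.sqrt y by rewrite sqrtr_gt0; exact/RplusP.
apply: (@le_trans _ _ (\int[leb]_(x in Rp) ((4 * Num.sqrt y)%:E *
    (psi x ^+ 2 * Num.sqrt x * (y <= x)%R%:R)%:E))%E).
  rewrite le_eqVlt; apply/orP; left; apply/eqP; apply: eq_integral => x _.
  by rewrite !exprMn v2 bb -EFinM; congr EFin; ring.
rewrite ge0_integralZl//.
- apply: le_trans (lee_wpmul2l _ (int_sqrt_tail_le Ry mpsi he)) _.
    by rewrite lee_fin mulr_ge0// ltW.
  rewrite -EFinM lee_fin le_eqVlt; apply/orP; left; apply/eqP; field.
  by rewrite gt_eqF.
- apply/measurable_EFinP; apply: measurable_funTS.
  apply: measurable_funM; last exact: (jmeasurable2 y jmeasurable_le).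
  by apply: measurable_funM; [exact: measurable_funX|exact: measurable_sqrt].
- by move=> x _; rewrite lee_fin mulr_ge0// mulr_ge0 ?sqr_ge0 ?sqrtr_ge0.
Qed.

(** The same weight with the roles of the two factors exchanged. *)
Lemma hardy_dual_bound : kbound (fun x y => psi y * (x <= y)%R%:R) (32 * e).
Proof.
have jle := jmeasurable_swap jmeasurable_le.
apply: (schur (a := fun x y => psi y * v y * (x <= y)%R%:R)
   (b := fun x y => (v y)^-1 * (x <= y)%R%:R) (A := fun x => 8 * e * (Num.sqrt x)^-1)).
- by apply: jmeasurableM => //; exact: jmeasurable_y.
- apply: jmeasurableM => //.
  by apply: jmeasurableM; exact: jmeasurable_y.
- by apply: jmeasurableM => //; exact: jmeasurable_y.
- by apply: measurable_funM => //; exact: measurable_inv_sqrt.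
- by move=> x y; rewrite mulr_ge0.
- by move=> x y; rewrite !mulr_ge0.
- by move=> x y; rewrite mulr_ge0// invr_ge0.
- by move=> x; rewrite !mulr_ge0// invr_ge0 sqrtr_ge0.
- move=> x y Rx Ry; case: (boolP (x <= y)) => _; last by rewrite !mulr0.
  by rewrite !mulr1 -mulrA divff ?mulr1// gt_eqF// vp.
- move=> x Rx; apply: le_trans (int_sqrt_tail_le Rx mpsi he).
  rewrite le_eqVlt; apply/orP; left; apply/eqP; apply: eq_integral => y _.
  by rewrite !exprMn v2 bb.
move=> y Ry; have vy := vp Ry; have sy : 0 < Num.sqrt y by rewrite sqrtr_gt0; exact/RplusP.
apply: (@le_trans _ _ (\int[leb]_(x in Rp) ((8 * e / Num.sqrt y)%:E *
    ((Num.sqrt x)^-1 * (x <= y)%R%:R)%:E))%E).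
  rewrite le_eqVlt; apply/orP; left; apply/eqP; apply: eq_integral => x _.
  by rewrite !exprMn exprVn v2 bb -EFinM; congr EFin; ring.
have c0 : 0 <= 8 * e / Num.sqrt y by rewrite !mulr_ge0// invr_ge0 ltW.
rewrite ge0_integralZl//.
- apply: le_trans (lee_wpmul2l _ (int_inv_sqrt_le Ry)) _; first by rewrite lee_fin.
  rewrite -EFinM lee_fin le_eqVlt; apply/orP; left; apply/eqP; field.
  by rewrite gt_eqF.
- apply/measurable_EFinP; apply: measurable_funTS.
  apply: measurable_funM; last exact: (jmeasurable2 y jle).
  exact: measurable_inv_sqrt.
Qed.

End Dyadic.

(** * Kernels supported on a disjoint union of squares *)

Section Pieces.
Context {R : realType}.
Local Notation leb := (@lebesgue_measure R).
Local Notation Rp := (@Rplus R).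
Let mRp : measurable Rp.
Proof. exact: measurable_Rplus. Qed.
#[local] Hint Resolve mRp : core.
#[local] Hint Resolve int_sqr_ge0 : core.

(** Let G(t) be the relative length of [a, t[ plus its relative mass. G increases
    continuously from 0 to 2, so there are points c i at which G takes the values
    2 i / k. On each piece relative length and mass add up to 2 / k, and by the
    inequality of the arithmetic and geometric means their product is at most 1 /
    k^2. *)
Lemma equipartition (h : R -> R) (a b Q : R) (k : nat) : a < b -> 0 < Q -> (0 < k)%N ->
  measurable_fun setT h -> (forall x, 0 <= h x) ->
  (\int[leb]_(x in `[a, b[) (h x)%:E = Q%:E)%E ->
  exists2 c : nat -> R, [/\ c 0 = a, c k = b & forall i, c i <= c i.+1] &
  forall i, (i < k)%N -> exists w : R, [/\ 0 <= w,
    (\int[leb]_(x in `[c i, c i.+1[) (h x)%:E = w%:E)%E &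
    (c i.+1 - c i) * w <= (b - a) * Q / k%:R ^+ 2].
Proof.
move=> ab Q0 k0 mh h0 hQ.
have mhI (D : set R) : measurable D -> measurable_fun D (EFin \o h).
  by move=> mD; apply/measurable_EFinP; exact: measurable_funTS.
have hQ' : (\int[leb]_(x in `[a, b]) (h x)%:E = Q%:E)%E.
  by rewrite -integral_itv_bndo_bndc//; exact: mhI.
have iab : leb.-integrable `[a, b] (EFin \o h).
  apply/integrableP; split; first exact: mhI.
  by under eq_integral => x _ do rewrite /= ger0_norm//; rewrite hQ' ltry.
pose F (t : R) := \int[leb]_(x in `[a, t]) h x.
have isub s t : a <= s -> t <= b -> leb.-integrable `]s, t] (EFin \o h).
  move=> as_ tb; apply: integrableS iab => //.
  by move=> x /=; rewrite !in_itv /= => /andP[h1 h2]; lra.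
have isub' t : t <= b -> leb.-integrable `[a, t] (EFin \o h).
  move=> tb; apply: integrableS iab => //.
  by move=> x /=; rewrite !in_itv /= => /andP[h1 h2]; lra.
have FB s t : a <= s -> s <= t -> t <= b -> F t - F s = \int[leb]_(x in `]s, t]) h x.
  move=> as_ st tb; rewrite /F Rintegral_itvB//.
  exact: isub'.
have F0 s t : 0 <= \int[leb]_(x in `]s, t]) h x.
  by apply: Rintegral_ge0 => x _.
have Fmono s t : a <= s -> s <= t -> t <= b -> F s <= F t.
  by move=> as_ st tb; rewrite -subr_ge0 FB.
have Fa : F a = 0 by rewrite /F set_itv1 Rintegral_set1.
have Fb : F b = Q by rewrite /F /Rintegral hQ'.
pose G (t : R) := (t - a) / (b - a) + F t / Q.
have ba : 0 < b - a by rewrite subr_gt0.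
have Ga : G a = 0 by rewrite /G Fa subrr !mul0r addr0.
have Gb : G b = 2 by rewrite /G Fb !divff ?gt_eqF.
have Gmono s t : a <= s -> s < t -> t <= b -> G s < G t.
  move=> as_ st tb; rewrite /G ltr_leD//.
    by rewrite ltr_pM2r ?invr_gt0//; lra.
  by rewrite ler_pM2r ?invr_gt0// Fmono// ltW.
have Gcont : {within `[a, b], continuous G}.
  have c1 : {within `[a, b], continuous (fun t : R => (t - a) / (b - a))}.
    apply: continuous_subspaceT => y; apply: cvgM; last exact: cvg_cst.
    by apply: cvgB; [exact: cvg_id|exact: cvg_cst].
  have c2 : {within `[a, b], continuous F}.
    by apply: parameterized_integral_continuous => //; exact: ltW.
  move=> x; apply: cvgD; first exact: c1.
  by apply: cvgM; [exact: c2|exact: cvg_cst].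
have kR : 0 < k%:R :> R by rewrite ltr0n.
(* The minimum with k keeps c inside [a, b], where it stays equal to b from k on. *)
have /choice[c hc] : forall i : nat, exists x : R,
    a <= x <= b /\ G x = 2 * (minn i k)%:R / k%:R.
  move=> i; have [|x] := @IVT R G a b (2 * (minn i k)%:R / k%:R) (ltW ab) Gcont.
    rewrite Ga Gb minElt maxElt ltr0n /=; apply/andP; split.
      by rewrite divr_ge0 ?mulr_ge0// ltW.
    by rewrite ler_pdivrMr// ler_pM2l// ler_nat geq_minr.
  by rewrite in_itv /= => xab Gx; exists x.
have cG i j : G (c i) <= G (c j) -> c i <= c j.
  move=> Gij; rewrite leNgt; apply/negP => cji.
  have [/andP[ai bi] _] := hc i; have [/andP[aj bj] _] := hc j.
  by have := Gmono _ _ aj cji bi; rewrite ltNge Gij.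
have cmono i : c i <= c i.+1.
  apply: cG; rewrite !(hc _).2 ler_pM2r ?invr_gt0// ler_pM2l// ler_nat.
  by rewrite leq_min geq_minr andbT (leq_trans (geq_minl _ _)).
exists c; first split => //.
- have [/andP[ai bi] Gi] := hc 0; apply/eqP; rewrite eq_le ai andbT leNgt; apply/negP => ac.
  have := Gmono _ _ (lexx a) ac bi; rewrite Ga Gi min0n mulr0 mul0r ltxx //.
- have [/andP[ai bi] Gi] := hc k; apply/eqP; rewrite eq_le bi /= leNgt; apply/negP => ac.
  by have := Gmono _ _ ai ac (lexx b); rewrite Gb Gi minnn mulfK ?gt_eqF// ltxx.
move=> i ik; exists (F (c i.+1) - F (c i)).
have [/andP[ai bi] Gi] := hc i; have [/andP[aj bj] Gj] := hc i.+1.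
have w0 : 0 <= F (c i.+1) - F (c i) by rewrite FB// F0.
split => //.
  rewrite FB// /Rintegral fineK.
    rewrite integral_itv_bndo_bndc; last exact: mhI.
    by rewrite integral_itv_obnd_cbnd//; exact: mhI.
  by apply: integrable_fin_num => //; exact: isub.
have E : (c i.+1 - c i) / (b - a) + (F (c i.+1) - F (c i)) / Q = 2 / k%:R.
  transitivity (G (c i.+1) - G (c i)); first by rewrite /G; ring.
  by rewrite Gi Gj (minn_idPl (ltnW ik)) (minn_idPl ik) -(natr1 i); ring.
set u := c i.+1 - c i in E *; set w := F (c i.+1) - F (c i) in E *.
have uv : (u / (b - a)) * (w / Q) <= (1 / k%:R) ^+ 2.
  have := sqr_ge0 (u / (b - a) - w / Q); move: E.
  by move: (u / _) (w / _) => y z E; have -> : 1 / k%:R = (y + z) / 2 :> R; [rewrite E; lra|nra].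
have -> : u * w = (u / (b - a)) * (w / Q) * ((b - a) * Q).
  by field; rewrite !gt_eqF.
apply: le_trans (ler_wpM2r _ uv) _; first by rewrite mulr_ge0 ?ltW.
by rewrite expr_div_n expr1n mulrC mul1r.
Qed.

Lemma integral_indicator (D E : set R) (b : R -> bool) (h : R -> R) : E `<=` D ->
  (forall x, E x <-> b x) ->
  (\int[leb]_(x in D) (h x * (b x)%:R)%:E = \int[leb]_(x in E) (h x)%:E)%E.
Proof.
move=> ED Eb; rewrite integral_mkcond [RHS]integral_mkcond; apply: eq_integral => x _.
rewrite !patchE; have -> : (x \in E) = b x.
  by apply/idP/idP => [|bx]; [rewrite inE => /Eb|rewrite inE; apply/Eb].
case: (boolP (b x)) => bx; last by rewrite mulr0; case: ifP.
by have -> : x \in D; [rewrite inE; apply: ED; apply/Eb|rewrite mulr1].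
Qed.

Section Blocks.
Variables (I : finType) (s t w : I -> R) (psi : R -> R) (d : R).
Hypothesis st : forall i, s i <= t i.
Hypothesis s0 : forall i, 0 < s i.
Hypothesis disj : forall i j x, s i <= x < t i -> s j <= x < t j -> i = j.
Hypothesis mpsi : measurable_fun setT psi.
Hypothesis psi0 : forall x, 0 <= psi x.
Hypothesis w0 : forall i, 0 <= w i.
Hypothesis hw : forall i, (\int[leb]_(x in `[s i, t i[) (psi x ^+ 2)%:E = (w i)%:E)%E.
Hypothesis d0 : 0 <= d.
Hypothesis hd : forall i, (t i - s i) * w i <= d.

Let mJ i : measurable (`[s i, t i[ : set R).
Proof. exact: measurable_itv. Qed.

(** The indicator of the union of the squares J x J, where J runs through the
    disjoint intervals [s i, t i[. *)
Definition block_kernel (x y : R) : R :=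
  \sum_i (s i <= x < t i)%R%:R * (s i <= y < t i)%R%:R.

Lemma measurable_ind i : measurable_fun setT (fun x : R => (s i <= x < t i)%R%:R : R).
Proof.
apply: (@measurable_boolR _ _ _ (fun x => s i <= x < t i)).
by apply: measurable_and; [exact: measurable_fun_ler|exact: measurable_fun_ltr].
Qed.

Lemma jmeasurable_sum (J : Type) (r : seq J) (k : J -> R -> R -> R) :
  (forall i, jmeasurable (k i)) -> jmeasurable (fun x y => \sum_(i <- r) k i x y).
Proof. by move=> mk; exact: measurable_sum. Qed.

Lemma jmeasurable_block_kernel : jmeasurable block_kernel.
Proof.
apply: jmeasurable_sum => i; apply: jmeasurableM.
  exact: (jmeasurable_x (measurable_ind i)).
exact: (jmeasurable_y (measurable_ind i)).
Qed.

Lemma block_kernel_in i x y : s i <= x < t i -> block_kernel x y = (s i <= y < t i)%R%:R.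
Proof.
move=> xi; rewrite /block_kernel (bigD1 i)//= xi mul1r big1 ?addr0// => j ji.
case: (boolP (s j <= x < t j)) => xj; last by rewrite mul0r.
by rewrite (disj xj xi) eqxx in ji.
Qed.

Lemma block_kernel_out x y : (forall i, ~~ (s i <= x < t i)) -> block_kernel x y = 0.
Proof. by move=> h; rewrite /block_kernel big1// => i _; rewrite (negbTE (h i)) mul0r. Qed.

Lemma block_kernel_sym x y : block_kernel x y = block_kernel y x.
Proof. by apply: eq_bigr => i _; rewrite mulrC. Qed.

Lemma block_kernel_ge0 x y : 0 <= block_kernel x y.
Proof. by rewrite sumr_ge0// => i _; rewrite mulr_ge0. Qed.

Lemma block_kernel_sqr x y : block_kernel x y ^+ 2 = block_kernel x y.
Proof.
have [i xi|h] := pickP (fun i => s i <= x < t i).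
  by rewrite (block_kernel_in _ xi); case: (_ <= _ < _); rewrite ?expr1n ?expr0n.
by rewrite block_kernel_out ?expr0n// => i; rewrite h.
Qed.

Lemma int_Rplus_piece i (h : R -> R) :
  (\int[leb]_(y in Rp) (h y * (s i <= y < t i)%R%:R)%:E = \int[leb]_(y in `[s i, t i[) (h y)%:E)%E.
Proof.
apply: integral_indicator.
  move=> y /=; rewrite in_itv /= => /andP[h1 _]; apply/RplusP.
  exact: lt_le_trans (s0 i) h1.
by move=> y; rewrite /= in_itv.
Qed.

Lemma int_piece i : (\int[leb]_(y in `[s i, t i[) 1%:E = (t i - s i)%:E)%E.
Proof.
transitivity (1 * leb `[s i, t i[)%E; first exact: (integral_cst leb (measurable_itv _) 1%E).
rewrite mul1e lebesgue_measure_itv /= lte_fin; case: ltP => // h.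
by have /eqP -> : s i == t i; [rewrite eq_le st h|rewrite subrr].
Qed.

Let A (v : I -> R) x := \sum_i (s i <= x < t i)%R%:R * v i.
Let mA v : measurable_fun setT (A v).
Proof.
apply: measurable_sum => i; apply: measurable_funM; last exact: measurable_cst.
exact: measurable_ind.
Qed.
Let A0 v x : (forall i, 0 <= v i) -> 0 <= A v x.
Proof. by move=> v0; rewrite sumr_ge0// => i _; rewrite mulr_ge0. Qed.
Let A_in v i x : s i <= x < t i -> A v x = v i.
Proof.
move=> xi; rewrite /A (bigD1 i)//= xi mul1r big1 ?addr0// => j ji.
case: (boolP (s j <= x < t j)) => xj; last by rewrite mul0r.
by rewrite (disj xj xi) eqxx in ji.
Qed.

(** Schur test with the factors 1_J(y) and psi(x) 1_J(x): the first gives A(x) =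
    |J| for x in J, and |J| times the integral of psi^2 over J is at most d. *)
Lemma block_bound : kbound (fun x y => psi x * block_kernel x y) d.
Proof.
have ts0 i : 0 <= t i - s i by rewrite subr_ge0.
apply: (schur (a := block_kernel) (b := fun x y => psi x * block_kernel x y)
   (A := A (fun i => t i - s i))) => //.
- by apply: jmeasurableM; [exact: jmeasurable_x|exact: jmeasurable_block_kernel].
- exact: jmeasurable_block_kernel.
- by apply: jmeasurableM; [exact: jmeasurable_x|exact: jmeasurable_block_kernel].
- by move=> x y; rewrite mulr_ge0// block_kernel_ge0.
- exact: block_kernel_ge0.
- by move=> x y; rewrite mulr_ge0// block_kernel_ge0.
- by move=> x; exact: A0.
- by move=> x y _ _; rewrite mulrCA -expr2 block_kernel_sqr.
- move=> x Rx; under eq_integral do rewrite block_kernel_sqr.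
  have [i xi|h] := pickP (fun i => s i <= x < t i).
    rewrite (A_in _ xi) -int_piece -(int_Rplus_piece i (fun=> 1)) le_eqVlt; apply/orP; left.
    by apply/eqP; apply: eq_integral => y _; rewrite (block_kernel_in _ xi) mul1r.
  rewrite integral0_eq; first by rewrite lee_fin A0.
  by move=> y _; rewrite block_kernel_out// => i; rewrite h.
move=> y Ry; have [i yi|h] := pickP (fun i => s i <= y < t i); last first.
  rewrite integral0_eq ?lee_fin// => x _; rewrite block_kernel_sym block_kernel_out ?mulr0 ?expr0n ?mulr0//.
  by move=> i; rewrite h.
apply: (@le_trans _ _ (\int[leb]_(x in `[s i, t i[) ((t i - s i)%:E * (psi x ^+ 2)%:E))%E).
  rewrite le_eqVlt; apply/orP; left; apply/eqP.
  transitivity (\int[leb]_(x in Rp) ((t i - s i) * psi x ^+ 2 * (s i <= x < t i)%R%:R)%:E)%E.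
    apply: eq_integral => x _; rewrite exprMn block_kernel_sqr block_kernel_sym (block_kernel_in _ yi).
    case: (boolP (s i <= x < t i)) => xi; last by rewrite !mulr0.
    by rewrite !mulr1 (A_in _ xi).
  by rewrite int_Rplus_piece; apply: eq_integral => x _; rewrite EFinM.
rewrite ge0_integralZl//.
- by rewrite hw -EFinM lee_fin.
- by apply/measurable_EFinP; apply: measurable_funX; exact: measurable_funTS.
- by move=> x _; rewrite lee_fin sqr_ge0.
- by rewrite lee_fin.
Qed.

(** The factors of block_bound exchanged: now A(x) is the integral of psi^2 over
    the interval J that contains x. *)
Lemma block_dual_bound : kbound (fun x y => psi y * block_kernel x y) d.
Proof.
have ts0 i : 0 <= t i - s i by rewrite subr_ge0.
apply: (schur (b := block_kernel) (a := fun x y => psi y * block_kernel x y)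
   (A := A w)) => //.
- by apply: jmeasurableM; [exact: jmeasurable_y|exact: jmeasurable_block_kernel].
- by apply: jmeasurableM; [exact: jmeasurable_y|exact: jmeasurable_block_kernel].
- exact: jmeasurable_block_kernel.
- by move=> x y; rewrite mulr_ge0// block_kernel_ge0.
- by move=> x y; rewrite mulr_ge0// block_kernel_ge0.
- exact: block_kernel_ge0.
- by move=> x; exact: A0.
- by move=> x y _ _; rewrite -mulrA -expr2 block_kernel_sqr.
- move=> x Rx; under eq_integral do rewrite exprMn block_kernel_sqr.
  have [i xi|h] := pickP (fun i => s i <= x < t i).
    rewrite (A_in _ xi) -hw -int_Rplus_piece le_eqVlt; apply/orP; left.
    by apply/eqP; apply: eq_integral => y _; rewrite (block_kernel_in _ xi).
  rewrite integral0_eq; first by rewrite lee_fin A0.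
  by move=> y _; rewrite block_kernel_out ?mulr0// => i; rewrite h.
move=> y Ry; have [i yi|h] := pickP (fun i => s i <= y < t i); last first.
  rewrite integral0_eq ?lee_fin// => x _; rewrite block_kernel_sym block_kernel_out ?mulr0 ?expr0n ?mulr0//.
  by move=> i; rewrite h.
apply: (@le_trans _ _ (\int[leb]_(x in `[s i, t i[) ((w i)%:E * 1%:E))%E).
  rewrite le_eqVlt; apply/orP; left; apply/eqP.
  transitivity (\int[leb]_(x in Rp) ((w i * 1) * (s i <= x < t i)%R%:R)%:E)%E.
    apply: eq_integral => x _; rewrite block_kernel_sqr block_kernel_sym (block_kernel_in _ yi).
    case: (boolP (s i <= x < t i)) => xi; last by rewrite !mulr0.
    by rewrite !mulr1 (A_in _ xi).
  by rewrite (int_Rplus_piece i (fun=> w i * 1)); apply: eq_integral => x _; rewrite EFinM.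
rewrite ge0_integralZl//.
- by rewrite int_piece -EFinM lee_fin mulrC.
- by rewrite lee_fin.
Qed.

End Blocks.
End Pieces.

(** * Finite rank approximation of the kernel *)

Section Approximation.
Context {R : realType}.
Local Notation C := (complex R).
Local Notation leb := (@lebesgue_measure R).
Local Notation Rp := (@Rplus R).
Let mRp : measurable Rp.
Proof. exact: measurable_Rplus. Qed.
#[local] Hint Resolve mRp : core.
#[local] Hint Resolve int_sqr_ge0 : core.

(** For b = false this is the kernel of Q^+, for b = true that of Q. *)
Definition kernelQ (b : bool) (phi : R -> C) (x y : R) : C :=
  phi x * (y < x)%R%:R + b%:R * (phi y * (x <= y)%R%:R).

Lemma cmod_bool (b : bool) : cmod (b%:R : C) = b%:R.
Proof. by case: b; rewrite ?cmod0//; apply: (@cmodR R 1). Qed.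

Lemma cmeasurable_real (D : set R) (u : R -> R) : measurable_fun D u ->
  cmeasurable D (fun x => (u x)%:C).
Proof. by move=> mu; split => //=; exact: measurable_cst. Qed.

Lemma kmeasurable_real (k : R -> R -> R) : jmeasurable k -> kmeasurable (fun x y => (k x y)%:C).
Proof. by move=> mk; split => //=; exact: measurable_cst. Qed.

Lemma boolC (b : bool) : (b%:R : C) = (b%:R : R)%:C.
Proof. by case: b. Qed.

Lemma kmeasurable_bool (b : R -> R -> bool) : jmeasurable (fun x y => (b x y)%:R) ->
  kmeasurable (fun x y => (b x y)%:R).
Proof.
move=> mb; rewrite (_ : (fun x y => _) = (fun x y => ((b x y)%:R : R)%:C)).
  exact: kmeasurable_real.
by apply/funext => x; apply/funext => y; rewrite boolC.
Qed.

Lemma kmeasurable_cst (a : C) : kmeasurable (fun _ _ => a).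
Proof. by split; exact: measurable_cst. Qed.

Lemma cbound_le K (k : R -> R -> R) (c : R) : kmeasurable K -> jmeasurable k ->
  (forall x y, 0 <= k x y) -> 0 <= c ->
  (forall x y, Rp x -> Rp y -> cmod (K x y) <= k x y) -> kbound k c -> cbound K c.
Proof.
move=> mK mk k0 c0 Kk bk; split => //.
apply: (kbound_le _ mk _ k0 Kk bk); first exact: jmeasurable_cmod.
by move=> x y; exact: cmod_ge0.
Qed.

Lemma L2_ind_lt (a : R) : 0 < a -> L2 (fun y : R => (y < a)%R%:R : C).
Proof.
move=> a0; apply/L2E; split.
  rewrite (_ : (fun y => _) = (fun y => ((y < a)%R%:R : R)%:C)); last first.
    by apply/funext => y; rewrite boolC.
  apply: cmeasurable_real; apply: measurable_funTS; apply: measurable_boolR.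
  exact: measurable_fun_ltr.
have -> : (sqnorm (fun y : R => (y < a)%R%:R : C) =
    \int[leb]_(x in Rp) (1 * (0 < x < a)%R%:R)%:E)%E.
  apply: eq_integral => x; rewrite inE => /RplusP x0; rewrite cmod_bool x0 /= mul1r.
  by case: (_ < _)%R; rewrite ?expr1n ?expr0n.
rewrite (@integral_indicator _ Rp `]0, a[ (fun x => 0 < x < a) (fun=> 1)).
- rewrite (_ : \int[leb]_(x in _) _ = 1%:E * leb `]0%R, a[)%E; last first.
    exact: (integral_cst leb (measurable_itv _) 1%E).
  by rewrite lebesgue_measure_itv /= lte_fin a0 mul1e -EFinB ltry.
- by move=> x; rewrite /= in_itv /= => /andP[x0 _]; exact/RplusP.
- by move=> x; rewrite /= in_itv.
Qed.

Variables (phi : R -> C) (q : int -> R) (eps : R) (Bs : seq int) (bq : bool).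
Hypothesis mphi : cmeasurable setT phi.
Hypothesis hq : forall n, (\int[leb]_(x in dyad n) (cmod (phi x) ^+ 2)%:E = (q n)%:E)%E.
Hypothesis eps0 : 0 < eps.
Hypothesis uB : uniq Bs.
Local Notation sigma n := (Num.sqrt (2 ^ n * q n)).
Hypothesis hB : forall n, (n \in Bs) = (eps <= sigma n).

(** The number of i >= 1 with eps <= sigma n / i; also the number of pieces into
    which the n-th dyadic interval is cut. *)
Let k n := Num.truncn (sigma n / eps).
Definition pieces : seq (int * nat) := [seq (n, i) | n <- Bs, i <- iota 0 (k n)].

Lemma uniq_pieces : uniq pieces.
Proof.
apply: allpairs_uniq_dep => //; first by move=> n _; exact: iota_uniq.
by move=> [a b] [c d] _ _ /= [-> ->].
Qed.

Lemma mem_pieces n i : ((n, i) \in pieces) = (n \in Bs) && (i < k n)%N.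
Proof.
apply/allpairsPdep/andP => [[m [j [mB jk [-> ->]]]]|[nB ik]].
  by split => //; move: jk; rewrite mem_iota add0n.
by exists n, i; split => //; rewrite mem_iota add0n.
Qed.

Lemma pieces_sigma n i : (n, i) \in pieces -> eps <= sigma n / i.+1%:R.
Proof.
rewrite mem_pieces truncn_gt_nat => /andP[nB ik].
by rewrite ler_pdivlMr ?ltr0n// mulrC -ler_pdivlMr.
Qed.

Let q0 n : 0 <= q n.
Proof. by rewrite -lee_fin -hq int_sqr_ge0. Qed.

Let sigma2 n : sigma n ^+ 2 = 2 ^ n * q n.
Proof. by rewrite sqr_sqrtr// mulr_ge0// ltW// two_gt0. Qed.

Let psi x := cmod (phi x).
Let mpsi : measurable_fun setT psi.
Proof. exact: measurable_cmod. Qed.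
Let psi0 x : 0 <= psi x.
Proof. exact: cmod_ge0. Qed.

Let k_gt0 n : n \in Bs -> (0 < k n)%N.
Proof. by rewrite hB truncn_gt0 ler_pdivlMr// mul1r. Qed.

(** As k n >= 1, sigma n / eps < k n + 1 <= 2 * k n. *)
Let sigma_k n : n \in Bs -> 2 ^ n * q n / (k n)%:R ^+ 2 <= 4 * eps ^+ 2.
Proof.
move=> nB; have k0 := k_gt0 nB; rewrite -sigma2 -expr_div_n.
have -> : 4 * eps ^+ 2 = (2 * eps) ^+ 2 by ring.
rewrite ler_pXn2r ?nnegrE ?divr_ge0 ?sqrtr_ge0 ?mulr_ge0 ?(ltW eps0)//.
rewrite ler_pdivrMr ?ltr0n//.
have se0 : 0 <= sigma n / eps by rewrite divr_ge0 ?sqrtr_ge0 ?(ltW eps0).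
have /andP[_ h] := truncn_itv se0.
have h2 : (k n).+1%:R <= 2 * (k n)%:R :> R.
  by rewrite -natrM ler_nat mul2n -addnn -addn1 leq_add2l.
have := lt_le_trans h h2; rewrite ltr_pdivrMr// => /ltW.
by rewrite mulrAC.
Qed.

Let cuts : exists c : int -> nat -> R, forall n, n \in Bs ->
  [/\ c n 0 = 2 ^ n, c n (k n) = 2 ^ (n + 1), forall i, c n i <= c n i.+1 &
   forall i, (i < k n)%N -> exists w : R, [/\ 0 <= w,
    (\int[leb]_(x in `[c n i, c n i.+1[) (psi x ^+ 2)%:E = w%:E)%E &
    (c n i.+1 - c n i) * w <= 4 * eps ^+ 2]].
Proof.
suff /choice[c hc] : forall n, exists c : nat -> R, n \in Bs ->
  [/\ c 0 = 2 ^ n, c (k n) = 2 ^ (n + 1), forall i, c i <= c i.+1 &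
   forall i, (i < k n)%N -> exists w : R, [/\ 0 <= w,
    (\int[leb]_(x in `[c i, c i.+1[) (psi x ^+ 2)%:E = w%:E)%E &
    (c i.+1 - c i) * w <= 4 * eps ^+ 2]] by exists c.
move=> n; case: (boolP (n \in Bs)) => [nB|]; last by exists (fun=> 0).
have k0 := k_gt0 nB.
have qn : 0 < q n.
  rewrite lt_neqAle q0 andbT eq_sym; apply/eqP => E.
  move: nB; rewrite hB E mulr0 sqrtr0; apply/negP; by rewrite -ltNge.
have ab : 2 ^ n < 2 ^ (n + 1) :> R by rewrite two_exprzS ltr_pMl ?two_gt0// ltr1n.
have [c [c0 ck cm] hc] := equipartition ab qn k0 (measurable_funX 2 mpsi)
  (fun x => sqr_ge0 _) (hq n).
exists c => _; split => // i ik; have [w [w0 hw h]] := hc i ik.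
exists w; split => //; apply: le_trans h _; apply: le_trans (sigma_k nB).
by rewrite two_exprzS (_ : 2 * 2 ^ n - 2 ^ n = 2 ^ n)//; ring.
Qed.

(** On the pieces J = [s i, t i[ the approximant replaces 1_(y<x) by 1_(y<s i),
    which makes it of rank one on J x (0, oo), and similarly with x and y
    exchanged for the second half of the kernel. The error splits into the part
    phiG of phi outside all pieces, where every sigma n is less than eps, and the
    parts of the squares J x J with y < x and with x <= y. Their squared norms are
    bounded by 32 eps^2 and 4 eps^2 for either half of the kernel; with a factor 2
    for every sum of two kernels and one for complex integrals the total is 2 * 2
    * (2 * 36 + 2 * 36) eps^2 = (24 eps)^2. *)
Lemma kernelQ_approximation : exists2 cK, cbound (kernelQ bq phi) cK &
  (singular_number (size pieces * 2) (kernel_op (kernelQ bq phi)) <= (24 * eps)%:E)%E.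
Proof.
have [c hc] := cuts.
pose I := seq_sub pieces.
pose nn (i : I) := (val i).1; pose ii (i : I) := (val i).2.
have inB i : nn i \in Bs.
  by rewrite /nn; case: i => [[a b] h] /=; move: h; rewrite mem_pieces => /andP[].
have ik i : (ii i < k (nn i))%N.
  by rewrite /nn /ii; case: i => [[a b] h] /=; move: h; rewrite mem_pieces => /andP[].
pose s i := c (nn i) (ii i); pose t i := c (nn i) (ii i).+1.
have cmono n : n \in Bs -> {homo c n : i j / (i <= j)%N >-> i <= j}.
  by move=> nB; apply: homo_leq => [x|y x z|i]; [exact: lexx|exact: le_trans|by have [_ _ h _] := hc n nB].
have st i : s i <= t i by have [_ _ cm _] := hc _ (inB i); exact: cm.
have sub i x : s i <= x < t i -> dyad (nn i) x.
  move=> /andP[h1 h2]; apply/dyadP; have [c0 ck _ _] := hc _ (inB i).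
  rewrite -c0 -ck (le_trans _ h1)//=; last by apply: cmono; rewrite ?inB.
  by apply: lt_le_trans h2 _; apply: cmono; rewrite ?inB ?ik.
have s0 i : 0 < s i.
  have [c0 _ _ _] := hc _ (inB i); apply: lt_le_trans (two_gt0 (nn i)) _.
  by rewrite -c0; apply: cmono; rewrite ?inB.
have disj i j x : s i <= x < t i -> s j <= x < t j -> i = j.
  move=> xi xj; have nE := dyad_uniq (sub _ _ xi) (sub _ _ xj).
  apply: val_inj; rewrite [val i]surjective_pairing [val j]surjective_pairing.
  rewrite -/(nn i) -/(nn j) -/(ii i) -/(ii j) nE; congr pair.
  move: xi xj; rewrite /s /t nE => /andP[i1 i2] /andP[j1 j2].
  have aux a b : c (nn j) a <= x -> x < c (nn j) b.+1 -> (a <= b)%N.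
    move=> h1 h2; rewrite leqNgt; apply/negP => ba.
    by have := cmono _ (inB j) _ _ ba; rewrite leNgt (le_lt_trans h1 h2).
  by apply/eqP; rewrite eqn_leq (aux _ _ i1 j2) (aux _ _ j1 i2).
have cover n x : n \in Bs -> dyad n x -> exists i : I, s i <= x < t i.
  move=> nB /dyadP/andP[x1 x2]; have [c0 ck _ _] := hc n nB.
  have ex : exists m, x < c n m by exists (k n); rewrite ck.
  have := ex_minnP ex; case=> m xm mmin.
  have m0 : (0 < m)%N by rewrite lt0n; apply/eqP => m0; move: xm; rewrite m0 c0 ltNge x1.
  have mk : (m.-1 < k n)%N by rewrite prednK//; apply: mmin; rewrite ck.
  have inp : (n, m.-1) \in pieces by rewrite mem_pieces nB mk.
  exists (SeqSub inp); rewrite /s /t /nn /ii /= prednK// xm andbT leNgt.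
  by apply/negP => /mmin; rewrite leqNgt prednK// leqnn.
have /choice[w hw] : forall i : I, exists w : R, [/\ 0 <= w,
    (\int[leb]_(x in `[s i, t i[) (psi x ^+ 2)%:E = w%:E)%E &
    (t i - s i) * w <= 4 * eps ^+ 2].
  by move=> i; have [_ _ _ h] := hc _ (inB i); exact: h.
pose ind i x : bool := s i <= x < t i.
(* The indicator of the union of the pieces: the union of the dyadic intervals
   with index in Bs. *)
pose P x : R := \sum_i (ind i x)%:R.
have mind i : measurable_fun setT (fun x : R => (ind i x)%:R : R).
  exact: (measurable_ind s t i).
have mP : measurable_fun setT P by apply: measurable_sum => i; exact: mind.
have P_in i x : ind i x -> P x = 1.
  move=> xi; rewrite /P (bigD1 i)//= xi big1 ?addr0// => j ji.
  case: (boolP (ind j x)) => xj //.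
  by rewrite (disj _ _ _ xj xi) eqxx in ji.
have P_out x : (forall i, ~~ ind i x) -> P x = 0.
  by move=> h; rewrite /P big1// => i _; rewrite (negbTE (h i)).
pose phiG x := phi x * (1 - P x)%:C.
have mphiG : cmeasurable setT phiG.
  apply: cmeasurableM => //; apply: cmeasurable_real; exact: measurable_funB.
pose psiG x := cmod (phiG x).
have mpsiG : measurable_fun setT psiG by exact: measurable_cmod.
have psiG0 x : 0 <= psiG x by exact: cmod_ge0.
have psiG_le x : psiG x <= psi x.
  rewrite /psiG cmodM; have [i xi|h] := pickP (fun i => ind i x).
    by rewrite (P_in _ _ xi) subrr cmod0 mulr0.
  by rewrite P_out ?subr0 ?(@cmodR _ 1) ?mulr1// => i; rewrite h.
have heG n : (\int[leb]_(y in dyad n) (psiG y ^+ 2)%:E <= (eps ^+ 2 * (2 ^ n)^-1)%:E)%E.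
  case: (boolP (n \in Bs)) => nB.
    rewrite integral0_eq; last first.
      move=> x xn; have [i xi] := cover n x nB xn.
      by rewrite /psiG /phiG (P_in _ _ xi) subrr mulr0 cmod0 expr0n.
    by rewrite lee_fin mulr_ge0 ?exprn_ge0 ?invr_ge0 ?ltW ?two_gt0.
  apply: (@le_trans _ _ (q n)%:E).
    rewrite -hq; apply: ge0_le_integral => //.
    - exact: measurable_dyad.
    - by move=> x _; rewrite lee_fin sqr_ge0.
    - by apply/measurable_EFinP; apply: measurable_funX; exact: measurable_funTS.
    - by apply/measurable_EFinP; apply: measurable_funX; exact: measurable_funTS.
    - move=> x _; rewrite lee_fin ler_pXn2r ?nnegrE ?cmod_ge0//; exact: psiG_le.
  rewrite lee_fin ler_pdivlMr ?two_gt0// mulrC -sigma2.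
  move: nB; rewrite hB -ltNge => /ltW h.
  by rewrite ler_pXn2r ?nnegrE ?sqrtr_ge0 ?(ltW eps0).
have e0 : 0 <= eps ^+ 2 by rewrite sqr_ge0.
have w0 i : 0 <= w i by have [] := hw i.
have hw1 i : (\int[leb]_(x in `[s i, t i[) (psi x ^+ 2)%:E = (w i)%:E)%E by have [] := hw i.
have hw2 i : (t i - s i) * w i <= 4 * eps ^+ 2 by have [] := hw i.
have d0 : 0 <= 4 * eps ^+ 2 by rewrite mulr_ge0.
have jS : jmeasurable (block_kernel s t) by exact: jmeasurable_block_kernel.
have S0 x y : 0 <= block_kernel s t x y by exact: block_kernel_ge0.
have kS : kmeasurable (fun x y => (block_kernel s t x y)%:C) by exact: kmeasurable_real.
have klt : kmeasurable (fun x y : R => (y < x)%R%:R : C) by apply: kmeasurable_bool; exact: jmeasurable_lt.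
have jle := jmeasurable_swap (@jmeasurable_le R).
have kle : kmeasurable (fun x y : R => (x <= y)%R%:R : C) by exact: kmeasurable_bool.
have b1 : cbound (fun x y => phiG x * (y < x)%R%:R) (32 * eps ^+ 2).
  apply: cbound_le (hardy_bound mpsiG psiG0 heG) => //.
  - by apply: kmeasurableM => //; exact: kmeasurable_x.
  - by apply: jmeasurableM; [exact: jmeasurable_x|exact: jmeasurable_le].
  - by move=> x y; rewrite mulr_ge0.
  - by rewrite mulr_ge0.
  - move=> x y _ _; rewrite cmodM cmod_bool; apply: ler_wpM2l; first exact: cmod_ge0.
    by rewrite ler_nat; case: (ltgtP y x).
have b2 : cbound (fun x y => phi x * (block_kernel s t x y)%:C * (y < x)%R%:R) (4 * eps ^+ 2).
  apply: cbound_le (block_bound st s0 disj mpsi psi0 hw1 d0 hw2) => //.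
  - by apply: kmeasurableM => //; apply: kmeasurableM => //; exact: kmeasurable_x.
  - by apply: jmeasurableM => //; exact: jmeasurable_x.
  - by move=> x y; rewrite mulr_ge0.
  - move=> x y _ _; rewrite !cmodM cmod_bool cmodR//; apply: ler_piMr.
      by rewrite mulr_ge0 ?cmod_ge0.
    by rewrite lern1 leq_b1.
have b3 : cbound (fun x y => bq%:R * (phiG y * (x <= y)%R%:R)) (32 * eps ^+ 2).
  apply: cbound_le (hardy_dual_bound mpsiG psiG0 heG) => //.
  - apply: kmeasurableM; first exact: kmeasurable_cst.
    by apply: kmeasurableM => //; exact: kmeasurable_y.
  - by apply: jmeasurableM => //; exact: jmeasurable_y.
  - by move=> x y; rewrite mulr_ge0.
  - by rewrite mulr_ge0.
  - move=> x y _ _; rewrite cmodM [X in _ * X]cmodM !cmod_bool; apply: ler_piMl.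
      by rewrite mulr_ge0 ?cmod_ge0.
    by rewrite lern1 leq_b1.
have b4 : cbound (fun x y => bq%:R * (phi y * (block_kernel s t x y)%:C * (x <= y)%R%:R)) (4 * eps ^+ 2).
  apply: cbound_le (block_dual_bound st s0 disj mpsi psi0 w0 hw1 d0 hw2) => //.
  - apply: kmeasurableM; first exact: kmeasurable_cst.
    by apply: kmeasurableM => //; apply: kmeasurableM => //; exact: kmeasurable_y.
  - by apply: jmeasurableM => //; exact: jmeasurable_y.
  - by move=> x y; rewrite mulr_ge0.
  - move=> x y _ _; rewrite !cmodM !cmod_bool cmodR//.
    rewrite (_ : bq%:R * _ = psi y * block_kernel s t x y * ((x <= y)%R%:R * bq%:R)); last first.
      by rewrite /psi; ring.
    apply: ler_piMr; first by rewrite mulr_ge0.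
    by rewrite mulr_ile1 ?lern1 ?leq_b1.
have bE := cbound_add (cbound_add b1 b2) (cbound_add b3 b4).
set E := (fun x y => _) in bE.
(* The boolean true selects the term with phi in the variable x, false the one
   with phi in y. *)
pose e (u : I * bool) : R -> C := if u.2 then (fun x => phi x * (ind u.1 x)%:R)
  else (fun x => (x < s u.1)%R%:R).
pose b (u : I * bool) : R -> C := if u.2 then (fun x => (x < s u.1)%R%:R)
  else (fun x => bq%:R * (phi x * (ind u.1 x)%:R)).
have mlt a : cmeasurable setT (fun x : R => (x < a)%R%:R : C).
  rewrite (_ : (fun y => _) = (fun y => ((y < a)%R%:R : R)%:C)); last first.
    by apply/funext => y; rewrite boolC.
  by apply: cmeasurable_real; apply: measurable_boolR; exact: measurable_fun_ltr.
have mphi_ind i : cmeasurable setT (fun x => phi x * (ind i x)%:R).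
  apply: cmeasurableM => //; rewrite (_ : (fun y => _) = (fun y => ((ind i y)%:R : R)%:C)).
    exact: cmeasurable_real.
  by apply/funext => y; rewrite boolC.
have L2phi_ind i : L2 (fun x => phi x * (ind i x)%:R).
  apply/L2E; split; first by have [m1 m2] := mphi_ind i; split; exact: measurable_funTS.
  suff -> : sqnorm (fun x => phi x * (ind i x)%:R) = (w i)%:E by rewrite ltry.
  rewrite -hw1 -(int_Rplus_piece _ s0 i (fun x => psi x ^+ 2)); apply: eq_integral => x _.
  rewrite cmodM cmod_bool exprMn -/(psi x) /ind.
  by case: (_ <= _ < _)%R; rewrite ?expr1n ?expr0n.
have me u : cmeasurable setT (e u) by rewrite /e; case: u => i [] /=; [exact: mphi_ind|exact: mlt].
have mb u : cmeasurable setT (b u).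
  rewrite /b; case: u => i [] //=; apply: cmeasurableM => //; exact: cmeasurable_cst.
have Le u : L2 (e u) by rewrite /e; case: u => i [] /=; [exact: L2phi_ind|exact: L2_ind_lt].
have Lb u : L2 (b u).
  rewrite /b; case: u => i [] /=; first exact: L2_ind_lt.
  have := L2_lin bq%:R (L2phi_ind i) (@L2_0 R).
  by congr L2; apply/funext => x; rewrite addr0.
have KE x y : kernelQ bq phi x y = finite_rank_kernel e b x y + E x y.
  have splitx (z : R) : \sum_i ((ind i z)%:R : C) + (1 - P z)%:C = 1.
    have -> : \sum_i ((ind i z)%:R : C) = (P z)%:C.
      by rewrite /P rmorph_sum; apply: eq_bigr => i _; rewrite boolC.
    by rewrite -rmorphD /= addrC subrK.
  have -> : finite_rank_kernel e b x y = \sum_i (phi x * (ind i x)%:R) * (y < s i)%R%:R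
     + bq%:R * \sum_i (x < s i)%R%:R * (phi y * (ind i y)%:R).
    rewrite /finite_rank_kernel mulr_sumr -big_split /=.
    rewrite (eq_bigr (fun u => e (u.1, u.2) x * b (u.1, u.2) y)); last by move=> [].
    rewrite -(pair_bigA _ (fun i v => e (i, v) x * b (i, v) y)) /=.
    apply: eq_bigr => i _; rewrite big_bool /=; congr (_ + _).
    by rewrite mulrCA.
  have Sx : phi x * (block_kernel s t x y)%:C * (y < x)%R%:R =
     \sum_i (phi x * (ind i x)%:R) * ((ind i y) && (y < x))%:R.
    rewrite /block_kernel rmorph_sum /= mulr_sumr mulr_suml; apply: eq_bigr => i _.
    by rewrite rmorphM /= -!boolC -/(ind i x) -/(ind i y) -mulnb natrM !mulrA.
  have Sy : phi y * (block_kernel s t x y)%:C * (x <= y)%R%:R =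
     \sum_i ((ind i x) && (x <= y))%:R * (phi y * (ind i y)%:R).
    rewrite /block_kernel rmorph_sum /= mulr_sumr mulr_suml; apply: eq_bigr => i _.
    by rewrite rmorphM /= -!boolC -/(ind i x) -/(ind i y) -mulnb natrM; ring.
  (* For x in a piece, y < x holds exactly if y lies to the left of the piece, or
     in the piece and y < x. *)
  have Tx : \sum_i (phi x * (ind i x)%:R) * (y < s i)%R%:R +
     \sum_i (phi x * (ind i x)%:R) * ((ind i y) && (y < x))%:R =
     phi x * (\sum_i (ind i x)%:R) * (y < x)%R%:R.
    rewrite -big_split /= mulr_sumr mulr_suml; apply: eq_bigr => i _.
    rewrite -mulrDr; case: (boolP (ind i x)) => xi; last by rewrite !mulr0 !mul0r.
    congr (_ * _); move: xi; rewrite /ind => /andP[x1 x2].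
    case: (ltP y (s i)) => [ys|sy] /=.
      by rewrite (lt_le_trans ys x1) addr0.
    case: (ltP y x) => [yx|_]; last by rewrite andbF add0r.
    by rewrite (lt_trans yx x2) add0r.
  (* Likewise for x <= y and y in a piece; here x = y belongs to the square. *)
  have Ty : \sum_i (x < s i)%R%:R * (phi y * (ind i y)%:R) +
     \sum_i ((ind i x) && (x <= y))%:R * (phi y * (ind i y)%:R) =
     phi y * (\sum_i (ind i y)%:R) * (x <= y)%R%:R.
    rewrite -big_split /= mulr_sumr mulr_suml; apply: eq_bigr => i _.
    rewrite -mulrDl; case: (boolP (ind i y)) => xi; last by rewrite !mulr0 mul0r.
    rewrite mulrC; congr (_ * _); move: xi; rewrite /ind => /andP[x1 x2].
    case: (ltP x (s i)) => [ys|sy] /=.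
      by rewrite (le_trans (ltW ys) x1) addr0.
    case: (leP x y) => [yx|_]; last by rewrite andbF add0r.
    by rewrite (le_lt_trans yx x2) add0r.
  rewrite /E /kernelQ Sx Sy /phiG.
  have ex := splitx x; have ey := splitx y.
  move: Tx Ty ex ey.
  set A1 := \sum_i _ * _; set A2 := \sum_i _ * _; set A3 := \sum_i _.
  set A4 := \sum_i _ * _; set A5 := \sum_i _ * _; set A6 := \sum_i _.
  set px := (1 - P x)%:C; set py := (1 - P y)%:C.
  set l1 := (y < x)%R%:R; set l2 := (x <= y)%R%:R.
  move=> Tx Ty ex ey.
  transitivity (phi x * (A3 + px) * l1 + bq%:R * (phi y * (A6 + py) * l2)).
    by rewrite ex ey !mulr1.
  transitivity ((phi x * A3 * l1) + phi x * px * l1 + bq%:R * ((phi y * A6 * l2) + phi y * py * l2)).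
    by ring.
  by rewrite -Tx -Ty; ring.
have [cA bA] := cbound_finite_rank_kernel me mb Le Lb.
have bK := cbound_add bA bE.
rewrite (_ : (fun x y => _) = kernelQ bq phi) in bK; last first.
  by apply/funext => x; apply/funext => y; rewrite KE.
eexists; first exact: bK.
have := singular_number_le me mb Le Lb bK bE (fun x y _ _ => KE x y).
rewrite card_prod card_bool card_seq_sub ?uniq_pieces//.
rewrite (_ : 2 * _ = (24 * eps) ^+ 2); last by ring.
by rewrite sqrtr_sqr ger0_norm// mulr_ge0// ltW.
Qed.

End Approximation.

(** * Sufficiency of the condition on phi *)

Section Forward.
Context {R : realType}.
Local Notation C := (complex R).
Local Notation leb := (@lebesgue_measure R).
Local Notation Rp := (@Rplus R).
Let mRp : measurable Rp.
Proof. exact: measurable_Rplus. Qed.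
#[local] Hint Resolve mRp : core.
#[local] Hint Resolve int_sqr_ge0 : core.

Lemma cmeasurable_sub (D E : set R) (f : R -> C) : measurable E -> D `<=` E ->
  cmeasurable E f -> cmeasurable D f.
Proof. by move=> mE DE [m1 m2]; split; exact: measurable_funS mE DE _. Qed.

(** The definition of X_p integrates over closed intervals, which differ from the
    half-open ones by a null set. *)
Lemma Xspace_term (p : R) (phi : R -> C) (n : int) : cmeasurable Rp phi ->
  ((2 `^ (n%:~R * p / 2))%:E *
      (\int[leb]_(x in `[(2 : R) ^ n, (2 : R) ^ (n + 1)])
         ((cmod (phi x)) ^+ 2)%:E) `^ (p / 2) =
   ((2 ^ n)%:E * \int[leb]_(x in dyad n) ((cmod (phi x)) ^+ 2)%:E) `^ (p / 2))%E.
Proof.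
move=> mphi; rewrite poweRM ?lee_fin ?(ltW (two_gt0 n))//; last exact: int_sqr_ge0.
rewrite -mulrA powRrM powR_intmul// poweR_EFin; congr (_ * _ `^ _)%E.
rewrite /dyad integral_itv_bndo_bndc//; apply/measurable_EFinP; apply: measurable_funX.
apply: measurable_cmod; first exact: measurable_itv.
exact: cmeasurable_sub (@dyad_Rplus R n) mphi.
Qed.

Lemma esum_sum_le (a : int -> \bar R) (F : seq int) : uniq F ->
  (\sum_(n <- F) a n <= \esum_(n in [set: int]) a n)%E.
Proof.
move=> uF; apply: esum_ge; exists [set` F]; last by rewrite fsbig_seq.
by split => //; exact: finite_seq.
Qed.

Lemma Xspace_sigma (p : R) (phi : R -> C) : 1 < p -> Xspace p phi ->
  exists (q : int -> R) (S : R),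
  [/\ forall n, 0 <= q n,
     forall n, (\int[leb]_(x in dyad n) (cmod (phi x) ^+ 2)%:E = (q n)%:E)%E &
     forall F : seq int, uniq F -> \sum_(n <- F) Num.sqrt (2 ^ n * q n) `^ p <= S].
Proof.
move=> p1 [mphi]; set a := (fun n : int => _); set s := esum _ _ => sfin.
have p2 : 0 < p / 2 by rewrite divr_gt0// (lt_trans ltr01).
have aE n : a n = (((2 ^ n)%:E * \int[leb]_(x in dyad n) ((cmod (phi x)) ^+ 2)%:E) `^ (p / 2))%E.
  exact: Xspace_term.
have afin n : (a n < +oo)%E.
  apply: le_lt_trans sfin; have := @esum_sum_le a [:: n] isT.
  by rewrite big_seq1.
have qfin n : (\int[leb]_(x in dyad n) ((cmod (phi x)) ^+ 2)%:E < +oo)%E.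
  rewrite ltNge leye_eq; apply/negP => /eqP E; move: (afin n); rewrite aE E.
  by rewrite gt0_muley ?lte_fin ?two_gt0// poweRyr// gt_eqF.
pose q n := fine (\int[leb]_(x in dyad n) ((cmod (phi x)) ^+ 2)%:E).
have qE n : (\int[leb]_(x in dyad n) ((cmod (phi x)) ^+ 2)%:E)%E = (q n)%:E.
  by rewrite fineK// ge0_fin_numE//; exact: int_sqr_ge0.
have q0 n : 0 <= q n by rewrite -lee_fin -qE.
have s0 : (0 <= s)%E by apply: esum_ge0 => n _; rewrite -/(a n) aE poweR_ge0.
exists q, (fine s); split => // F uF.
rewrite -lee_fin fineK ?ge0_fin_numE//; apply: le_trans (esum_sum_le a uF).
rewrite -sumEFin; apply: lee_sum => n _; rewrite aE qE -EFinM poweR_EFin lee_fin.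
have z0 : 0 <= 2 ^ n * q n by rewrite mulr_ge0// ltW// two_gt0.
by rewrite -powR12_sqrt// -powRrM (mulrC _ p).
Qed.

Section Level.
Variables (p S : R) (sigma : int -> R).
Hypothesis p0 : 0 < p.
Hypothesis hS : forall F : seq int, uniq F -> \sum_(n <- F) sigma n `^ p <= S.

Lemma finite_level (eps : R) : 0 < eps ->
  exists2 Bs : seq int, uniq Bs & forall n, (n \in Bs) = (eps <= sigma n).
Proof.
move=> e0; pose A := [set n | eps <= sigma n].
have fA : finite_set A.
  apply: contrapT => iA; pose N := (Num.truncn (S / eps `^ p)).+1.
  have [B BA NB] := infinite_set_fset N iA.
  have ep : 0 < eps `^ p by rewrite powR_gt0.
  pose Bl : seq int := finmap.enum_fset B.
  have uBl : uniq Bl by exact: finmap.fset_uniq.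
  have : N%:R * eps `^ p <= S.
    apply: le_trans (hS uBl).
    apply: (@le_trans _ _ (\sum_(n <- Bl) eps `^ p)).
      rewrite big_const_seq count_predT iter_addr_0 -[leRHS]mulr_natl ler_wpM2r ?(ltW ep)//.
      by rewrite ler_nat.
    rewrite big_seq [leRHS]big_seq; apply: ler_sum => n nB.
    have ns : eps <= sigma n by exact: BA.
    by rewrite ge0_ler_powR ?nnegrE ?(ltW p0) ?(ltW e0)// (le_trans _ ns) ?ltW.
  rewrite -ler_pdivlMr// leNgt.
  have S0 : 0 <= S by have := hS (isT : uniq [::]); rewrite big_nil.
  by have /andP[_ ->] := truncn_itv (divr_ge0 S0 (ltW ep)).
have /finite_seqP[s sE] := fA.
exists (undup s); first exact: undup_uniq.
move=> n; rewrite mem_undup; apply/idP/idP.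
  by move=> ns; have : [set` s] n by []; rewrite -sE.
by move=> h; have : A n by []; rewrite sE.
Qed.

End Level.

(** For every eps, kernelQ_approximation bounds a singular number whose index is
    the length of a list of triples (n, i, v) with eps <= sigma n / i.+1, and the
    p-th powers of the sigma n / i.+1 are summable by sum_harmonic_le. *)
Lemma schatten_kernelQ (p S : R) (phi : R -> C) (q : int -> R) (b : bool) :
  1 < p -> cmeasurable setT phi ->
  (forall n, (\int[leb]_(x in dyad n) (cmod (phi x) ^+ 2)%:E = (q n)%:E)%E) ->
  (forall F : seq int, uniq F -> \sum_(n <- F) Num.sqrt (2 ^ n * q n) `^ p <= S) ->
  schatten p (kernel_op (kernelQ b phi)).
Proof.
move=> p1 mphi hq hS; have p0 : 0 < p by rewrite (lt_trans ltr01).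
pose sigma (n : int) : R := Num.sqrt (2 ^ n * q n).
pose tau (t : int * nat * bool) := sigma t.1.1 / t.1.2.+1%:R.
have count eps : 0 < eps -> exists2 l : seq (int * nat * bool),
  uniq l /\ (forall t, t \in l -> eps <= tau t) &
  exists2 cK, cbound (kernelQ b phi) cK &
   (singular_number (size l) (kernel_op (kernelQ b phi)) <= (24 * eps)%:E)%E.
  move=> e0; have [Bs uB hB] := finite_level p0 hS e0.
  exists [seq (t, v) | t <- pieces q eps Bs, v <- [:: true; false]].
    split; first by apply: allpairs_uniq => //; [exact: uniq_pieces|move=> [? ?] [? ?]].
    move=> t /allpairsP[[[n i] v] [tp _ ->]]; exact: (pieces_sigma e0 tp).
  rewrite size_allpairs /=. exact: (kernelQ_approximation b mphi hq e0 uB hB).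
apply: (@schatten_of_count _ _ p 24 (2 * (1 - 2 `^ (1 - p))^-1 * S) tau) => //.
- by have [l _ [cK bK _]] := count 1 ltr01; exact: kernel_op_bounded bK.
- by move=> t; rewrite divr_ge0 ?sqrtr_ge0.
- by move=> eps /count[l [ul lt] [cK _ h]]; exists l.
- by apply: sum_harmonic_le => // n; exact: sqrtr_ge0.
Qed.

Lemma mem_itv0 (x y : R) : (y \in `]0, x[%classic) = (y \in Rp) && (y < x).
Proof.
apply/idP/andP => [|[]].
  by rewrite !inE /Rplus /= !in_itv /= andbT => /andP[-> ->].
by rewrite !inE /Rplus /= !in_itv /= andbT => -> ->.
Qed.

Lemma cintegral_lt (x : R) (f : R -> C) :
  cintegral Rp (fun y => (y < x)%R%:R * f y) = cintegral `]0, x[ f.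
Proof.
have aux (u v : R -> R) : (forall y, u y = if y < x then v y else 0) ->
   \int[leb]_(y in Rp) u y = \int[leb]_(y in `]0, x[) v y.
  move=> uv; rewrite /Rintegral; congr fine.
  rewrite integral_mkcond [RHS]integral_mkcond; apply: eq_integral => y _.
  rewrite !patchE; have -> : (y \in `]0, x[%classic) = (y \in Rp) && (y < x).
    exact: mem_itv0.
  by case: (y \in Rp) => //=; rewrite uv; case: (y < x).
rewrite /cintegral; congr (_ +i* _); apply: aux => y; case: (y < x);
  by rewrite ?mul1r ?mul0r.
Qed.

Lemma bcs_cintegrable (x : R) (f : R -> C) : bounded_compact_support f ->
  cintegrable `]0, x[ f.
Proof.
move=> [mf [M fM] _].
have sub : `]0, x[ `<=` Rp.
  by move=> y; rewrite /Rplus /= !in_itv /= andbT => /andP[].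
have mI : measurable (`]0, x[ : set R) by exact: measurable_itv.
have mf' : cmeasurable `]0, x[ f by exact: cmeasurable_sub sub mf.
split => //.
have h : (\int[leb]_(y in `]0%R, x[) (cmod (f y))%:E <= \int[leb]_(y in `]0%R, x[) (cst `|M|%:E y))%E.
  apply: ge0_le_integral => //.
  - by move=> y _; rewrite lee_fin cmod_ge0.
  - by apply/measurable_EFinP; exact: measurable_cmod.
  - by move=> y /sub Ry; rewrite lee_fin (le_trans (fM _ Ry))// ler_norm.
apply: (le_lt_trans h); rewrite [X in (X < _)%E](integral_cst leb mI `|M|%:E).
have L : (leb (`]0%R, x[ : set R) < +oo)%E.
  by rewrite lebesgue_measure_itv /= lte_fin; case: ifP; rewrite ?ltry// -EFinB ltry.
by apply: lte_mul_pinfty.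
Qed.

Lemma in_schatten_of_Xspace (p : R) (phi : R -> C) : 1 < p -> Xspace p phi ->
  in_schatten p (Qop phi) /\ in_schatten p (Qop_plus phi).
Proof.
move=> p1 X; have [mphi _] := X.
have [q [S [q0 hq hS]]] := Xspace_sigma p1 X.
have [phi' mphi' e] := cmeasurable_ext mphi.
have hq' n : (\int[leb]_(x in dyad n) (cmod (phi' x) ^+ 2)%:E = (q n)%:E)%E.
  by rewrite -hq; apply: eq_integral => x; rewrite inE => /dyad_Rplus/e ->.
have sch b := schatten_kernelQ b p1 mphi' hq' hS.
split.
- exists (kernel_op (kernelQ true phi')) => // f _; apply: aeW => x Rx.
  apply: eq_cintegral => y Ry; rewrite /kernelQ mul1r !e//; congr (_ * _).
  by case: (ltP y x) => _; rewrite ?mulr1 ?mulr0 ?addr0 ?add0r.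
- exists (kernel_op (kernelQ false phi')) => // f bf; apply: aeW => x Rx.
  rewrite /Qop_plus -cintegral_lt -e//.
  have bfx := bcs_cintegrable x bf.
  have [mf _ _] := bf.
  rewrite -cintegralZ//; last first.
    split.
      apply: cmeasurableM => //.
      rewrite (_ : (fun y => _) = (fun y => ((y < x)%R%:R : R)%:C)); last first.
        by apply/funext => y; rewrite boolC.
      apply: cmeasurable_real; apply: measurable_funTS; apply: measurable_boolR.
      exact: measurable_fun_ltr.
    have [_] := bfx; congr (_ < _)%E.
    rewrite integral_mkcond [RHS]integral_mkcond; apply: eq_integral => y _.
    rewrite !patchE; have -> : (y \in `]0, x[%classic) = (y \in Rp) && (y < x).
      exact: mem_itv0.
    by case: (y \in Rp) => //=; case: (y < x); rewrite ?mul1r// mul0r cmod0.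
  apply: eq_cintegral => y _; rewrite /kernelQ mul0r addr0; ring.
Qed.

End Forward.

(** * Lower bounds for singular numbers *)

Section LowerBound.
Local Open Scope sesquilinear_scope.
Context {R : realType}.
Local Notation C := (complex R).
Local Notation leb := (@lebesgue_measure R).
Local Notation Rp := (@Rplus R).
Let mRp : measurable Rp.
Proof. exact: measurable_Rplus. Qed.
#[local] Hint Resolve mRp : core.
#[local] Hint Resolve int_sqr_ge0 : core.
Implicit Types (f g : R -> C) (T A : @operator R).

Lemma aeq_refl f : aeq f f.
Proof. by apply: aeW. Qed.

Lemma aeq_trans f g h : aeq f g -> aeq g h -> aeq f h.
Proof.
have F := ae_filter_ringOfSetsType leb.
move=> fg gh; have := @filterI _ _ F _ _ fg gh.
by apply: (@filterS _ _ F) => x [/= e1 e2] Rx; rewrite e1// e2.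
Qed.

Lemma aeq_lin (a : C) f f' g g' : aeq f f' -> aeq g g' ->
  aeq (fun x => a * f x + g x) (fun x => a * f' x + g' x).
Proof.
have F := ae_filter_ringOfSetsType leb.
move=> fg gh; have := @filterI _ _ F _ _ fg gh.
by apply: (@filterS _ _ F) => x [/= e1 e2] Rx; rewrite e1// e2.
Qed.

Lemma L2_sum (I : Type) (r : seq I) (a : I -> C) (f : I -> R -> C) :
  (forall i, L2 (f i)) -> L2 (fun x => \sum_(i <- r) a i * f i x).
Proof.
move=> Lf; elim: r => [|i r IH].
  by rewrite (_ : (fun x => _) = (fun=> 0)); [exact: L2_0|apply/funext => x; rewrite big_nil].
rewrite (_ : (fun x => _) = (fun x => a i * f i x + \sum_(j <- r) a j * f j x)).
  exact: L2_lin.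
by apply/funext => x; rewrite big_cons.
Qed.

Lemma operator_sum T (I : Type) (r : seq I) (a : I -> C) (f : I -> R -> C) :
  bounded_operator T -> (forall i, L2 (f i)) ->
  aeq (T (fun x => \sum_(i <- r) a i * f i x)) (fun x => \sum_(i <- r) a i * T (f i) x).
Proof.
have F := ae_filter_ringOfSetsType leb.
move=> [_ linT _] Lf; elim: r => [|i r IH].
  rewrite (_ : (fun x => _) = (fun=> 0)); last by apply/funext => x; rewrite big_nil.
  have := linT 1 _ _ L2_0 L2_0.
  rewrite (_ : (fun x : R => 1 * 0 + 0) = (fun=> 0)); last first.
    by apply/funext => x; rewrite mulr0 addr0.
  apply: (@filterS _ _ F) => x /= h Rx; rewrite big_nil.
  by move: (h Rx) => {h}; rewrite mul1r -[X in X = _]addr0 => /addrI <-.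
rewrite (_ : (fun x => _) = (fun x => a i * f i x + \sum_(j <- r) a j * f j x)); last first.
  by apply/funext => x; rewrite big_cons.
apply: aeq_trans (linT _ _ _ (Lf i) (L2_sum r a Lf)) _.
rewrite [X in aeq _ X](_ : _ =
  (fun x => a i * T (f i) x + \sum_(j <- r) a j * T (f j) x)); last first.
  by apply/funext => x; rewrite big_cons.
by apply: aeq_lin => //; exact: aeq_refl.
Qed.

Lemma left_kernel k (c : 'M[C]_(k.+1, k)) : exists2 x : 'rV[C]_k.+1, x != 0 & x *m c = 0.
Proof.
have : kermx c != 0.
  rewrite -mxrank_eq0 mxrank_ker subn_eq0 -ltnNge.
  by rewrite (leq_ltn_trans (rank_leq_col c)).
move=> /rowV0Pn[x xk xn0]; exists x => //.
exact/sub_kermxP.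
Qed.

Section MinMax.
Variables (M : nat) (T : @operator R) (e : 'I_M -> R -> C) (l : 'I_M -> (R -> C) -> C) (b : R).
Hypothesis bT : bounded_operator T.
Hypothesis Le : forall m, L2 (e m).
Hypothesis ne : forall y : 'I_M -> C,
  sqnorm (fun x => \sum_m y m * e m x) = (\sum_m cmod (y m) ^+ 2)%:E.
Hypothesis lae : forall i f g, L2 f -> L2 g -> aeq f g -> l i f = l i g.
Hypothesis llin : forall i (a : 'I_M -> C) (f : 'I_M -> R -> C), (forall m, L2 (f m)) ->
  l i (fun x => \sum_m a m * f m x) = \sum_m a m * l i (f m).
Hypothesis b0 : 0 <= b.
Hypothesis bessel : forall f, L2 f -> ((\sum_i cmod (l i f) ^+ 2)%:E <= b%:E * sqnorm f)%E.

Variables (P W : 'M[C]_M) (t : 'I_M -> R).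
Let B := \matrix_(j, i) l i (T (e j)).
Hypothesis PP : P *m P^t* = 1%:M.
Hypothesis PB : P *m B = W.
Hypothesis t0 : forall k, 0 <= t k.
Hypothesis WW : W *m W ^t* = diag_mx (\row_k ((t k) ^+ 2)%:C).

(** The easy half of the min-max principle. Let A have rank at most k. Among the
    combinations of the k+1 functions that correspond to the rows idx j of P, some
    g of norm 1 is mapped to 0 by A. The coordinates l of T g are the coefficients
    of a combination of rows of W, all of length at least tau, so they have norm
    at least tau. Hence tau^2 <= b |T g|^2 = b |(T - A) g|^2 by Bessel's
    inequality with constant b. *)
Lemma singular_number_ge (k : nat) (idx : 'I_k.+1 -> 'I_M) (tau : R) :
  injective idx -> 0 <= tau -> (forall j, tau <= t (idx j)) ->
  (tau%:E <= (Num.sqrt b)%:E * singular_number k T)%E.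
Proof.
move=> injx tau0 htau.
have key A : bounded_operator A -> rank_le k A ->
   (tau%:E <= (Num.sqrt b)%:E * opnorm (fun f x => T f x - A f x)%R)%E.
  move=> bA [u Lu rA].
  have [TL _ _] := bT; have [AL _ Abd] := bA.
  pose v j := fun x => \sum_m P (idx j) m * e m x.
  have Lv j : L2 (v j) by exact: L2_sum.
  have /choice[c hc] : forall j : 'I_k.+1, exists c : 'I_k -> C,
      aeq (A (v j)) (fun x => \sum_(i < k) c i * u i x).
    by move=> j; exact: rA.
  have [x0 x0n0 x0c] := left_kernel (\matrix_(j, i) c j i).
  pose nx := \sum_j cmod (x0 0 j) ^+ 2.
  have nx0 : 0 < nx.
    rewrite lt_neqAle sumr_ge0 ?andbT => [|j _]; last by rewrite sqr_ge0.
    apply: contra x0n0; rewrite eq_sym psumr_eq0 => [/allP h|j _]; last by rewrite sqr_ge0.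
    apply/eqP/rowP => j; rewrite mxE; apply/eqP.
    have := h j; rewrite mem_index_enum => /(_ isT) /=.
    by rewrite sqrf_eq0 => /eqP hj; rewrite -normr_eq0 cmodE hj.
  (* x0 is rescaled to the unit vector x. *)
  pose s := (Num.sqrt nx)^-1.
  have s0 : 0 <= s by rewrite invr_ge0 sqrtr_ge0.
  pose x j := s%:C * x0 0 j.
  have xc i : \sum_j x j * c j i = 0.
    have := congr1 (fun X : 'rV[C]_k => X 0 i) x0c; rewrite !mxE => h.
    transitivity (s%:C * 0); last by rewrite mulr0.
    rewrite -[X in _ * X]h mulr_sumr; apply: eq_bigr => j _.
    by rewrite mulrA mxE.
  have nx1 : \sum_j cmod (x j) ^+ 2 = 1.
    rewrite (eq_bigr (fun j => s ^+ 2 * cmod (x0 0 j) ^+ 2)); last first.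
      by move=> j _; rewrite cmodM cmodR// exprMn.
    by rewrite -mulr_sumr exprVn sqr_sqrtr ?(ltW nx0)// mulVf// gt_eqF.
  (* x as a row vector indexed by all rows of P, with zeros outside the image of
     idx. *)
  pose X : 'rV[C]_M := \row_m \sum_(j | idx j == m) x j.
  have Xidx j : X 0 (idx j) = x j.
    by rewrite mxE (eq_bigl (pred1 j)) ?big_pred1_eq// => i; rewrite /= (inj_eq injx).
  have sumX (G : 'I_M -> C) : \sum_m X 0 m * G m = \sum_j x j * G (idx j).
    rewrite (partition_big idx xpredT)//=; apply: eq_bigr => m _.
    by rewrite mxE mulr_suml; apply: eq_bigr => j /eqP <-.
  have sumX2 (G : 'I_M -> R) :
      \sum_m cmod (X 0 m) ^+ 2 * G m = \sum_j cmod (x j) ^+ 2 * G (idx j).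
    rewrite [RHS](partition_big idx xpredT)//=; apply: eq_bigr => m _.
    case: (pickP (fun j => idx j == m)) => [j /eqP jm|h].
      rewrite (eq_bigl (pred1 j)) ?big_pred1_eq -?jm ?Xidx// => i.
      by rewrite /= (inj_eq injx).
    by rewrite big_pred0// mxE big_pred0// cmod0 expr0n mul0r.
  pose y : 'rV[C]_M := X *m P.
  pose g := fun z => \sum_m y 0 m * e m z.
  have gE : g = fun z => \sum_j x j * v j z.
    apply/funext => z; rewrite /g /v -(sumX (fun m => \sum_m0 P m m0 * e m0 z)).
    rewrite (eq_bigr (fun m => \sum_j X 0 j * P j m * e m z)); last first.
      by move=> m _; rewrite /y mxE mulr_suml.
    rewrite exchange_big /=; apply: eq_bigr => j _; rewrite mulr_sumr.
    by apply: eq_bigr => m _; rewrite mulrA.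
  have Lg : L2 g by exact: L2_sum.
  have PWW : P *m P^t* = diag_mx (\row_k ((1 : R) ^+ 2)%:C).
    by rewrite PP; apply/matrixP => i j; rewrite !mxE expr1n.
  have ng : sqnorm g = 1%:E.
    rewrite /g ne; congr EFin; rewrite (sum_sqr_mulmx _ PWW).
    by rewrite sumX2 -[RHS]nx1; apply: eq_bigr => j _; rewrite expr1n mulr1.
  have Ag : aeq (A g) (fun=> 0).
    rewrite gE; apply: aeq_trans (operator_sum _ _ bA Lv) _.
    have F := ae_filter_ringOfSetsType leb.
    have hall := @filter_forall _ _ (fun j z => Rp z -> A (v j) z = \sum_(i < k) c j i * u i z)
      _ F (fun j => hc j).
    apply: (@filterS _ _ F _ _ _ hall) => z h Rz.
    rewrite (eq_bigr (fun j => \sum_(i < k) x j * c j i * u i z)); last first.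
      by move=> j _; rewrite h// mulr_sumr; apply: eq_bigr => i _; rewrite mulrA.
    rewrite exchange_big big1//= => i _.
    by rewrite -mulr_suml xc mul0r.
  have Tg : sqnorm (fun z => T g z - A g z) = sqnorm (T g).
    have [mT _] := TL g Lg; have [mA _] := AL g Lg.
    apply: sqnorm_ae => //.
      rewrite (_ : (fun z => _) = (fun z => T g z + (-1) * A g z)); last first.
        by apply/funext => z; rewrite mulN1r.
      by apply: cmeasurableD => //; apply: cmeasurableM => //; exact: cmeasurable_cst.
    have F := ae_filter_ringOfSetsType leb.
    by apply: (@filterS _ _ F _ _ _ Ag) => z h Rz; rewrite h// subr0.
  have lTg i : l i (T g) = (X *m W) 0 i.
    rewrite (lae i (TL g Lg) (L2_sum _ _ (fun m => TL _ (Le m))) (operator_sum _ _ bT Le)).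
    rewrite llin; last by move=> m; exact: TL.
    rewrite -PB mulmxA -/y [RHS]mxE; apply: eq_bigr => m _.
    by congr (_ * _); rewrite mxE.
  have h1 : ((tau ^+ 2)%:E <= b%:E * sqnorm (T g))%E.
    apply: le_trans (bessel (TL g Lg)); rewrite lee_fin.
    rewrite (eq_bigr (fun i => cmod ((X *m W) 0 i) ^+ 2)); last by move=> i _; rewrite lTg.
    rewrite (sum_sqr_mulmx _ WW) sumX2 -[tau ^+ 2]mul1r -nx1 mulr_suml.
    apply: ler_sum => j _; rewrite ler_wpM2l ?sqr_ge0//.
    by rewrite ler_pXn2r ?nnegrE.
  have h2 : (L2norm (fun z => T g z - A g z)%R <= opnorm (fun f x => T f x - A f x)%R)%E.
    by apply: ereal_sup_ubound; exists g => //; split => //; rewrite L2norm_le// ng expr1n.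
  apply: (@le_trans _ _ ((Num.sqrt b)%:E * L2norm (fun z => T g z - A g z)%R)%E); last first.
    by apply: lee_wpmul2l => //; rewrite lee_fin sqrtr_ge0.
  rewrite L2normE Tg -lee_sqr ?lee_fin// ?mule_ge0 ?lee_fin ?sqrtr_ge0 ?sqrte_ge0//.
  rewrite !expe2 muleACA -!expe2 sqr_sqrte ?sqnorm_ge0//.
  have -> : ((Num.sqrt b)%:E ^+ 2 = b%:E)%E by rewrite expe2 -EFinM -expr2 sqr_sqrtr.
  by rewrite expe2 -EFinM -expr2.
(* The bound key is going to be divided by sqrt b; if b = 0, it gives tau = 0 at
   once. *)
have [bz|bz] := eqVneq (Num.sqrt b) 0.
  have [TL TT Tb] := bT.
  have := key (fun _ _ => 0); rewrite bz !mul0e; apply.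
    split; first by move=> *; exact: L2_0.
      by move=> a f g _ _; apply: aeW => x _; rewrite mulr0 addr0.
    apply: le_lt_trans (@opnorm_le _ _ 0 _ _) (ltry _) => // f _.
    by rewrite sqnorm0 expr0n mul0e.
  exists (fun=> fun=> 0) => [i|f _]; first exact: L2_0.
  by exists (fun=> 0); apply: aeW => x _; rewrite big1// => i _; rewrite mul0r.
have sb : 0 < Num.sqrt b by rewrite lt_def bz sqrtr_ge0.
rewrite -lee_pdivrMl//; apply: le_ereal_inf_tmp => _ [A [bA rA] <-].
by rewrite lee_pdivrMl//; exact: key.
Qed.

(** The k+1 largest singular values are all at least the k-th one in decreasing
    order, so singular_number_ge applies to each k. *)
Lemma sum_singular_values_le (p : R) : 0 < p ->
  ((\sum_k t k `^ p)%:E <= \sum_(0 <= k < M) ((Num.sqrt b)%:E * singular_number k T) `^ p)%E.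
Proof.
move=> p0; pose L := sort (fun i j => t j <= t i) (enum 'I_M).
have sL : size L = M by rewrite size_sort size_enum_ord.
have uL : uniq L by rewrite sort_uniq enum_uniq.
have tot : total (fun i j : 'I_M => t j <= t i) by move=> i j; exact: le_total.
have trans : transitive (fun i j : 'I_M => t j <= t i).
  by move=> j i m ji mj; exact: le_trans mj ji.
have srt : sorted (fun i j => t j <= t i) L by exact: sort_sorted.
have -> : \sum_k t k `^ p = \sum_(i <- L) t i `^ p.
  have pL : perm_eq L (enum 'I_M) by rewrite perm_sort.
  by rewrite [RHS](perm_big _ pL) [RHS]big_enum.
case: (posnP M) => [M0|M0].
  rewrite (_ : L = [::]) ?big_nil; last by apply: size0nil; rewrite sL M0.
  by apply: sume_ge0 => k _; exact: poweR_ge0.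
pose i0 := Ordinal M0.
rewrite (big_nth i0) sL -sumEFin !big_mkord; apply: lee_sum => k _.
rewrite -poweR_EFin; apply: gt0_ler_poweR; first exact: ltW.
- by rewrite in_itv /= lee_fin t0 leey.
- by rewrite in_itv /= leey andbT mule_ge0 ?lee_fin ?sqrtr_ge0 ?singular_number_ge0.
apply: (@singular_number_ge k (fun j : 'I_k.+1 => nth i0 L j)) => //.
  move=> i j /eqP; rewrite nth_uniq ?sL//.
  - by move=> /eqP h; exact: val_inj.
  - exact: leq_trans (ltn_ord i) _.
  - exact: leq_trans (ltn_ord j) _.
move=> j; have := sorted_leq_nth trans (fun i => lexx (t i)) i0 srt.
move=> h; apply: (h j k); rewrite ?inE ?sL//.
  exact: leq_trans (ltn_ord j) _.
by rewrite -ltnS.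
Qed.

End MinMax.
End LowerBound.

(** * Necessity of the condition on phi *)

Section TestFunctions.
Context {R : realType}.
Local Notation C := (complex R).
Local Notation leb := (@lebesgue_measure R).
Local Notation Rp := (@Rplus R).
Let mRp : measurable Rp.
Proof. exact: measurable_Rplus. Qed.
#[local] Hint Resolve mRp : core.
#[local] Hint Resolve int_sqr_ge0 : core.
Implicit Types (f g phi : R -> C) (n : int).

Definition in_dyad n (x : R) : bool := 2 ^ n <= x < 2 ^ (n + 1).

Lemma in_dyadP n x : dyad n x <-> in_dyad n x.
Proof. exact: dyadP. Qed.

Lemma in_dyad_Rplus n x : in_dyad n x -> 0 < x.
Proof. by move=> /andP[h _]; exact: lt_le_trans (two_gt0 n) h. Qed.

Lemma measurable_in_dyad n : measurable_fun setT (fun x : R => (in_dyad n x)%:R : R).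
Proof.
apply: (@measurable_boolR _ _ _ (fun x => in_dyad n x)).
by apply: measurable_and; [exact: measurable_fun_ler|exact: measurable_fun_ltr].
Qed.

Lemma in_dyad_uniq n m x : in_dyad n x -> in_dyad m x -> n = m.
Proof. by move=> /in_dyadP h1 /in_dyadP h2; exact: dyad_uniq h1 h2. Qed.

(** The integral of test_fun n. *)
Definition test_mass n : R := Num.sqrt (2 ^ (n - 1)).

Lemma test_mass_gt0 n : 0 < test_mass n.
Proof. by rewrite sqrtr_gt0 two_gt0. Qed.

Lemma test_mass2 n : test_mass n ^+ 2 = 2 ^ (n - 1).
Proof. by rewrite sqr_sqrtr// ltW// two_gt0. Qed.

(** The support is the dyadic interval preceding the n-th one, so that it lies to
    the left of every point at which T (test_fun n) is evaluated. *)
Definition test_fun n (x : R) : C := ((test_mass n)^-1 * (in_dyad (n - 1) x)%:R)%:C.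

Lemma cmod_test_fun n x : cmod (test_fun n x) = (test_mass n)^-1 * (in_dyad (n - 1) x)%:R.
Proof. by rewrite cmodR// mulr_ge0// invr_ge0 ltW// test_mass_gt0. Qed.

Lemma cmeasurable_test_fun n D : cmeasurable D (test_fun n).
Proof.
apply: cmeasurable_real; apply: measurable_funTS; apply: measurable_funM => //.
exact: measurable_in_dyad.
Qed.

Lemma test_bcs n : bounded_compact_support (test_fun n).
Proof.
split; first exact: cmeasurable_test_fun.
  exists (test_mass n)^-1 => x _; rewrite cmod_test_fun.
  by case: (in_dyad _ _); rewrite ?mulr1// mulr0 invr_ge0 ltW// test_mass_gt0.
exists `[(2 : R) ^ (n - 1), (2 : R) ^ (n - 1 + 1)]%classic; split.
- exact: segment_compact.
- move=> x /=; rewrite /Rplus /= !in_itv /= andbT => /andP[h _].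
  exact: lt_le_trans (two_gt0 _) h.
- move=> x _ /= h; rewrite /test_fun; case: (boolP (in_dyad _ _)) => [/andP[h1 h2]|]; last by rewrite mulr0.
  by case: h; rewrite in_itv /= h1 ltW.
Qed.

Lemma int_in_dyad (D : set R) m (h : R -> R) : dyad m `<=` D ->
  (\int[leb]_(x in D) (h x * (in_dyad m x)%:R)%:E = \int[leb]_(x in dyad m) (h x)%:E)%E.
Proof. by move=> mD; apply: integral_indicator => // x; exact: in_dyadP. Qed.

Lemma int_cst_dyad m (c : R) : (\int[leb]_(x in dyad m) c%:E = (c * 2 ^ m)%:E)%E.
Proof.
transitivity (c%:E * leb (dyad m))%E; first exact: (integral_cst leb (@measurable_dyad R m) c%:E).
by rewrite leb_dyad.
Qed.

Lemma test_mass_inv n : (test_mass n)^-1 * 2 ^ (n - 1) = test_mass n.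
Proof. by rewrite -test_mass2 expr2 mulKf// gt_eqF// test_mass_gt0. Qed.

Lemma test_integral (D : set R) n : measurable D -> dyad (n - 1) `<=` D ->
  cintegrable D (test_fun n) /\ cintegral D (test_fun n) = (test_mass n)%:C.
Proof.
move=> mD dD.
have I : (\int[leb]_(x in D) ((test_mass n)^-1 * (in_dyad (n - 1) x)%:R)%:E = (test_mass n)%:E)%E.
  by rewrite int_in_dyad// int_cst_dyad test_mass_inv.
split.
  split; first exact: cmeasurable_test_fun.
  by under eq_integral do rewrite cmod_test_fun; rewrite I ltry.
rewrite /cintegral /test_fun /= /Rintegral I /=.
by rewrite integral0_eq.
Qed.

Lemma sqnorm_test_fun n : sqnorm (test_fun n) = 1%:E.
Proof.
rewrite /sqnorm.
transitivity (\int[leb]_(x in Rp) ((test_mass n)^-1 ^+ 2 * (in_dyad (n - 1) x)%:R)%:E)%E.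
  apply: eq_integral => x _; rewrite cmod_test_fun exprMn.
  by case: (in_dyad _ _); rewrite ?expr1n ?expr0n.
rewrite int_in_dyad; last exact: dyad_Rplus.
by rewrite int_cst_dyad exprVn test_mass2 mulVf// gt_eqF// two_gt0.
Qed.

(** For y in the support of test_fun n the maximum of x and y is x. *)
Lemma Qop_test phi n x : dyad n x -> Qop phi (test_fun n) x = phi x * (test_mass n)%:C.
Proof.
move=> /in_dyadP/andP[x1 x2].
have [h1 h2] := test_integral mRp (@dyad_Rplus R (n - 1)).
rewrite -h2 -cintegralZ//; apply: eq_cintegral => y Ry.
rewrite /test_fun; case: (boolP (in_dyad _ _)) => [/andP[_ y2]|_]; last by rewrite mulr0 !mulr0.
congr (phi _ * _); apply/max_idPl; rewrite subrK in y2.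
by rewrite ltW// (lt_le_trans y2).
Qed.

Lemma Qop_plus_test phi n x : dyad n x -> Qop_plus phi (test_fun n) x = phi x * (test_mass n)%:C.
Proof.
move=> /in_dyadP/andP[x1 x2]; have mI : measurable (`]0, x[ : set R) by exact: measurable_itv.
have [|_ h2] := test_integral mI (n := n); last by rewrite /Qop_plus h2.
move=> y /in_dyadP yD; rewrite /= in_itv /= (in_dyad_Rplus yD) /=.
by move: yD => /andP[_]; rewrite subrK => /lt_le_trans; apply.
Qed.

Lemma sqnorm_test_sum M (N : 'I_M -> int) (y : 'I_M -> C) : injective N ->
  sqnorm (fun x => \sum_m y m * test_fun (N m) x) = (\sum_m cmod (y m) ^+ 2)%:E.
Proof.
move=> injN; rewrite /sqnorm.
transitivity (\int[leb]_(x in Rp) (\sum_m (cmod (y m) ^+ 2)%:E * (cmod (test_fun (N m) x) ^+ 2)%:E))%E.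
  apply: eq_integral => x _; rewrite (eq_bigr (fun m => (cmod (y m) ^+ 2 * cmod (test_fun (N m) x) ^+ 2)%:E))//.
  rewrite sumEFin; congr EFin.
  case: (pickP (fun m => in_dyad (N m - 1) x)) => [m xm|h].
    have z j : j != m -> test_fun (N j) x = 0.
      move=> jm; rewrite /test_fun; case: (boolP (in_dyad _ _)) => [xj|_]; last by rewrite mulr0.
      by have /addIr/injN jE := in_dyad_uniq xj xm; rewrite jE eqxx in jm.
    have e1 : \sum_j y j * test_fun (N j) x = y m * test_fun (N m) x.
      by rewrite (bigD1 m)// big1; [exact: addr0|move=> j /z ->; rewrite mulr0].
    have e2 : \sum_j cmod (y j) ^+ 2 * cmod (test_fun (N j) x) ^+ 2 =
        cmod (y m) ^+ 2 * cmod (test_fun (N m) x) ^+ 2.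
      rewrite (bigD1 m)// big1; first exact: addr0.
      by move=> j /z ->; rewrite cmod0 expr0n mulr0.
    by rewrite e1 e2 cmodM exprMn.
  have z j : test_fun (N j) x = 0 by rewrite /test_fun h mulr0.
  by rewrite !big1 ?cmod0 ?expr0n// => j _; rewrite z ?mulr0// cmod0 expr0n mulr0.
rewrite ge0_integral_sum//; last 2 first.
- move=> m; apply: emeasurable_funM => //; apply/measurable_EFinP.
  by apply: measurable_funX; apply: measurable_cmod => //; exact: cmeasurable_test_fun.
- by move=> m x _; rewrite mule_ge0 ?lee_fin ?sqr_ge0.
rewrite -sumEFin; apply: eq_bigr => m _.
rewrite ge0_integralZl//.
- by have := sqnorm_test_fun (N m); rewrite /sqnorm => ->; rewrite mule1.
- apply/measurable_EFinP; apply: measurable_funX; apply: measurable_cmod => //.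
  exact: cmeasurable_test_fun.
- by move=> x _; rewrite lee_fin sqr_ge0.
- by rewrite lee_fin sqr_ge0.
Qed.

Section Converse.
Variables (p : R) (phi : R -> C) (T : @operator R).
Hypothesis p1 : 1 < p.
Hypothesis mphi : cmeasurable Rp phi.
Hypothesis sT : schatten p T.
Hypothesis hT : forall n, {ae leb, forall x, dyad n x -> T (test_fun n) x = phi x * (test_mass n)%:C}.

Let bT : bounded_operator T.
Proof. by case: sT. Qed.
Let TL f : L2 f -> L2 (T f).
Proof. by case: bT => h _ _; exact: h. Qed.
Let L2test_fun n : L2 (test_fun n).
Proof. by apply/L2E; split; [exact: cmeasurable_test_fun|rewrite sqnorm_test_fun ltry]. Qed.

Let mphid n : cmeasurable (dyad n) phi.
Proof. exact: cmeasurable_sub (@dyad_Rplus R n) mphi. Qed.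

Let mphi2 n : measurable_fun (dyad n) (fun x => (cmod (phi x) ^+ 2)%:E).
Proof.
apply/measurable_EFinP; apply: measurable_funX; apply: measurable_cmod => //.
exact: measurable_dyad.
Qed.

(** Local square integrability of phi is read off from T (test_fun n), which is in
    L^2. *)
Let phi_fin n : (\int[leb]_(x in dyad n) (cmod (phi x) ^+ 2)%:E < +oo)%E.
Proof.
have /L2E[mTe nTe] := TL (L2test_fun n).
have : (\int[leb]_(x in dyad n) (cmod (T (test_fun n) x) ^+ 2)%:E < +oo)%E.
  apply: le_lt_trans nTe; apply: ge0_subset_integral => //.
  - exact: measurable_dyad.
  - by apply/measurable_EFinP; apply: measurable_funX; exact: measurable_cmod.
  - by move=> x _; rewrite lee_fin sqr_ge0.
  - exact: dyad_Rplus.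
rewrite (_ : integral _ _ _ = (2 ^ (n - 1))%:E * \int[leb]_(x in dyad n) (cmod (phi x) ^+ 2)%:E)%E.
  move=> h; rewrite ltNge leye_eq; apply/negP => /eqP E; move: h.
  by rewrite E gt0_muley ?lte_fin ?two_gt0.
rewrite -ge0_integralZl//; last 4 first.
- exact: measurable_dyad.
- exact: mphi2.
- by move=> x _; rewrite lee_fin sqr_ge0.
- by rewrite lee_fin ltW// two_gt0.
apply: ge0_ae_eq_integral.
- exact: measurable_dyad.
- apply/measurable_EFinP; apply: measurable_funX; apply: measurable_cmod.
    exact: measurable_dyad.
  exact: cmeasurable_sub (@dyad_Rplus R n) mTe.
- by apply: emeasurable_funM; [exact: measurable_cst|exact: mphi2].
- by move=> x _; rewrite lee_fin sqr_ge0.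
- by move=> x _; rewrite mule_ge0// lee_fin ?sqr_ge0// ltW// two_gt0.
have F := ae_filter_ringOfSetsType leb.
apply: (@filterS _ _ F _ _ _ (hT n)) => x /= h xn.
rewrite h// cmodM cmodR ?(ltW (test_mass_gt0 n))// exprMn test_mass2 -EFinM.
by rewrite mulrC.
Qed.

Let q n := fine (\int[leb]_(x in dyad n) (cmod (phi x) ^+ 2)%:E).
Let hq n : (\int[leb]_(x in dyad n) (cmod (phi x) ^+ 2)%:E = (q n)%:E)%E.
Proof.
rewrite fineK// ge0_fin_numE; first exact: phi_fin.
exact: int_sqr_ge0.
Qed.
Let q0 n : 0 <= q n.
Proof. by rewrite -lee_fin -hq int_sqr_ge0. Qed.

Let s n : R := (Num.sqrt (q n))^-1.
(** The conjugate of phi on the n-th dyadic interval, normalized in L^2; it is 0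
    if phi vanishes almost everywhere there, because then s n is the inverse of 0. *)
Let psi n (x : R) : C :=
  Complex (s n * (in_dyad n x)%:R * complex.Re (phi x)) (- (s n * (in_dyad n x)%:R * complex.Im (phi x))).

Let s0 n : 0 <= s n.
Proof. by rewrite invr_ge0 sqrtr_ge0. Qed.

Let phi_psi n x : phi x * psi n x = (s n * cmod (phi x) ^+ 2 * (in_dyad n x)%:R)%:C.
Proof.
rewrite cmod_sqr /psi; case: (phi x) => a b /=; apply/eqP; rewrite eq_complex /=.
by apply/andP; split; apply/eqP; case: (in_dyad n x) => /=; ring.
Qed.

Let cmod_psi2 n x : cmod (psi n x) ^+ 2 = (s n ^+ 2 * cmod (phi x) ^+ 2) * (in_dyad n x)%:R.
Proof.
rewrite !cmod_sqr /psi; case: (phi x) => a b /=.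
by case: (in_dyad n x) => /=; ring.
Qed.

Let mpsi n : cmeasurable Rp (psi n).
Proof.
have [m1 m2] := mphi.
have mi : measurable_fun Rp (fun x : R => s n * (in_dyad n x)%:R).
  by apply: measurable_funM => //; apply: measurable_funTS; exact: measurable_in_dyad.
split => /=; first exact: measurable_funM.
by apply: measurableT_comp => //; exact: measurable_funM.
Qed.

Let sq1 n : s n ^+ 2 * q n <= 1.
Proof.
rewrite /s exprVn sqr_sqrtr//; have [->|qn] := eqVneq (q n) 0; first by rewrite mulr0.
by rewrite mulVf.
Qed.

Let sqnorm_psi n : (sqnorm (psi n) <= 1%:E)%E.
Proof.
rewrite /sqnorm.
rewrite (_ : integral _ _ _ = \int[leb]_(x in Rp) ((s n ^+ 2 * cmod (phi x) ^+ 2) * (in_dyad n x)%:R)%:E)%E; last first.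
  by apply: eq_integral => x _; rewrite cmod_psi2.
rewrite int_in_dyad; last exact: dyad_Rplus.
under eq_integral do rewrite EFinM.
rewrite ge0_integralZl//.
- by rewrite hq -EFinM lee_fin.
- exact: measurable_dyad.
- exact: mphi2.
- by move=> x _; rewrite lee_fin sqr_ge0.
- by rewrite lee_fin sqr_ge0.
Qed.

Let L2psi n : L2 (psi n).
Proof. by apply/L2E; split => //; apply: le_lt_trans (sqnorm_psi n) (ltry _). Qed.

Let l n f := cintegral Rp (fun x => f x * psi n x).

Let l_sqr n f : L2 f ->
  ((cmod (l n f) ^+ 2)%:E <= 2%:E * \int[leb]_(x in dyad n) (cmod (f x) ^+ 2)%:E)%E.
Proof.
move=> fL2; have [mf _] := fL2.
apply: le_trans (cintegral_sqr_le mRp (cmeasurableM mf (mpsi n))) _.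
apply: lee_wpmul2l => //.
have mcf := measurable_cmod mRp mf.
have mu : measurable_fun Rp (fun x => cmod (f x) * (in_dyad n x)%:R).
  by apply: measurable_funM => //; apply: measurable_funTS; exact: measurable_in_dyad.
have := cauchy_schwarz mRp mu (measurable_cmod mRp (mpsi n)).
move=> /(_ _ _) h; apply: le_trans (le_trans _ (h _ _)) _.
- rewrite le_eqVlt; apply/orP; left; apply/eqP; congr expe; apply: eq_integral => x _.
  rewrite cmodM; congr EFin; case: (boolP (in_dyad n x)) => xn; first by rewrite mulr1.
  have : cmod (psi n x) ^+ 2 = 0 by rewrite cmod_psi2 (negbTE xn) mulr0.
  by move/eqP; rewrite sqrf_eq0 => /eqP ->; rewrite !mulr0.
- by move=> x _; rewrite mulr_ge0// cmod_ge0.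
- by move=> x _; rewrite cmod_ge0.
- rewrite -[leRHS]mule1; apply: lee_pmul; [exact: int_sqr_ge0|exact: int_sqr_ge0| |exact: sqnorm_psi].
  rewrite le_eqVlt; apply/orP; left; apply/eqP.
  transitivity (\int[leb]_(x in Rp) (cmod (f x) ^+ 2 * (in_dyad n x)%:R)%:E)%E; last first.
    exact: (int_in_dyad (fun x => cmod (f x) ^+ 2) (@dyad_Rplus R n)).
  apply: eq_integral => x _; rewrite exprMn.
  by case: (in_dyad n x); rewrite ?expr1n ?expr0n.
Qed.

(** The psi (N i) have disjoint supports and norm at most 1. The constant is 2
    instead of 1 because of cintegral_sqr_le. *)
Let bessel M (N : 'I_M -> int) : injective N -> forall f, L2 f ->
  ((\sum_i cmod (l (N i) f) ^+ 2)%:E <= 2%:E * sqnorm f)%E.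
Proof.
move=> injN f fL2; have [mf _] := fL2.
have mcf := measurable_cmod mRp mf.
rewrite -sumEFin; apply: le_trans (lee_sum _ (fun i _ => l_sqr (N i) fL2)) _.
rewrite -ge0_sume_distrr; last by move=> i _; exact: int_sqr_ge0.
apply: lee_wpmul2l => //.
have mh i : measurable_fun Rp (fun x => (cmod (f x) ^+ 2 * (in_dyad (N i) x)%:R)%:E).
  apply/measurable_EFinP; apply: measurable_funM; first exact: measurable_funX.
  by apply: measurable_funTS; exact: measurable_in_dyad.
have h0 i x : Rp x -> (0 <= (cmod (f x) ^+ 2 * (in_dyad (N i) x)%:R)%:E)%E.
  by move=> _; rewrite lee_fin mulr_ge0 ?sqr_ge0.
rewrite (eq_bigr (fun i => \int[leb]_(x in Rp) (cmod (f x) ^+ 2 * (in_dyad (N i) x)%:R)%:E)%E); last first.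
  by move=> i _; rewrite int_in_dyad//; exact: dyad_Rplus.
rewrite -ge0_integral_sum//; apply: ge0_le_integral => //.
- by move=> x Rx; apply: sume_ge0 => i _; exact: h0.
- exact: emeasurable_sum.
- by apply/measurable_EFinP; exact: measurable_funX.
- move=> x _; rewrite sumEFin lee_fin.
  case: (pickP (fun m => in_dyad (N m) x)) => [m xm|h]; last first.
    by rewrite big1 ?sqr_ge0// => i _; rewrite h mulr0.
  rewrite (bigD1 m)//= xm mulr1 big1 ?addr0// => j jm.
  case: (boolP (in_dyad (N j) x)) => [xj|_]; last by rewrite mulr0.
  by have /injN jE := in_dyad_uniq xj xm; rewrite jE eqxx in jm.
Qed.

Let l_ae n f g : L2 f -> L2 g -> aeq f g -> l n f = l n g.
Proof.
move=> fL2 gL2 fg; have [mf _] := fL2; have [mg _] := gL2.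
have [m1 m2] := cmeasurableM mf (mpsi n); have [m3 m4] := cmeasurableM mg (mpsi n).
have F := ae_filter_ringOfSetsType leb.
rewrite /l /cintegral /Rintegral; congr (fine _ +i* fine _).
- apply: ae_eq_integral => //; try exact/measurable_EFinP.
  by apply: (@filterS _ _ F _ _ _ fg) => x h Rx; rewrite h.
- apply: ae_eq_integral => //; try exact/measurable_EFinP.
  by apply: (@filterS _ _ F _ _ _ fg) => x h Rx; rewrite h.
Qed.

Let l_lin n M (a : 'I_M -> C) (f : 'I_M -> R -> C) : (forall m, L2 (f m)) ->
  l n (fun x => \sum_m a m * f m x) = \sum_m a m * l n (f m).
Proof.
move=> Lf.
have [E _] := cintegral_sum (index_enum 'I_M) a (fun i => L2_mul_int (Lf i) (L2psi n)).
rewrite /l -E; apply: eq_cintegral => x _; rewrite mulr_suml.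
by apply: eq_bigr => i _; rewrite mulrA.
Qed.

(** On the n-th dyadic interval T (test_fun n) * psi n is test_mass n * s n *
    |phi|^2. *)
Let l_diag n : cmod (l n (T (test_fun n))) = test_mass n * Num.sqrt (q n).
Proof.
have [mT _] := TL (L2test_fun n).
pose u x := test_mass n * s n * cmod (phi x) ^+ 2 * (in_dyad n x)%:R.
have Iu : (\int[leb]_(x in Rp) (u x)%:E = (test_mass n * Num.sqrt (q n))%:E)%E.
  rewrite int_in_dyad; last exact: dyad_Rplus.
  under eq_integral do rewrite EFinM.
  rewrite ge0_integralZl//.
  - rewrite hq -EFinM; congr EFin; rewrite -mulrA; congr (_ * _).
    rewrite /s -[q n in X in _ * X]sqr_sqrtr// expr2 mulrA; have [->|h] := eqVneq (Num.sqrt (q n)) 0.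
      by rewrite !mulr0.
    by rewrite mulVf// mul1r.
  - exact: measurable_dyad.
  - exact: mphi2.
  - by move=> x _; rewrite lee_fin sqr_ge0.
  - by rewrite lee_fin mulr_ge0// ltW// test_mass_gt0.
suff -> : l n (T (test_fun n)) = (test_mass n * Num.sqrt (q n))%:C.
  by rewrite cmodR// mulr_ge0 ?sqrtr_ge0// ltW// test_mass_gt0.
have mc := cmeasurableM mT (mpsi n).
have F := ae_filter_ringOfSetsType leb.
have ae : {ae leb, forall x, Rp x -> T (test_fun n) x * psi n x = (u x)%:C}.
  apply: (@filterS _ _ F _ _ _ (hT n)) => x h Rx.
  case: (boolP (in_dyad n x)) => xn.
    rewrite h; last exact/in_dyadP.
    rewrite mulrAC phi_psi -rmorphM /= /u; congr (_%:C); case: (in_dyad n x) => /=; ring.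
  rewrite /u (negbTE xn) mulr0.
  rewrite (_ : psi n x = 0) ?mulr0//; apply/eqP.
  by rewrite eq_complex /= (negbTE xn) !mulr0 !mul0r oppr0 eqxx.
have mphi2R : measurable_fun Rp (fun x => cmod (phi x) ^+ 2).
  by apply: measurable_funX; exact: measurable_cmod.
have mu : measurable_fun Rp u.
  apply: measurable_funM; first exact: measurable_funM.
  by apply: measurable_funTS; exact: measurable_in_dyad.
have [m1 m2] := mc.
rewrite /l /cintegral /Rintegral; congr (_ +i* _).
- transitivity (fine (\int[leb]_(x in Rp) (u x)%:E)%E); last by rewrite Iu.
  congr fine; apply: ae_eq_integral => //; try exact/measurable_EFinP.
  by apply: (@filterS _ _ F _ _ _ ae) => x h Rx; rewrite h.
- transitivity (fine (\int[leb]_(x in Rp) (0 : R)%:E)%E); last by rewrite integral0_eq.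
  congr fine; apply: ae_eq_integral => //; try exact/measurable_EFinP.
  by apply: (@filterS _ _ F _ _ _ ae) => x h Rx; rewrite h.
Qed.

(** The diagonal entries of B are sigma_n / sqrt 2, and Bessel's inequality with
    constant 2 costs another factor sqrt 2 in the comparison with the s_k(T). *)
Lemma Xspace_of_schatten : Xspace p phi.
Proof.
split => //.
have p0 : 0 < p by rewrite (lt_trans ltr01).
pose Ss := (\sum_(0 <= k <oo) singular_number k T `^ p)%E.
have Sfin : (Ss < +oo)%E by case: sT.
set a := (fun n : int => _).
have aE n : a n = (((test_mass n * Num.sqrt (q n)) `^ p) * (Num.sqrt 2 `^ p))%:E.
  rewrite /a Xspace_term// hq -EFinM poweR_EFin -powRM ?mulr_ge0 ?sqrtr_ge0//.
  congr EFin; rewrite /test_mass -!sqrtrM ?mulr_ge0 ?(ltW (two_gt0 _))//.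
  have -> : 2 ^ (n - 1) * q n * 2 = 2 ^ n * q n :> R.
    have -> : 2 ^ n = 2 * 2 ^ (n - 1) :> R by rewrite -two_exprzS subrK.
    by ring.
  have z0 : 0 <= 2 ^ n * q n by rewrite mulr_ge0// ltW// two_gt0.
  by rewrite -powR12_sqrt// -powRrM (mulrC _ p).
apply: (@le_lt_trans _ _ ((Num.sqrt 2 `^ p)%:E * ((Num.sqrt 2 `^ p)%:E * Ss))%E); last first.
  by rewrite lte_mul_pinfty ?lee_fin ?powR_ge0// lte_mul_pinfty ?lee_fin ?powR_ge0.
apply: ge_ereal_sup => _ [A [fA _] <-]; rewrite fsbig_finite//.
pose F : seq int := finmap.enum_fset (fset_set A).
have uF : uniq F by exact: finmap.fset_uniq.
rewrite -/F; clearbody F => {fA A}.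
pose M := size F; pose N (i : 'I_M) := nth 0 F i.
have injN : injective N.
  by move=> i j /eqP; rewrite nth_uniq// => /eqP h; exact: val_inj.
have -> : (\sum_(n <- F) a n = \sum_(i < M) a (N i))%E.
  by rewrite (big_nth 0) big_mkord.
pose e (i : 'I_M) := test_fun (N i).
pose B : 'M[C]_M := \matrix_(j, i) l (N i) (T (e j)).
have [P [W [t [PP PB t0 WW]]]] := svd B.
have Bd i : cmod (B i i) = test_mass (N i) * Num.sqrt (q (N i)) by rewrite mxE l_diag.
under eq_bigr do rewrite aE -Bd EFinM muleC.
rewrite -ge0_sume_distrr; last by move=> i _; rewrite lee_fin powR_ge0.
apply: lee_wpmul2l; first by rewrite lee_fin powR_ge0.
rewrite sumEFin.
apply: (@le_trans _ _ (\sum_k t k `^ p)%:E).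
  by rewrite lee_fin; exact: sum_diag_le PP PB t0 WW.
have lae i f g : L2 f -> L2 g -> aeq f g -> l (N i) f = l (N i) g by exact: l_ae.
have llin i (c : 'I_M -> C) (f : 'I_M -> R -> C) : (forall m, L2 (f m)) ->
    l (N i) (fun x => \sum_m c m * f m x) = \sum_m c m * l (N i) (f m).
  exact: l_lin.
have Le i : L2 (e i) by exact: L2test_fun.
have ne y := sqnorm_test_sum y injN.
have b2 : 0 <= 2 :> R by [].
apply: le_trans (sum_singular_values_le bT Le ne lae llin b2 (bessel injN) PP PB t0 WW p0) _.
under eq_bigr do rewrite poweRM ?lee_fin ?sqrtr_ge0 ?singular_number_ge0// poweR_EFin.
rewrite -ge0_sume_distrr; last by move=> i _; exact: poweR_ge0.
apply: lee_wpmul2l; first by rewrite lee_fin powR_ge0.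
by apply: nneseries_lim_ge => k _ _; exact: poweR_ge0.
Qed.

End Converse.

Lemma Xspace_of_in_schatten (p : R) (phi : R -> C) (Q : @operator R) :
  1 < p -> cmeasurable Rp phi ->
  (forall n x, dyad n x -> Q (test_fun n) x = phi x * (test_mass n)%:C) ->
  in_schatten p Q -> Xspace p phi.
Proof.
move=> p1 mphi hQ [T sT TQ].
apply: (Xspace_of_schatten p1 mphi sT) => n.
have F := ae_filter_ringOfSetsType leb.
apply: (@filterS _ _ F _ _ _ (TQ _ (test_bcs n))) => x h xn.
by rewrite h ?hQ//; exact: dyad_Rplus xn.
Qed.

End TestFunctions.

Theorem theorem3p3 (R : realType) (p : R) (phi : R -> complex R) :
  1 < p -> L1loc phi ->
  (in_schatten p (Qop phi) <-> in_schatten p (Qop_plus phi)) /\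
  (in_schatten p (Qop_plus phi) <-> Xspace p phi).
Proof.
move=> p1 [mphi _].
have fwd := in_schatten_of_Xspace p1.
have bwd := Xspace_of_in_schatten p1 mphi.
have bQ := bwd _ (Qop_test phi); have bQp := bwd _ (Qop_plus_test phi).
split; split.
- by move=> /bQ/fwd[].
- by move=> /bQp/fwd[].
- exact: bQp.
- by move=> /fwd[].
Qed.
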